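(* Let $n\ge1$, $K\ge2$, $m\ge 1$, $\mu\in\mathbb{R}^n$, $\sigma^2>0$ and $\rho\in[-1/(K-1),1]$ be fixed. Let $Y\sim\mathcal{N}(\mu,\sigma^2I_n)$, and let $(\omega^1,\ldots,\omega^K)$ be random vectors in $\mathbb{R}^n$, jointly independent of $Y$, forming an exchangeable normal randomization with correlation $\rho$. Let $g:\mathbb{R}^n\to\mathbb{R}^n$ be of the form \[ g(y)=f_0(y)+\sum_{\ell=1}^m a_\ell(y)\,\mathbf{1}\{h_\ell(y)>0\} \] with $f_0,a_1,\ldots,a_m:\mathbb{R}^n\to\mathbb{R}^n$ and $h_1,\ldots,h_m:\mathbb{R}^n\to\mathbb{R}$ satisfying the piecewise-smoothness conditions, and suppose $\mathbb{E}[\|g(Y)-Y\|_2^2]>0$. Then, as $\alpha\downarrow0$, \[ \mathbb{E}\left[\operatorname{Var}(\mathrm{CV}_\alpha\mid Y)\right]= \begin{cases} O(\alpha^{-1/2}) & \text{if }\rho=-\frac{1}{K-1},\\ \Theta(\alpha^{-1}) & \text{if }\rho>-\frac{1}{K-1}. \end{cases} \]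
   Context: Cross-validation estimator: for $\alpha>0$, \[ \mathrm{CV}_\alpha=\frac1K\sum_{k=1}^K\left\{\left\|g(Y+\sqrt\alpha\,\omega^k)-\left(Y-\tfrac{1}{\sqrt\alpha}\omega^k\right)\right\|_2^2-\frac1\alpha\|\omega^k\|_2^2\right\}. \] Exchangeable normal randomization with correlation $\rho$: (i) $(\omega^{\pi(1)},\ldots,\omega^{\pi(K)})$ has the same distribution as $(\omega^1,\ldots,\omega^K)$ for every permutation $\pi$ of $\{1,\ldots,K\}$; (ii) $\omega^k\sim\mathcal{N}(0,\sigma^2 I_n)$ for every $k$, and $\operatorname{Cov}(\omega^k,\omega^{k'})=\rho\sigma^2 I_n$ for every $k\ne k'$. Joint normality is not assumed. The joint law of $(\omega^1,\ldots,\omega^K)$ does not depend on $\alpha$. Smoothness-and-moment condition on a map $f:\mathbb{R}^n\to\mathbb{R}^n$: every component $f_i$ is weakly differentiable, meaning that there is a function $\nabla f_i:\mathbb{R}^n\to\mathbb{R}^n$ with \[ f_i(y+z)-f_i(y)=\int_0^1 z\cdot\nabla f_i(y+tz)\,dt\quad\text{for almost all } y,z\in\mathbb{R}^n; \] $\nabla f$ denotes the $n\times n$ Jacobian matrix with $i$-th row $\nabla f_i$; and there exists $\alpha_0>0$ such that, for $Z_{\alpha_0}\sim\mathcal{N}(\mu,(1+\alpha_0)\sigma^2I_n)$, $\mathbb{E}\|f(Z_{\alpha_0})\|_2^4<\infty$ and $\mathbb{E}\|\nabla f(Z_{\alpha_0})\|_{\mathrm F}^2<\infty$ ($\|\cdot\|_{\mathrm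 F}$ the Frobenius norm). Piecewise-smoothness conditions: (i) each of $f_0,a_1,\ldots,a_m$ satisfies the smoothness-and-moment condition; (ii) for each $\ell$, $h_\ell$ is Lipschitz with Lipschitz constant $L_\ell<\infty$; (iii) for each $\ell$ there exists $t_0>0$ such that $h_\ell(Y)$ has a density $p_\ell$ on $(-t_0,t_0)$ and, with $m_\ell(s)=\mathbb{E}\left[\|a_\ell(Y)\|_2^2\mid h_\ell(Y)=s\right]$, \[ \operatorname*{ess\,sup}_{|s|\le t_0}\ p_\ell(s)\,m_\ell(s)<\infty. \] *)

(* Defs.v *)
From HB Require Import structures.
From mathcomp Require Import all_boot all_order all_algebra all_fingroup.
From mathcomp Require Import all_classical all_reals all_analysis.
From mathcomp Require Import measurable_realfun ess_sup_inf.

Set Implicit Arguments.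
Unset Strict Implicit.
Unset Printing Implicit Defensive.

Import Order.TTheory GRing.Theory Num.Theory.
Import numFieldNormedType.Exports.

Local Open Scope classical_set_scope.
Local Open Scope ring_scope.

(* ['rV[R]_n] carries the sigma-algebra generated by the coordinates, that is,
   the Borel sigma-algebra of R^n. *)
Section measurable_rV.
Context {R : realType} (n : nat).

Let coord (i : 'I_n) (v : 'rV[R]_n) : R := v ord0 i.

Let rV_set0 : g_sigma_preimage coord set0.
Proof. exact: sigma_algebra0. Qed.

Let rV_setC A : g_sigma_preimage coord A -> g_sigma_preimage coord (~` A).
Proof. exact: sigma_algebraC. Qed.

Let rV_bigcup (F : _^nat) : (forall i, g_sigma_preimage coord (F i)) ->
  g_sigma_preimage coord (\bigcup_i (F i)).
Proof. exact: sigma_algebra_bigcup. Qed.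

HB.instance Definition _ := @isMeasurable.Build default_measure_display
  'rV[R]_n (g_sigma_preimage coord) rV_set0 rV_setC rV_bigcup.

Lemma measurable_rV_coord (i : 'I_n) :
  measurable_fun [set: 'rV[R]_n] (fun v : 'rV[R]_n => v ord0 i).
Proof.
move=> _ Y mY; rewrite setTI; apply: sub_sigma_algebra => /=.
rewrite -bigcup_seq/=; exists i => /=; first by rewrite mem_index_enum.
by exists Y => //; rewrite setTI.
Qed.

Lemma measurable_fun_rVP d (T : measurableType d) (f : T -> 'rV[R]_n) :
  measurable_fun [set: T] f <->
  forall i, measurable_fun [set: T] (fun x => f x ord0 i).
Proof.
split=> [mf i|mf].
  exact: (measurableT_comp (measurable_rV_coord i) mf).
suff : g_sigma_preimage (fun i => coord i \o f) `<=` measurable.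
  by rewrite g_sigma_preimage_comp => H _ A mA; apply: H; exists A.
apply: smallest_sub; first exact: sigma_algebra_measurable.
rewrite -bigcup_seq; apply: bigcup_sub => i _ A [B mB <-].
exact: mf.
Qed.

End measurable_rV.

Section product_measure_rV.
Context {R : realType}.

Definition cons_rV n (p : measurableTypeR R * 'rV[R]_n) : 'rV[R]_n.+1 :=
  \row_i oapp (fun j => p.2 ord0 j) p.1 (unlift ord0 i).

Lemma measurable_cons_rV n : measurable_fun setT (@cons_rV n).
Proof.
apply/measurable_fun_rVP => i.
have [j ij|i0] := unliftP ord0 i.
  rewrite [X in measurable_fun _ X](_ : _ = (fun v : 'rV[R]_n => v ord0 j) \o snd).
    by apply: measurableT_comp => //; exact: measurable_rV_coord.
  by apply/funext => p /=; rewrite mxE ij liftK.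
rewrite [X in measurable_fun _ X](_ : _ = fst) //.
by apply/funext => p /=; rewrite mxE i0 unlift_none.
Qed.

(* The product of the measures m i, by recursion on the first coordinate.  The
   canonical measure structure of [pushforward] is given by name because its
   measurability argument cannot be inferred. *)
Fixpoint product_rV n :
    ('I_n -> {sigma_finite_measure set (measurableTypeR R) -> \bar R}) ->
    {measure set 'rV[R]_n -> \bar R} :=
  match n with
  | 0 => fun _ => \d_(0 : 'rV[R]_0)
  | n'.+1 => fun m =>
      measure_function_pushforward__canonical__measure_function_Measure
        (m ord0 \x^ product_rV (fun i => m (lift ord0 i)))%E
        (@measurable_cons_rV n')
  end.


Lemma product_rV_box n
    (m : 'I_n -> {sigma_finite_measure set (measurableTypeR R) -> \bar R})
    (A : 'I_n -> set R) : (forall i, measurable (A i)) ->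
  product_rV m [set v | forall i, A i (v ord0 i)] = (\prod_i m i (A i))%E.
Proof.
elim: n => [|n IH] in m A *; move=> mA.
  by rewrite big_ord0 /= diracE mem_set// => -[].
rewrite big_ord_recl -IH//= /pushforward -product_measure2E//; last first.
  rewrite [X in measurable X](_ : _ =
    \bigcap_i ((fun v : 'rV[R]_n => v ord0 i) @^-1` A (lift ord0 i))).
    apply: fin_bigcap_measurable => // i _.
    by rewrite -[X in measurable X]setTI; exact: measurable_rV_coord.
  by apply/seteqP; split=> v /= H i; [move=> _; exact: H|exact: (H i)].
  exact: (mA ord0).
congr (_ _); apply/seteqP; split=> -[x v] /= H.
  split=> [|i]; first by have := H ord0; rewrite mxE unlift_none.
  by have := H (lift ord0 i); rewrite mxE liftK.
by move=> i; rewrite mxE; case: unliftP => [j|] -> /=; [exact: H.2|exact: H.1].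
Qed.

End product_measure_rV.

Definition lebesgue_rV (R : realType) n : {measure set 'rV[R]_n -> \bar R} :=
  @product_rV R n (fun=> lebesgue_measure).

(* The law N(mu, v I_n); [normal_prob] takes the standard deviation. *)
Definition normal_rV (R : realType) n (mu : 'rV[R]_n) (v : R) :
    {measure set 'rV[R]_n -> \bar R} :=
  @product_rV R n (fun i => normal_prob (mu ord0 i) (Num.sqrt v)).

(* The library norm [`|A|] of a matrix is the maximum norm.  [l2norm] is the
   Euclidean norm on ['rV[R]_n] and the Frobenius norm on ['M[R]_n]. *)
Definition l2norm (R : realType) m n (A : 'M[R]_(m, n)) : R :=
  Num.sqrt (\sum_i \sum_j A i j ^+ 2).

Section conditioning.
Context {R : realType} d (T : measurableType d) (P : probability T R).

(* [m] is a version of u |-> E[X | Z = u]: the composite of [m] and [Z] is a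
   version of E[X | Z]. *)
Definition is_cond_expectation d' (U : measurableType d') (Z : T -> U)
    (X : T -> R) (m : U -> R) : Prop :=
  [/\ P.-integrable [set: T] (EFin \o X),
      measurable_fun [set: U] m,
      P.-integrable [set: T] (EFin \o (m \o Z)) &
      forall B, measurable B ->
        (\int[P]_(w in Z @^-1` B) (m (Z w))%:E =
         \int[P]_(w in Z @^-1` B) (X w)%:E)%E].

Definition is_cond_variance d' (U : measurableType d') (Z : T -> U)
    (X : T -> R) (v : U -> R) : Prop :=
  exists2 m : U -> R, is_cond_expectation Z X m &
    is_cond_expectation Z (fun w => (X w - m (Z w)) ^+ 2) v.

(* e = E[Var(X | Z)]; in particular X and (X - E[X | Z])^2 are integrable. *)
Definition is_expected_cond_variance d' (U : measurableType d') (Z : T -> U)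
    (X : T -> R) (e : R) : Prop :=
  exists2 v : U -> R, is_cond_variance Z X v & e%:E = ('E_P[v \o Z])%E.

Lemma cond_expectation_unique d' (U : measurableType d') (Z : T -> U)
    (X : T -> R) (m1 m2 : U -> R) : measurable_fun [set: T] Z ->
  is_cond_expectation Z X m1 -> is_cond_expectation Z X m2 ->
  \forall w \ae P, m1 (Z w) = m2 (Z w).
Proof.
move=> mZ [_ mm1 im1 e1] [_ mm2 im2 e2].
have mZpre B : measurable B -> measurable (Z @^-1` B).
  by move=> mB; rewrite -[X in measurable X]setTI; exact: mZ.
pose Q := measure_function_pushforward__canonical__measure_function_Measure P mZ.
have mE1 : measurable_fun [set: U] (fun u => (m1 u)%:E) by exact/measurable_EFinP.
have mE2 : measurable_fun [set: U] (fun u => (m2 u)%:E) by exact/measurable_EFinP.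
have [N [mN QN0 subN]] : ae_eq Q setT (EFin \o m1) (EFin \o m2).
  apply: integral_ae_eq => //.
    exact: integrable_pushforward.
  move=> E _ mE.
  have mZE := mZpre _ mE.
  rewrite !integral_pushforward//.
  - by rewrite e1// e2.
  - exact: integrableS im2.
  - exact: integrableS im1.
exists (Z @^-1` N); split => //; first exact: mZpre.
by move=> w /= h; apply: subN => /= h'; apply: h; have [] := h' I.
Qed.

Lemma expected_cond_variance_unique d' (U : measurableType d') (Z : T -> U)
    (X : T -> R) (e1 e2 : R) : measurable_fun [set: T] Z ->
  is_expected_cond_variance Z X e1 -> is_expected_cond_variance Z X e2 ->
  e1 = e2.
Proof.
move=> mZ [v1 [m1 cm1 cv1] E1] [v2 [m2 cm2 cv2] E2].
apply/EFin_inj; rewrite E1 E2 !unlock /=.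
have [iX1 _ _ /(_ setT measurableT)] := cv1; rewrite preimage_setT => ->.
have [iX2 _ _ /(_ setT measurableT)] := cv2; rewrite preimage_setT => ->.
apply: ae_eq_integral => //.
- exact: measurable_int iX1.
- exact: measurable_int iX2.
apply: filterS (cond_expectation_unique mZ cm1 cm2) => w /= -> _ //.
Qed.

End conditioning.

Section randomization.
Context {R : realType} d (T : measurableType d) (P : probability T R).
Context (n K : nat).

Definition joint (omega : 'I_K -> T -> 'rV[R]_n) (w : T) : K.-tuple 'rV[R]_n :=
  [tuple omega k w | k < K].

Definition exchangeable_normal (sigma rho : R)
    (omega : 'I_K -> {RV P >-> 'rV[R]_n}) : Prop :=
  [/\ forall (s : 'S_K) B, measurable B ->
        P (joint (fun k => omega (s k)) @^-1` B) = P (joint omega @^-1` B),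
      forall k B, measurable B ->
        distribution P (omega k) B = normal_rV 0 (sigma ^+ 2) B &
      forall k k' i j, k != k' ->
        covariance P (fun w => omega k w ord0 i) (fun w => omega k' w ord0 j) =
        (rho * sigma ^+ 2 * (i == j)%:R)%:E].

Definition independent_joint (Y : T -> 'rV[R]_n)
    (omega : 'I_K -> T -> 'rV[R]_n) : Prop :=
  forall A B, measurable A -> measurable B ->
    (P ((Y @^-1` A) `&` (joint omega @^-1` B)) =
     P (Y @^-1` A) * P (joint omega @^-1` B))%E.

Definition CV (g : 'rV[R]_n -> 'rV[R]_n) (Y : T -> 'rV[R]_n)
    (omega : 'I_K -> T -> 'rV[R]_n) (alpha : R) (w : T) : R :=
  K%:R^-1 * \sum_(k < K)
    (l2norm (g (Y w + Num.sqrt alpha *: omega k w) -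
             (Y w - (Num.sqrt alpha)^-1 *: omega k w)) ^+ 2 -
     alpha^-1 * l2norm (omega k w) ^+ 2).

End randomization.

Section smoothness.
Context {R : realType} (n : nat).

(* A pair (y, z) in R^n x R^n is read as a point of R^(n + n).  The equation is
   in the extended reals: it fails if the right-hand integrand is not
   integrable. *)
Definition weak_gradient (phi : 'rV[R]_n -> R) (dphi : 'rV[R]_n -> 'rV[R]_n) :=
  \forall yz \ae lebesgue_rV R (n + n),
    let y := lsubmx yz in let z := rsubmx yz in
    ((phi (y + z) - phi y)%:E =
     \int[lebesgue_measure]_(t in `[0%R, 1%R])
       (\sum_j z ord0 j * dphi (y + t *: z) ord0 j)%:E)%E.

Definition smooth_moment (mu : 'rV[R]_n) (sigma : R)
    (f : 'rV[R]_n -> 'rV[R]_n) : Prop :=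
  measurable_fun [set: 'rV[R]_n] f /\
  exists Df : 'rV[R]_n -> 'M[R]_n,
  [/\ forall i, measurable_fun [set: 'rV[R]_n] (fun y => row i (Df y)),
      forall i, weak_gradient (fun y => f y ord0 i) (fun y => row i (Df y)) &
      exists2 alpha0 : R, 0 < alpha0 &
        let Z := normal_rV mu ((1 + alpha0) * sigma ^+ 2) in
        (\int[Z]_y (l2norm (f y) ^+ 4)%:E < +oo)%E /\
        (\int[Z]_y (l2norm (Df y) ^+ 2)%:E < +oo)%E].

Definition has_lipschitz_constant (h : 'rV[R]_n -> R) (L : R) : Prop :=
  forall y z, `|h y - h z| <= L * l2norm (y - z).

(* [p] is a density of h(Y) on ]-t0, t0[ and [ma s] is E[|a(Y)|^2 | h(Y) = s].
   Both are determined up to null sets, which the essential supremum ignores. *)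
Definition bounded_near_zero d (T : measurableType d) (P : probability T R)
    (Y : T -> 'rV[R]_n) (a : 'rV[R]_n -> 'rV[R]_n) (h : 'rV[R]_n -> R) : Prop :=
  exists t0 : R, 0 < t0 /\
  exists p ma : R -> R,
  [/\ measurable_fun [set: R] p /\ (forall s, 0 <= p s),
      forall B, measurable B -> B `<=` `]- t0, t0[ ->
        (P ((h \o Y) @^-1` B) = \int[lebesgue_measure]_(s in B) (p s)%:E)%E,
      is_cond_expectation P (h \o Y) (fun w => l2norm (a (Y w)) ^+ 2) ma &
      (ess_sup (mrestr lebesgue_measure (measurable_itv `[(- t0)%R, t0]))
        (fun s => (p s * ma s)%:E) < +oo)%E].

Definition piecewise_smooth d (T : measurableType d) (P : probability T R)
    (Y : T -> 'rV[R]_n) (mu : 'rV[R]_n) (sigma : R) (m : nat)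
    (f0 : 'rV[R]_n -> 'rV[R]_n) (a : 'I_m -> 'rV[R]_n -> 'rV[R]_n)
    (h : 'I_m -> 'rV[R]_n -> R) : Prop :=
  [/\ smooth_moment mu sigma f0,
      forall l, smooth_moment mu sigma (a l),
      forall l, exists L : R, has_lipschitz_constant (h l) L &
      forall l, bounded_near_zero P Y (a l) (h l)].

End smoothness.

(* Main.v *)
Require Import Defs.
From HB Require Import structures.
From mathcomp Require Import all_boot all_order all_algebra all_fingroup.
From mathcomp Require Import all_classical all_reals all_analysis.
From mathcomp Require Import measurable_realfun ess_sup_inf.
From mathcomp Require Import ring lra.

(** Write s for the square root of alpha and lambda = sigma^2 (1 + (K-1) rho) / K
    for the variance of each coordinate of the average perturbation.  Expanding
    the square in each fold, the terms |omega|^2 / alpha cancel and the estimator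
    becomes the sum of a linear part

      (2 / s) <mean of the omega^k, g(Y) - Y>

    and of a residual, the average over the folds of

      |g(Y + s omega) - Y|^2 + (2 / s) <omega, g(Y + s omega) - g(Y)>

    (fold_decomposition).  Given Y the linear part is centred, and its mean square
    is (4 / alpha) lambda E|g(Y) - Y|^2 (CV_linear_second_moment).  It vanishes
    exactly when lambda = 0, that is when rho = -1/(K-1): then the perturbations
    add up to zero.  It remains to prove that the residual has mean square
    O(1/s) = O(alpha^(-1/2)), which is fold_residual_bigO.  There the first term
    has bounded mean square, and the second one is governed by the increment of g,
    for which one needs

      E[|omega|^2 |g(Y + s omega) - g(Y)|^2] = O(s)

    (piecewise_increment_bigO).

    This increment splits into increments of f_0 and a_l, and jumps.  An increment
    of a smooth f is the integral of s <omega, Df(Y + t s omega)> over t in [0, 1],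
    so that its mean square is O(s^2) once the law of Y + t s omega is controlled
    uniformly in t.  Given omega, this law is N(mu, sigma^2) shifted by t s omega,
    and completing the square bounds it by N(mu, (1 + alpha_0) sigma^2) times a
    constant times the exponential of a small multiple of |omega|^2, which is
    integrable for small s (gaussP_shift_le, gauss_domination): this is where the
    moments at the inflated variance come in.  The indicator of h_l > 0 changes
    only if |h_l(Y)| <= L_l s |omega|, and by the boundedness of p_l m_l the
    mass of |a_l(Y)|^2 on this slab is O(s |omega|) (slab_mass_le).  These jumps
    make the increment O(s) instead of O(s^2), hence the exponent -1/2.

    For the conditional variance, independence of Y and of the perturbations lets
    one integrate the latter out with Y frozen (is_cond_expectation_frozen).  The
    expected conditional variance V is at most 4 E[CV^2], which gives both upper
    bounds.  Conversely, let m(Y) be the conditional mean of CV.  As the linear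
    part M is centred given Y, E[M^2] <= E[(M - m(Y))^2], which is at most twice V
    plus twice the mean square of the residual.  Since E|g(Y) - Y|^2 > 0, this
    gives the lower bound of order 1/alpha when lambda > 0
    (expected_variance_bounds). *)

Set Implicit Arguments.
Unset Strict Implicit.
Unset Printing Implicit Defensive.

Import Order.TTheory GRing.Theory Num.Theory.
Import numFieldNormedType.Exports.

Local Open Scope classical_set_scope.
Local Open Scope ring_scope.

Notation pushforward_measure m mphi :=
  (measure_function_pushforward__canonical__measure_function_Measure m mphi).

(** * Integration *)

Section density.
Context d (T : measurableType d) (R : realType).
Variables (mu nu : {measure set T -> \bar R}) (p : T -> R).
Hypothesis mp : measurable_fun setT p.
Hypothesis p0 : forall x, 0 <= p x.
Hypothesis nuE : forall A, measurable A ->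
  nu A = (\int[mu]_(x in A) (p x)%:E)%E.
Local Open Scope ereal_scope.
Import HBNNSimple.

Let nnsfun_density (h : {nnsfun T >-> R}) :
  \int[nu]_x (h x)%:E = \int[mu]_x ((h x)%:E * (p x)%:E).
Proof.
have mpE : measurable_fun [set: T] (fun x => (p x)%:E) by exact/measurable_EFinP.
transitivity (\int[nu]_x (\sum_(y \in range h) (y * \1_(h @^-1` [set y]) x)%:E)).
  by apply: eq_integral => t _; rewrite /= fimfunE -fsumEFin.
have indich r : measurable_fun setT (fun x => (r * \1_(h @^-1` [set r]) x)%:E).
  by apply/measurable_EFinP; exact: measurable_funM.
rewrite ge0_integral_fsum//; last by move=> m y _; exact: nnfun_muleindic_ge0.
transitivity (\int[mu]_x (\sum_(y \in range h)
    (y * \1_(h @^-1` [set y]) x)%:E * (p x)%:E)); last first.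
  apply: eq_integral => x _.
  rewrite -ge0_mule_fsuml => [|y]; last exact: nnfun_muleindic_ge0.
  by rewrite fsumEFin // -(fimfunE _ x).
rewrite ge0_integral_fsum//; last 2 first.
  - by move=> y; exact: emeasurable_funM.
  - by move=> m y _; apply: mule_ge0; [exact: nnfun_muleindic_ge0|rewrite lee_fin].
apply: eq_fsbigr => r rh.
have r0 : (0 <= r)%R by move: rh; rewrite inE => -[t _ <-].
under eq_integral do rewrite EFinM.
rewrite ge0_integralZl ?lee_fin//; last exact/measurable_EFinP.
under [RHS]eq_integral do rewrite EFinM -muleA.
rewrite ge0_integralZl ?lee_fin//; last 2 first.
  by apply: emeasurable_funM => //; exact/measurable_EFinP.
  by move=> x _; rewrite mule_ge0 ?lee_fin.
congr (_ * _); rewrite integral_indic// setIT nuE//.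
rewrite integral_mkcond; apply: eq_integral => x _.
by rewrite epatch_indic muleC.
Qed.

(** Monotone approximation of f by simple functions. *)
Lemma ge0_integral_density (f : T -> \bar R) : measurable_fun setT f ->
  (forall x, 0 <= f x) -> \int[nu]_x f x = \int[mu]_x (f x * (p x)%:E).
Proof.
move=> mf f0.
have mpE : measurable_fun [set: T] (fun x => (p x)%:E) by exact/measurable_EFinP.
pose h := nnsfun_approx measurableT mf.
have fE x : (EFin \o h n) x @[n --> \oo] --> f x.
  exact: cvg_nnsfun_approx.
have -> : \int[nu]_x f x = limn (fun n => \int[nu]_x (h n x)%:E).
  rewrite -monotone_convergence//.
  - by apply: eq_integral => x _; apply/esym/cvg_lim => //; exact: fE.
  - by move=> n; exact/measurable_EFinP.
  - by move=> n x _; rewrite lee_fin.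
  - by move=> x _ a b ab; rewrite lee_fin; exact/lefP/nd_nnsfun_approx.
have -> : \int[mu]_x (f x * (p x)%:E) =
    limn (fun n => \int[mu]_x ((h n x)%:E * (p x)%:E)).
  rewrite -monotone_convergence//.
  - apply: eq_integral => x _; apply/esym/cvg_lim => //.
    by apply: cvgeZr => //; exact: fE.
  - by move=> n; apply: emeasurable_funM => //; exact/measurable_EFinP.
  - by move=> n x _; rewrite mule_ge0 ?lee_fin.
  - move=> x _ a b ab; rewrite lee_wpmul2r ?lee_fin//.
    exact/lefP/nd_nnsfun_approx.
by congr (limn _); apply/funext => n; exact: nnsfun_density.
Qed.

End density.

(** The restriction of nu to B has the density p 1_B with respect to mu. *)
Lemma ge0_integral_density_on d (T : measurableType d) (R : realType)
    (mu nu : {measure set T -> \bar R}) (p : T -> R) (B : set T)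
    (f : T -> \bar R) :
  measurable_fun setT p -> (forall x, 0 <= p x) -> measurable B ->
  (forall A, measurable A -> A `<=` B ->
     nu A = (\int[mu]_(x in A) (p x)%:E)%E) ->
  measurable_fun setT f -> (forall x, 0 <= f x)%E ->
  (\int[nu]_(x in B) f x = \int[mu]_(x in B) (f x * (p x)%:E))%E.
Proof.
move=> mp p0 mB nuE mf f0.
pose nuB := measure_function_mrestr__canonical__measure_function_Measure nu mB.
have m1B : measurable_fun setT (\1_B : T -> R) by exact: measurable_indic.
have i0 x : 0 <= (\1_B x : R) by rewrite indicE.
transitivity (\int[nuB]_x f x)%E.
  rewrite (@ge0_integral_density _ _ _ nu nuB (\1_B))//; last first.
    by move=> A mA; rewrite integral_indic// /nuB/= /mrestr setIC.
  by rewrite integral_mkcond; apply: eq_integral => x _; rewrite epatch_indic.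
rewrite (@ge0_integral_density _ _ _ mu nuB (fun x => p x * \1_B x))//.
- rewrite [RHS]integral_mkcond; apply: eq_integral => x _.
  by rewrite epatch_indic/= EFinM muleA.
- exact: measurable_funM.
- by move=> x; rewrite mulr_ge0.
- move=> A mA; rewrite /nuB/= /mrestr nuE//; last exact: measurableI.
  by rewrite integral_mkcondr; apply: eq_integral => x _; rewrite epatch_indic/= EFinM.
Qed.

Lemma ge0_integral_comp d1 d2 (X : measurableType d1) (Z : measurableType d2)
    (R : realType) (phi : X -> Z) (mphi : measurable_fun setT phi)
    (m : {measure set X -> \bar R}) (f : Z -> \bar R) :
  measurable_fun setT f -> (forall z, 0 <= f z)%E ->
  (\int[m]_x f (phi x) = \int[pushforward_measure m mphi]_z f z)%E.
Proof. by move=> mf f0; rewrite (ge0_integral_pushforward mphi). Qed.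

(** Jensen's inequality for the square: integrate 2 A |h| <= h^2 + A^2 with A
    the integral of |h|. *)
Lemma sqr_integral_le d (T : measurableType d) (R : realType)
    (mu : {measure set T -> \bar R}) (D : set T) (h : T -> R) (x : R) :
  measurable D -> mu D = 1%E -> measurable_fun D h ->
  (\int[mu]_(t in D) (h t)%:E = x%:E)%E ->
  ((x ^+ 2)%:E <= \int[mu]_(t in D) (h t ^+ 2)%:E)%E.
Proof.
move=> mD muD mh hx.
have mh1 : measurable_fun D (fun t => (h t)%:E) by exact/measurable_EFinP.
have mhn : measurable_fun D (fun t => `|h t|%:E).
  by apply/measurable_EFinP; exact: measurableT_comp.
have mh2 : measurable_fun D (fun t => (h t ^+ 2)%:E).
  by apply/measurable_EFinP; exact: measurable_funX.
have key (c : R) : 0 <= c -> ((2 * c)%:E * \int[mu]_(t in D) `|h t|%:E <=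
    \int[mu]_(t in D) (h t ^+ 2)%:E + (c ^+ 2)%:E)%E.
  move=> c0; rewrite -ge0_integralZl//; last by rewrite lee_fin mulr_ge0.
  rewrite -[X in (_ <= _ + X)%E]mule1 -muD -integral_cst// -ge0_integralD//; last 2 first.
    by move=> t _; rewrite lee_fin sqr_ge0.
    by move=> t _; rewrite lee_fin sqr_ge0.
  apply: ge0_le_integral => //.
  - by move=> t _; rewrite -EFinM lee_fin !mulr_ge0.
  - by apply: measurable_funeM.
  - by apply: emeasurable_funD.
  move=> t _; rewrite -EFinM -EFinD lee_fin -(real_normK (num_real (h t))).
  by have := sqr_ge0 (c - `|h t|); nra.
have xA : (`|x|%:E <= \int[mu]_(t in D) `|h t|%:E)%E.
  by have := le_abse_integral mu mD mh1; rewrite hx.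
have S0 : (0 <= \int[mu]_(t in D) (h t ^+ 2)%:E)%E.
  by apply: integral_ge0 => t _; rewrite lee_fin sqr_ge0.
move: xA key S0.
case: (\int[mu]_(t in D) `|h t|%:E)%E => [A||] //=; last first.
  move=> _ /(_ 1 ler01); rewrite mulr1 expr1n mulry gtr0_sg// mul1e.
  by case: (\int[mu]_(t in D) (h t ^+ 2)%:E)%E => //= *; rewrite leey.
rewrite lee_fin => xA; have A0 : 0 <= A by rewrite (le_trans _ xA).
move=> /(_ A A0); case: (\int[mu]_(t in D) (h t ^+ 2)%:E)%E => [S||]//= + _;
  last by move=> _; rewrite leey.
rewrite -EFinM -EFinD !lee_fin -(real_normK (num_real x)).
have := normr_ge0 x; nra.
Qed.

(** * Measurability and the Euclidean norm on R^n *)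

Section measurability_rV.
Context {R : realType} d (T : measurableType d) (n : nat).
Implicit Types f g : T -> 'rV[R]_n.

Lemma measurable_rVD f g : measurable_fun setT f -> measurable_fun setT g ->
  measurable_fun setT (fun x => f x + g x).
Proof.
move=> /measurable_fun_rVP mf /measurable_fun_rVP mg.
apply/measurable_fun_rVP => i.
by under eq_fun do rewrite mxE; exact: measurable_funD.
Qed.

Lemma measurable_rVB f g : measurable_fun setT f -> measurable_fun setT g ->
  measurable_fun setT (fun x => f x - g x).
Proof.
move=> /measurable_fun_rVP mf /measurable_fun_rVP mg.
apply/measurable_fun_rVP => i.
by under eq_fun do rewrite !mxE; exact: measurable_funB.
Qed.

Lemma measurable_rVZ (k : T -> R) f : measurable_fun setT k ->
  measurable_fun setT f -> measurable_fun setT (fun x => k x *: f x).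
Proof.
move=> mk /measurable_fun_rVP mf; apply/measurable_fun_rVP => i.
by under eq_fun do rewrite mxE; exact: measurable_funM.
Qed.

Lemma measurable_rV_sum (I : Type) (s : seq I) (F : I -> T -> 'rV[R]_n) :
  (forall i, measurable_fun setT (F i)) ->
  measurable_fun setT (fun x => \sum_(i <- s) F i x).
Proof.
move=> mF; elim: s => [|i s IH].
  by under eq_fun do rewrite big_nil; exact: measurable_cst.
by under eq_fun do rewrite big_cons; exact: measurable_rVD.
Qed.

Definition dotv (x y : 'rV[R]_n) : R := \sum_j x ord0 j * y ord0 j.

Lemma measurable_dotv f g : measurable_fun setT f -> measurable_fun setT g ->
  measurable_fun setT (fun x => dotv (f x) (g x)).
Proof.
move=> /measurable_fun_rVP mf /measurable_fun_rVP mg.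
by apply: measurable_sum => i; exact: measurable_funM.
Qed.

End measurability_rV.

Lemma measurable_l2norm {R : realType} d (T : measurableType d) (n : nat)
  (f : T -> 'rV[R]_n) : measurable_fun setT f ->
  measurable_fun setT (fun x => l2norm (f x)).
Proof.
move=> /measurable_fun_rVP mf.
have msqrt : measurable_fun setT (@Num.sqrt R).
  by apply: continuous_measurable_fun; exact: sqrt_continuous.
apply: (measurableT_comp msqrt).
apply: measurable_sum => i; apply: measurable_sum => j.
by apply: measurable_funX; rewrite (ord1 i).
Qed.

Lemma measurable_bool_natr d (T : measurableType d) (R : realType) (b : T -> bool) :
  measurable_fun setT b -> measurable_fun setT (fun x => (b x)%:R : R).
Proof.
move=> mb; rewrite (_ : (fun x => _) = (fun x => if b x then 1 else 0)).
  by apply: measurable_fun_ifT.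
by apply/funext => x; case: (b x).
Qed.

Section euclidean.
Context {R : realType} (n : nat).
Implicit Types x y z : 'rV[R]_n.

Definition sqn x : R := \sum_j x ord0 j ^+ 2.

Lemma sqn_ge0 x : 0 <= sqn x.
Proof. by apply: sumr_ge0 => j _; exact: sqr_ge0. Qed.

Lemma l2norm_ge0 m (A : 'M[R]_(m, n)) : 0 <= l2norm A.
Proof. exact: sqrtr_ge0. Qed.

Lemma l2norm_sqr m (A : 'M[R]_(m, n)) :
  l2norm A ^+ 2 = \sum_i \sum_j A i j ^+ 2.
Proof.
rewrite /l2norm sqr_sqrtr//.
by apply: sumr_ge0 => i _; apply: sumr_ge0 => j _; exact: sqr_ge0.
Qed.

Lemma l2norm_rV_sqr x : l2norm x ^+ 2 = sqn x.
Proof. by rewrite l2norm_sqr big_ord1. Qed.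

Lemma cauchy_schwarz x y : dotv x y ^+ 2 <= sqn x * sqn y.
Proof.
have : 0 <= \sum_i \sum_j (x ord0 i * y ord0 j - x ord0 j * y ord0 i) ^+ 2.
  by apply: sumr_ge0 => i _; apply: sumr_ge0 => j _; exact: sqr_ge0.
have -> : \sum_i \sum_j (x ord0 i * y ord0 j - x ord0 j * y ord0 i) ^+ 2 =
    \sum_i \sum_j x ord0 i ^+ 2 * y ord0 j ^+ 2 +
    \sum_i \sum_j y ord0 i ^+ 2 * x ord0 j ^+ 2 -
    2 * \sum_i \sum_j (x ord0 i * y ord0 i) * (x ord0 j * y ord0 j).
  rewrite mulr_sumr -big_split -sumrB/=; apply: eq_bigr => i _.
  by rewrite mulr_sumr -big_split -sumrB/=; apply: eq_bigr => j _; ring.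
rewrite -!big_distrlr/= -/(sqn x) -/(sqn y) -/(dotv x y); nra.
Qed.

Lemma sqnD_le x y : sqn (x + y) <= 2 * sqn x + 2 * sqn y.
Proof.
rewrite /sqn !mulr_sumr -big_split/=; apply: ler_sum => j _; rewrite mxE.
by have := sqr_ge0 (x ord0 j - y ord0 j); nra.
Qed.

Lemma sqnN x : sqn (- x) = sqn x.
Proof. by apply: eq_bigr => j _; rewrite mxE sqrrN. Qed.

Lemma sqnZ k x : sqn (k *: x) = k ^+ 2 * sqn x.
Proof. by rewrite /sqn mulr_sumr; apply: eq_bigr => j _; rewrite mxE exprMn. Qed.

Lemma dotvDr x y z : dotv x (y + z) = dotv x y + dotv x z.
Proof. by rewrite -big_split; apply: eq_bigr => j _; rewrite mxE mulrDr. Qed.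

Lemma l2norm_le_sup x (e : R) : 0 <= e -> (forall j, `|x ord0 j| <= e) ->
  l2norm x <= n%:R * e.
Proof.
move=> e0 xe; rewrite -(ler_pXn2r (n:=2)) ?nnegrE ?l2norm_ge0 ?mulr_ge0//.
rewrite l2norm_rV_sqr exprMn; apply: (@le_trans _ _ (n%:R * e ^+ 2)).
  rewrite mulr_natl -[X in _ *+ X]card_ord -sumr_const; apply: ler_sum => j _.
  by rewrite -real_normK ?num_real// lerXn2r ?nnegrE.
rewrite ler_wpM2r ?sqr_ge0// -natrX ler_nat.
by case: n => // k; rewrite expnS leq_pmulr.
Qed.

Lemma rat_rV_dense x (e : R) : 0 < e ->
  exists q : 'rV[rat]_n, l2norm (x - map_mx ratr q) < e.
Proof.
move=> e0; pose de := e / (n.+1)%:R.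
have de0 : 0 < de by rewrite divr_gt0.
have /choice[q hq] : forall j, exists q : rat, `|x ord0 j - ratr q| <= de.
  move=> j; have [q] := @rat_in_itvoo R (x ord0 j - de) (x ord0 j + de) ltac:(lra).
  by rewrite in_itv/= => /andP[? ?]; exists q; rewrite ler_norml; lra.
exists (\row_j q j); apply: (@le_lt_trans _ _ (n%:R * de)).
  by apply: l2norm_le_sup => [|j]; [exact: ltW|rewrite !mxE].
by rewrite /de mulrA ltr_pdivrMr// mulrC ltr_pM2l// ltr_nat.
Qed.

(** A Lipschitz function is the supremum of countably many measurable functions
    y |-> h q - L |y - q|, with q running through the rational points. *)
Lemma measurable_lipschitz (h : 'rV[R]_n -> R) L :
  has_lipschitz_constant h L -> measurable_fun setT h.
Proof.
move=> hL.
wlog L0 : L hL / 0 < L.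
  move=> /(_ (`|L| + 1)); apply; last by rewrite ltr_wpDl.
  move=> y z; apply: (le_trans (hL y z)); rewrite ler_wpM2r ?l2norm_ge0//.
  by rewrite (le_trans (ler_norm _))// lerDl.
move=> mD; apply: (measurability _ (RGenOInfty.measurableE R)) => //.
move=> /= _ [_ [a ->] <-]; rewrite preimage_itvoy setTI.
rewrite [X in measurable X](_ : _ = \bigcup_(q : 'rV[rat]_n)
  [set y | a < h (map_mx ratr q) - L * l2norm (y - map_mx ratr q)]).
  apply: countable_bigcupT_measurable => // q.
  rewrite -[X in measurable X]setTI.
  have mg : measurable_fun setT (fun y : 'rV[R]_n =>
      h (map_mx ratr q) - L * l2norm (y - map_mx ratr q)).
    apply: measurable_funB => //; apply: measurable_funM => //.
    apply: measurable_l2norm; apply: measurable_rVB; first exact: measurable_id.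
    exact: measurable_cst.
  by rewrite -preimage_itvoy; apply: mg.
apply/seteqP; split => y /=.
  rewrite -subr_gt0 => ahy.
  have L20 : 0 < 2 * L by rewrite mulr_gt0.
  have [q] := rat_rV_dense y (divr_gt0 ahy L20).
  rewrite ltr_pdivlMr// => hq; exists q => //=.
  have := hL y (map_mx ratr q); rewrite ler_norml => /andP[_].
  lra.
move=> [q _ /= aq]; apply: (lt_le_trans aq).
have := hL y (map_mx ratr q); rewrite ler_norml => /andP[+ _].
lra.
Qed.

End euclidean.

(** * Lebesgue measure under affine maps *)

Section lebesgue_invariance.
Context {R : realType}.
Notation leb := (@lebesgue_measure R).
Implicit Types (A : set (measurableTypeR R)) (b c x : R).

Lemma measurable_shiftr b :
  measurable_fun setT (fun x : measurableTypeR R => (x + b : measurableTypeR R)).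
Proof. exact: measurable_funD. Qed.

Lemma measurable_scaler c :
  measurable_fun setT (fun x : measurableTypeR R => (c * x : measurableTypeR R)).
Proof. exact: measurable_funM. Qed.

Lemma measurable_negr :
  measurable_fun setT (fun x : measurableTypeR R => (- x : measurableTypeR R)).
Proof. exact: oppr_measurable. Qed.

Lemma lebesgue_measure_shift b A : measurable A ->
  leb ((fun x => x + b) @^-1` A) = leb A.
Proof.
move=> mA.
pose nu := pushforward_measure leb (measurable_shiftr b).
apply/esym/(lebesgue_measure_unique (mu := nu)) => // _ [[u v] /= _ <-].
rewrite /pushforward (_ : _ @^-1` _ = `]u - b, v - b]%classic).
  rewrite !lebesgue_measure_itv/= !lte_fin ltrD2r; case: ifP => // _.
  by rewrite -!EFinB; congr (_%:E); lra.
by apply/seteqP; split => x /=; rewrite !in_itv/=; lra.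
Qed.

Lemma lebesgue_measure_opp A : measurable A -> leb (-%R @^-1` A) = leb A.
Proof.
move=> mA.
pose nu := pushforward_measure leb measurable_negr.
apply/esym/(lebesgue_measure_unique (mu := nu)) => // _ [[u v] /= _ <-].
rewrite /pushforward (_ : _ @^-1` _ = `[- v, - u[%classic).
  rewrite !lebesgue_measure_itv/= !lte_fin ltrN2; case: ifP => // _.
  by rewrite -!EFinB; congr (_%:E); lra.
by apply/seteqP; split => x /=; rewrite !in_itv/=; lra.
Qed.

Lemma lebesgue_measure_scale c A : 0 < c -> measurable A ->
  leb A = (c%:E * leb ( *%R c @^-1` A))%E.
Proof.
move=> c0 mA.
pose nu := measure_function_mscale__canonical__measure_function_Measure
  (NngNum (ltW c0))
  (pushforward_measure leb (measurable_scaler c)).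
apply: (lebesgue_measure_unique (mu := nu)) => // _ [[u v] /= _ <-].
rewrite /mscale/= /pushforward (_ : _ @^-1` _ = `]u / c, v / c]%classic).
  rewrite !lebesgue_measure_itv/= !lte_fin ltr_pM2r ?invr_gt0//.
  case: ifP => [_|]; last by rewrite mule0.
  by rewrite -!EFinB -EFinM; congr (_%:E); field; rewrite gt_eqF.
apply/seteqP; split => x /=;
  by rewrite !in_itv/= ltr_pdivrMr// ler_pdivlMr// ![x * c]mulrC.
Qed.

Lemma ge0_integral_preserving (T : measurableTypeR R -> measurableTypeR R)
    (mT : measurable_fun setT T) (f : R -> \bar R) A :
  (forall B, measurable B -> leb (T @^-1` B) = leb B) ->
  measurable A -> measurable_fun setT f -> (forall x, 0 <= f x)%E ->
  (\int[leb]_(x in T @^-1` A) f (T x) = \int[leb]_(x in A) f x)%E.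
Proof.
move=> Tleb mA mf f0.
rewrite -[LHS](ge0_integral_pushforward mT)//; last exact: measurable_funTS.
by apply: eq_measure_integral => B mB _; exact: Tleb.
Qed.

End lebesgue_invariance.

(** * Normal laws on the line *)

Section normal1.
Context {R : realType}.
Notation leb := (@lebesgue_measure R).
Implicit Types (A : set (measurableTypeR R)) (m b x v a : R).

Lemma normal_pdf_sqrt m v x : 0 < v ->
  normal_pdf m (Num.sqrt v) x =
  (Num.sqrt (v * pi *+ 2))^-1 * expR (- (x - m) ^+ 2 / (v *+ 2)).
Proof.
move=> v0; rewrite normal_pdfE ?gt_eqF ?sqrtr_gt0//.
by rewrite /normal_peak /normal_fun sqr_sqrtr// ltW.
Qed.

Lemma normal_peak_scale v a : 0 < v -> 0 < a ->
  (Num.sqrt (v * pi *+ 2))^-1 =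
  Num.sqrt a * (Num.sqrt (a * v * pi *+ 2))^-1.
Proof.
move=> v0 a0; have -> : a * v * pi *+ 2 = a * (v * pi *+ 2) by ring.
by rewrite sqrtrM ?ltW// invfM mulrA divff ?mul1r// gt_eqF// sqrtr_gt0.
Qed.

(** The shifted density divided by the density of variance (1 + a) v is the
    exponential of a concave quadratic polynomial in x; completing the square
    shows that its maximum is b^2 / (2 a v). *)
Lemma normal_prob_shift_le m b v a A : 0 < v -> 0 < a -> measurable A ->
  (normal_prob m (Num.sqrt v) ((fun x : R => (x + b)%R) @^-1` A) <=
   (Num.sqrt (1 + a) * expR (b ^+ 2 / (a * v *+ 2)))%R%:E *
   normal_prob m (Num.sqrt ((1 + a) * v)) A)%E.
Proof.
move=> v0 a0 mA; have a10 : 0 < 1 + a by lra.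
rewrite /normal_prob.
rewrite (eq_integral (fun x : measurableTypeR R =>
  (normal_pdf m (Num.sqrt v) ((x + b) - b))%:E)); last first.
  by move=> x _; rewrite addrK.
have mpdf m' s : measurable_fun setT (fun x => (normal_pdf m' s (x))%:E : \bar R).
  by apply/measurable_EFinP; exact: measurable_normal_pdf.
have mf : measurable_fun setT (fun x => (normal_pdf m (Num.sqrt v) (x - b))%:E).
  apply: (measurableT_comp (mpdf m (Num.sqrt v))).
  exact: measurable_funB.
rewrite (ge0_integral_preserving (measurable_shiftr b)
  (f := fun x => (normal_pdf m (Num.sqrt v) (x - b))%:E))//; last 2 first.
  by move=> B mB; exact: lebesgue_measure_shift.
  by move=> x; rewrite lee_fin normal_pdf_ge0.
rewrite -ge0_integralZl//; last 2 first.
  exact: (measurable_funTS (mpdf _ _)).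
  by move=> x _; rewrite lee_fin normal_pdf_ge0.
apply: ge0_le_integral => //.
- by move=> x _; rewrite lee_fin normal_pdf_ge0.
- exact: (measurable_funTS mf).
- by apply: measurable_funeM; exact: (measurable_funTS (mpdf _ _)).
move=> x _; rewrite -EFinM lee_fin !normal_pdf_sqrt//; last exact: mulr_gt0.
rewrite (normal_peak_scale v0 a10).
set c := Num.sqrt (1 + a); set k := (Num.sqrt _)^-1.
rewrite -[leLHS]mulrA -[leRHS]mulrA ler_wpM2l ?sqrtr_ge0//.
rewrite mulrCA ler_wpM2l ?invr_ge0 ?sqrtr_ge0// -expRD ler_expR.
(* the maximum is attained where a (x - m) = (1 + a) b *)
have e1 : b ^+ 2 / (a * v *+ 2) + - (x - m) ^+ 2 / ((1 + a) * v *+ 2)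
   - - (x - b - m) ^+ 2 / (v *+ 2) =
   (a * (x - m) - (1 + a) * b) ^+ 2 / (a * (1 + a) * v *+ 2).
  by field; rewrite ?gt_eqF.
rewrite -subr_ge0 e1 divr_ge0// ?sqr_ge0// mulrn_wge0//.
by rewrite !mulr_ge0// ltW.
Qed.

Lemma normal_prob_scale_null m s c A : 0 < c -> measurable A ->
  leb A = 0%E -> normal_prob m s ( *%R c @^-1` A) = 0%E.
Proof.
move=> c0 mA A0.
have mcA : measurable ( *%R c @^-1` A).
  by rewrite -[X in measurable X]setTI; exact: measurable_scaler.
have /null_content_dominatesP := normal_prob_dominates m s; apply => //.
move: A0; rewrite (lebesgue_measure_scale c0 mA) => /eqP.
by rewrite mule_eq0 eqe gt_eqF//= => /eqP.
Qed.

Lemma normal_prob_opp v A : 0 < v -> measurable A ->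
  normal_prob 0 (Num.sqrt v) (-%R @^-1` A) = normal_prob 0 (Num.sqrt v) A.
Proof.
move=> v0 mA; rewrite /normal_prob.
have e x : normal_pdf 0 (Num.sqrt v) x = normal_pdf 0 (Num.sqrt v) (- x).
  by rewrite !normal_pdf_sqrt// !subr0 sqrrN.
rewrite (eq_integral (fun x : measurableTypeR R =>
  (normal_pdf 0 (Num.sqrt v) (- x))%:E)); last first.
  by move=> x _; rewrite e.
apply: (ge0_integral_preserving measurable_negr
  (f := fun x => (normal_pdf 0 (Num.sqrt v) x)%:E)) => //.
- by move=> B mB; exact: lebesgue_measure_opp.
- by apply/measurable_EFinP; exact: measurable_normal_pdf.
- by move=> x; rewrite lee_fin normal_pdf_ge0.
Qed.

(** Multiplying the N(0, v) density by exp ((1 - r^-2) x^2 / 2v) gives r times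
    the N(0, r^2 v) density. *)
Lemma normal_prob_exp_moment v r : 0 < v -> 0 < r ->
  (\int[normal_prob 0 (Num.sqrt v)]_x
     (expR ((1 - r ^- 2) / (v *+ 2) * x ^+ 2))%:E = r%:E)%E.
Proof.
move=> v0 r0.
have mE : measurable_fun setT
    (fun x : R => expR ((1 - r ^- 2) / (v *+ 2) * x ^+ 2)).
  by apply: measurableT_comp => //; apply: measurable_funM.
rewrite (ge0_integral_density (p := normal_pdf 0 (Num.sqrt v)) (mu := leb))//;
  last 3 first.
  exact: measurable_normal_pdf.
  by move=> x; rewrite normal_pdf_ge0.
  exact/measurable_EFinP.
rewrite (eq_integral (fun x : measurableTypeR R =>
  r%:E * (normal_pdf 0 (Num.sqrt (r ^+ 2 * v)) x)%:E)%E).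
  rewrite ge0_integralZl ?lee_fin ?ltW// ?integral_normal_pdf ?mule1//.
    by apply/measurable_EFinP; exact: measurable_normal_pdf.
  by move=> x _; rewrite lee_fin normal_pdf_ge0.
move=> x _; rewrite -!EFinM; congr (_%:E).
rewrite !normal_pdf_sqrt//; last by rewrite mulr_gt0// exprn_gt0.
rewrite (normal_peak_scale v0 (exprn_gt0 2 r0)) sqrtr_sqr gtr0_norm//.
rewrite mulrC -!mulrA -expRD; congr (_ * (_ * expR _)).
by rewrite subr0; field; rewrite !gt_eqF.
Qed.

End normal1.

Section normal_variance.
Context {R : realType} (v : R).
Hypothesis v0 : 0 < v.
Let N : probability (measurableTypeR R) R := normal_prob 0 (Num.sqrt v).

Let mE t : measurable_fun setT (fun x : R => (expR (t * x ^+ 2))%:E).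
Proof.
by apply/measurable_EFinP; apply: measurableT_comp => //; apply: measurable_funM.
Qed.

Let mS (t : R) : measurable_fun setT (fun x : R => (t * x ^+ 2)%:E).
Proof. by apply/measurable_EFinP; exact: measurable_funM. Qed.

Let second_moment_le r : 1 < r ->
  (\int[N]_x (x ^+ 2)%:E <= (v * r ^+ 2)%:E)%E.
Proof.
move=> r1; have r0 : 0 < r by lra.
pose t := (1 - r ^- 2) / (v *+ 2).
have r21 : r ^- 2 < 1 by rewrite invf_lt1 ?exprn_gt0// exprn_egt1.
have t0 : 0 < t by rewrite divr_gt0 ?subr_gt0// mulrn_wgt0.
have tE : t = (r ^+ 2 - 1) / (r ^+ 2 * v *+ 2).
  by rewrite /t; field; rewrite !gt_eqF.
have : (\int[N]_x (1 + (t * x ^+ 2)%:E) <= \int[N]_x (expR (t * x ^+ 2))%:E)%E.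
  apply: ge0_le_integral => //.
  - by move=> x _; rewrite adde_ge0// lee_fin mulr_ge0 ?sqr_ge0// ltW.
  - by apply: emeasurable_funD; [exact: measurable_cst|exact: mS].
  - exact: mE.
  - by move=> x _; rewrite -EFinD lee_fin expR_ge1Dx.
rewrite normal_prob_exp_moment// ge0_integralD//; last 2 first.
  by move=> x _; rewrite lee_fin mulr_ge0 ?sqr_ge0// ltW.
  exact: mS.
rewrite integral_cst// mul1e.
rewrite [X in (X + _ <= _)%E](_ : _ = 1%E); last exact: (probability_setT N).
under eq_integral do rewrite EFinM.
rewrite ge0_integralZl ?lee_fin ?(ltW t0)//; last 2 first.
  by apply/measurable_EFinP; exact: measurable_funX.
  by move=> x _; rewrite lee_fin sqr_ge0.
have I0 : (0 <= \int[N]_x (x ^+ 2)%:E)%E.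
  by apply: integral_ge0 => x _; rewrite lee_fin sqr_ge0.
move: I0; case: (\int[N]_x _)%E => [s||]//=.
  rewrite lee_fin => s0; rewrite -EFinM -EFinD !lee_fin => h.
  have {h} : t * s <= r - 1 by lra.
  rewrite tE mulrAC ler_pdivrMr ?mulrn_wgt0 ?mulr_gt0 ?exprn_gt0// => h.
  have h' : (r + 1) * s <= r ^+ 2 * v *+ 2.
    have r10 : 0 < r - 1 by lra.
  rewrite -(ler_pM2l r10).
  by have -> : (r - 1) * ((r + 1) * s) = (r ^+ 2 - 1) * s by ring.
  by apply: (@le_trans _ _ ((r + 1) / 2 * s)); [nra|lra].
by move=> _; rewrite mulry gtr0_sg// mul1e.
Qed.

Let second_moment_ge r : 0 < r -> r < 1 ->
  ((v * r ^+ 2)%:E <= \int[N]_x (x ^+ 2)%:E)%E.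
Proof.
move=> r0 r1.
pose t := - ((1 - r ^- 2) / (v *+ 2)).
have r21 : 1 < r ^- 2 by rewrite invf_gt1 ?exprn_gt0// exprn_ilt1// ltW.
have t0 : 0 < t by rewrite /t -mulNr divr_gt0 ?mulrn_wgt0//; lra.
have tE : t = (1 - r ^+ 2) / (r ^+ 2 * v *+ 2).
  by rewrite /t; field; rewrite !gt_eqF.
have : (\int[N]_x (1 : \bar R) <=
    \int[N]_x ((expR (- t * x ^+ 2))%:E + (t * x ^+ 2)%:E))%E.
  apply: ge0_le_integral => //.
  - by apply: emeasurable_funD; [exact: mE|exact: mS].
  - move=> x _; rewrite -EFinD lee_fin.
    by have := expR_ge1Dx (- t * x ^+ 2); lra.
rewrite ge0_integralD//; last 3 first.
  exact: mE.
  by move=> x _; rewrite lee_fin mulr_ge0 ?sqr_ge0// ltW.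
  exact: mS.
rewrite opprK normal_prob_exp_moment// integral_cst// mul1e.
rewrite [X in (X <= _)%E](_ : _ = 1%E); last exact: (probability_setT N).
under eq_integral do rewrite EFinM.
rewrite ge0_integralZl ?lee_fin ?(ltW t0)//; last 2 first.
  by apply/measurable_EFinP; exact: measurable_funX.
  by move=> x _; rewrite lee_fin sqr_ge0.
have I0 : (0 <= \int[N]_x (x ^+ 2)%:E)%E.
  by apply: integral_ge0 => x _; rewrite lee_fin sqr_ge0.
move: I0; case: (\int[N]_x _)%E => [s||]//=; last by move=> _ _; exact: leey.
rewrite lee_fin => s0; rewrite -EFinM -EFinD !lee_fin => h.
have {h} : 1 - r <= t * s by lra.
rewrite tE mulrAC ler_pdivlMr ?mulrn_wgt0 ?mulr_gt0 ?exprn_gt0// => h.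
have h' : r ^+ 2 * v *+ 2 <= (r + 1) * s.
  have r10 : 0 < 1 - r by lra.
  rewrite -(ler_pM2l r10).
  by have -> : (1 - r) * ((r + 1) * s) = (1 - r ^+ 2) * s by ring.
have r10 : 0 <= s * (1 - r) by rewrite mulr_ge0//; lra.
by apply: (@le_trans _ _ ((r + 1) / 2 * s)); lra.
Qed.

(** Integrating 1 + t x^2 <= exp (t x^2) against N(0, v) bounds the second
    moment from above for t > 0 and from below for t < 0; both bounds tend to
    v as t tends to 0. *)
Lemma normal_prob_second_moment : (\int[N]_x (x ^+ 2)%:E = v%:E)%E.
Proof.
have [M ME] : exists M : R, (\int[N]_x (x ^+ 2)%:E = M%:E)%E.
  have := @second_moment_le 2 ltac:(lra).
  have I0 : (0 <= \int[N]_x (x ^+ 2)%:E)%E.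
    by apply: integral_ge0 => x _; rewrite lee_fin sqr_ge0.
  by move: I0; case: (\int[N]_x _)%E => [s||]//=; exists s.
rewrite ME; congr (_%:E); apply/eqP; rewrite eq_le; apply/andP; split.
  apply/ler_addgt0Pr => e e0.
  have q1 : 1 < 1 + e / v by rewrite ltrDl divr_gt0.
  have := @second_moment_le (Num.sqrt (1 + e / v)).
  rewrite -{1}sqrtr1 ltr_sqrt ?q1//; last by rewrite (lt_trans _ q1).
  move=> /(_ isT); rewrite ME sqr_sqrtr ?lee_fin; last by lra.
  by rewrite mulrDr mulr1 mulrCA divff ?mulr1// gt_eqF.
apply/ler_addgt0Pr => e e0.
have [ev|ve] := ltP e v; last first.
  have : (0 <= \int[N]_x (x ^+ 2)%:E)%E.
    by apply: integral_ge0 => x _; rewrite lee_fin sqr_ge0.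
  by rewrite ME lee_fin; lra.
have q0 : 0 < 1 - e / v by rewrite subr_gt0 ltr_pdivrMr ?mul1r.
have q1 : 1 - e / v < 1 by rewrite ltrBlDr ltrDl divr_gt0.
have := @second_moment_ge (Num.sqrt (1 - e / v)).
rewrite sqrtr_gt0 q0 -{2}sqrtr1 ltr_sqrt ?q1// => /(_ isT isT).
rewrite ME sqr_sqrtr ?(ltW q0)// lee_fin.
by rewrite mulrBr mulr1 mulrCA divff ?mulr1 ?gt_eqF//; lra.
Qed.

End normal_variance.

(** * Product measures on R^n *)

Section product_rV_theory.
Context {R : realType}.
Notation mR := (measurableTypeR R).
Notation sfm := ({sigma_finite_measure set mR -> \bar R}).

Lemma product_rVS n (m : 'I_n.+1 -> sfm) (A : set 'rV[R]_n.+1) :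
  product_rV m A = (\int[product_rV (fun i => m (lift ord0 i))]_y
    m ord0 (ysection (@cons_rV R n @^-1` A) y))%E.
Proof. by []. Qed.

Definition map_rV n (T : 'I_n -> R -> R) (v : 'rV[R]_n) : 'rV[R]_n :=
  \row_i T i (v ord0 i).

Lemma measurable_map_rV n (T : 'I_n -> mR -> mR) :
  (forall i, measurable_fun setT (T i)) ->
  measurable_fun setT (map_rV T).
Proof.
move=> mT; apply/measurable_fun_rVP => i.
under eq_fun do rewrite mxE.
exact: (measurableT_comp (mT i) (measurable_rV_coord i)).
Qed.

Lemma map_rV_cons n (T : 'I_n.+1 -> R -> R) (x : mR) (y : 'rV[R]_n) :
  map_rV T (cons_rV (x, y)) =
  cons_rV (T ord0 x : mR, map_rV (fun i => T (lift ord0 i)) y).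
Proof.
apply/rowP => i; rewrite !mxE; case: unliftP => [j|] -> //=.
by rewrite mxE.
Qed.

Lemma ysection_map_rV n (T : 'I_n.+1 -> R -> R) (A : set 'rV[R]_n.+1) y :
  ysection (@cons_rV R n @^-1` (map_rV T @^-1` A)) y =
  T ord0 @^-1` ysection (@cons_rV R n @^-1` A)
                        (map_rV (fun i => T (lift ord0 i)) y).
Proof.
by apply/seteqP; split => x; rewrite /ysection/= !inE/= map_rV_cons.
Qed.

Lemma measurable_cons_preimage n (A : set 'rV[R]_n.+1) : measurable A ->
  measurable (@cons_rV R n @^-1` A).
Proof.
by move=> mA; rewrite -[X in measurable X]setTI; exact: measurable_cons_rV.
Qed.

Lemma preimage_map_rV0 (T : 'I_0 -> R -> R) (A : set 'rV[R]_0) :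
  map_rV T @^-1` A = A.
Proof.
have e v : map_rV T v = v by apply/rowP => -[].
by apply/seteqP; split => v /=; rewrite e.
Qed.

(** Domination of measures passes to products: integrate the domination in the
    first coordinate over the other ones.  It carries shifts, sign changes and
    changes of variance from the line to R^n. *)
Lemma product_rV_dominated n (p q : 'I_n -> sfm) (T : 'I_n -> mR -> mR)
    (c : 'I_n -> R) :
  (forall i, measurable_fun setT (T i)) -> (forall i, 0 <= c i) ->
  (forall i A, measurable A -> (p i (T i @^-1` A) <= (c i)%:E * q i A)%E) ->
  forall A, measurable A ->
  (product_rV p (map_rV T @^-1` A) <= (\prod_i c i)%:E * product_rV q A)%E.
Proof.
elim: n => [|n IH] in p q T c *; move=> mT c0 pq A mA.
  by rewrite big_ord0 mul1e preimage_map_rV0.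
have mT' : measurable_fun setT (map_rV (fun i => T (lift ord0 i))).
  exact: measurable_map_rV.
set T' := map_rV _ in mT'.
pose pp := product_rV (fun i => p (lift ord0 i)).
pose qq := product_rV (fun i => q (lift ord0 i)).
pose C := \prod_i c (lift ord0 i).
have C0 : 0 <= C by apply: prodr_ge0.
have IH' : forall B, measurable B -> (pp (T' @^-1` B) <= C%:E * qq B)%E.
  by apply: IH => // i B mB; exact: pq.
pose G y := q ord0 (ysection (@cons_rV R n @^-1` A) y).
have mcA := measurable_cons_preimage mA.
have mG : measurable_fun setT G by exact: measurable_fun_ysection.
have G0 y : (0 <= G y)%E by [].
rewrite !product_rVS big_ord_recl EFinM -muleA.
apply: (@le_trans _ _ (\int[pp]_y ((c ord0)%:E * G (T' y)))%E).
  apply: ge0_le_integral => //.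
  - apply: measurable_fun_ysection; apply: measurable_cons_preimage.
    by rewrite -[X in measurable X]setTI; exact: measurable_map_rV.
  - by apply: measurable_funeM; exact: measurableT_comp.
  - move=> y _; rewrite ysection_map_rV; apply: pq.
    exact: measurable_ysection.
rewrite ge0_integralZl//; last 2 first.
  exact: measurableT_comp.
  by rewrite lee_fin.
apply: lee_wpmul2l; first by rewrite lee_fin.
have -> : (\int[pp]_y G (T' y) = \int[pushforward pp T']_y G y)%E.
  by rewrite (ge0_integral_pushforward mT').
rewrite -(ge0_integral_mscale _ _ (NngNum C0))//.
by apply: (ge0_le_measure_integral (m1 := pushforward_measure pp mT')).
Qed.

(** Absolute continuity passes to products: almost all sections of a null set
    are null. *)
Lemma product_rV_null n (p q : 'I_n -> sfm) (T : 'I_n -> mR -> mR) :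
  (forall i, measurable_fun setT (T i)) ->
  (forall i A, measurable A -> q i A = 0%E -> p i (T i @^-1` A) = 0%E) ->
  forall A, measurable A -> product_rV q A = 0%E ->
  product_rV p (map_rV T @^-1` A) = 0%E.
Proof.
elim: n => [|n IH] in p q T *; move=> mT pq A mA.
  by rewrite preimage_map_rV0.
have mT' : measurable_fun setT (map_rV (fun i => T (lift ord0 i))).
  exact: measurable_map_rV.
set T' := map_rV _ in mT'.
pose pp := product_rV (fun i => p (lift ord0 i)).
pose qq := product_rV (fun i => q (lift ord0 i)).
have IH' : forall B, measurable B -> qq B = 0%E -> pp (T' @^-1` B) = 0%E.
  by apply: IH => // i B mB; exact: pq.
pose G y := q ord0 (ysection (@cons_rV R n @^-1` A) y).
have mcA := measurable_cons_preimage mA.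
have mG : measurable_fun setT G by exact: measurable_fun_ysection.
have G0 y : (0 <= G y)%E by [].
rewrite !product_rVS => GA0.
have [N [mN N0 sN]] : ae_eq qq setT G (cst 0%E).
  apply/ae_eq_integral_abs => //.
  by under eq_integral do rewrite gee0_abs//.
have mT'N : measurable (T' @^-1` N) by rewrite -[X in measurable X]setTI; exact: mT'.
have mTA : measurable (map_rV T @^-1` A).
  by rewrite -[X in measurable X]setTI; exact: measurable_map_rV.
apply/eqP; rewrite -[X in X == _](_ : (\int[pp]_y
  `| p ord0 (ysection (cons_rV (n:=n) @^-1` (map_rV T @^-1` A)) y)|)%E = _); last first.
  by apply: eq_integral => y _; rewrite gee0_abs.
apply/eqP/ae_eq_integral_abs => //.
  by apply: measurable_fun_ysection; exact: measurable_cons_preimage.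
exists (T' @^-1` N); split => //; first exact: IH'.
move=> y /= h; apply: sN => /= h'; apply: h => _.
rewrite ysection_map_rV; apply: pq; last exact: h'.
exact: measurable_ysection.
Qed.

Definition box_rV n (A : 'I_n -> set R) : set 'rV[R]_n :=
  [set v | forall i, A i (v ord0 i)].

Lemma measurable_box_rV n (A : 'I_n -> set mR) :
  (forall i, measurable (A i)) -> measurable (box_rV A).
Proof.
move=> mA; rewrite [X in measurable X](_ : _ =
    \bigcap_i ((fun v : 'rV[R]_n => v ord0 i) @^-1` A i)).
  apply: fin_bigcap_measurable => // i _.
  by rewrite -[X in measurable X]setTI; exact: (measurable_rV_coord i measurableT (mA i)).
by apply/seteqP; split=> v /= H i; [move=> _; exact: H|exact: (H i)].
Qed.

Lemma box_rVT n : box_rV (fun _ : 'I_n => setT) = setT.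
Proof. by apply/seteqP; split. Qed.

Lemma product_rV_setT n (m : 'I_n -> sfm) : (forall i, m i setT = 1%E) ->
  product_rV m setT = 1%E.
Proof.
move=> m1; rewrite -box_rVT product_rV_box//.
by rewrite big1.
Qed.

(** The boxes are stable under intersection and generate the sigma-algebra. *)
Lemma product_rV_unique n (m : 'I_n -> sfm)
    (nu : {measure set 'rV[R]_n -> \bar R}) : (forall i, m i setT = 1%E) ->
  (forall A, (forall i, measurable (A i)) ->
     nu (box_rV A) = (\prod_i m i (A i))%E) ->
  forall X, measurable X -> nu X = product_rV m X.
Proof.
move=> m1 nuE X mX.
pose G : set (set 'rV[R]_n) :=
  [set box_rV A | A in [set A : 'I_n -> set mR | forall i, measurable (A i)]].
apply: (measure_unique G (fun=> setT)) => //.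
- apply/seteqP; split.
    apply: smallest_sub; first exact: smallest_sigma_algebra.
    rewrite -bigcup_seq; apply: bigcup_sub => i _ A [B mB <-]; rewrite setTI.
    apply: sub_sigma_algebra.
    exists (fun j => if j == i then B else setT).
      by move=> j /=; case: ifP.
    apply/seteqP; split => v /= => [/(_ i)|Bv j]; first by rewrite eqxx.
    by case: eqP => // ->.
  apply: smallest_sub; first exact: sigma_algebra_measurable.
  by move=> _ [A mA <-]; exact: measurable_box_rV.
- move=> _ _ [A mA <-] [B mB <-]; exists (fun i => A i `&` B i).
    by move=> i; exact: measurableI.
  by apply/seteqP; split => v /= => [h|[h1 h2] i //]; split => i; have [] := h i.
- by move=> _; exists (fun=> setT) => //; rewrite box_rVT.
- by rewrite bigcup_const//; exists 0%N.
- by move=> _ [A mA <-]; rewrite nuE// product_rV_box.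
- by move=> _; rewrite -box_rVT nuE// big1// ltry.
Qed.

End product_rV_theory.

(** * Normal laws on R^n *)

Section gaussP.
Context {R : realType} (n : nat) (mu : 'rV[R]_n) (v : R).

Lemma normal_rV_setT : normal_rV mu v setT = 1%E.
Proof. by apply: product_rV_setT => i; exact: probability_setT. Qed.

(** normal_rV as a constant of its own, which carries the structure of a
    probability. *)
Definition gaussP (A : set 'rV[R]_n) : \bar R := normal_rV mu v A.

Let gaussP0 : gaussP set0 = 0%E. Proof. exact: measure0. Qed.

Let gaussP_ge0 A : (0 <= gaussP A)%E. Proof. exact: measure_ge0. Qed.

Let gaussP_sigma_additive : semi_sigma_additive gaussP.
Proof. exact: measure_semi_sigma_additive. Qed.

HB.instance Definition _ := isMeasure.Build _ _ _
  gaussP gaussP0 gaussP_ge0 gaussP_sigma_additive.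

HB.instance Definition _ :=
  @Measure_isProbability.Build _ _ R gaussP normal_rV_setT.

Lemma integral_gaussP D (f : 'rV[R]_n -> \bar R) : measurable D ->
  (\int[gaussP]_(x in D) f x = \int[normal_rV mu v]_(x in D) f x)%E.
Proof. by move=> mD; apply: eq_measure_integral. Qed.

End gaussP.

Section normal_rV_theory.
Context {R : realType}.
Notation mR := (measurableTypeR R).

Lemma gaussP_box n (mu : 'rV[R]_n) v (A : 'I_n -> set mR) :
  (forall i, measurable (A i)) ->
  gaussP mu v (box_rV A) =
  (\prod_i normal_prob (mu ord0 i) (Num.sqrt v) (A i))%E.
Proof. by move=> mA; rewrite /gaussP /normal_rV product_rV_box. Qed.

Lemma gaussP_coord n (mu : 'rV[R]_n) v i (A : set mR) : measurable A ->
  gaussP mu v ((fun x => x ord0 i) @^-1` A) =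
  normal_prob (mu ord0 i) (Num.sqrt v) A.
Proof.
move=> mA.
rewrite [X in gaussP mu v X](_ : _ =
    box_rV (fun j => if j == i then A else setT)); last first.
  apply/seteqP; split => x /= => [Bv j|/(_ i)]; last by rewrite eqxx.
  by case: eqP => // ->.
rewrite gaussP_box; last by move=> j; case: ifP.
rewrite (bigD1 i)//= eqxx big1 ?mule1// => j /negbTE ->.
exact: probability_setT.
Qed.

Lemma integral_gaussP_coord n (mu : 'rV[R]_n) v i (f : R -> \bar R) :
  measurable_fun setT f -> (forall x, 0 <= f x)%E ->
  (\int[gaussP mu v]_x f (x ord0 i) =
   \int[normal_prob (mu ord0 i) (Num.sqrt v)]_x f x)%E.
Proof.
move=> mf f0.
have mc : measurable_fun setT (fun x : 'rV[R]_n => (x ord0 i : mR)).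
  exact: measurable_rV_coord.
rewrite (ge0_integral_comp mc)//; apply: eq_measure_integral => A mA _.
exact: gaussP_coord.
Qed.

(** A shift is absorbed by an increase of the variance, at the price of a factor
    exponential in the square of the shift. *)
Lemma gaussP_shift_le n (mu b : 'rV[R]_n) v a (G : 'rV[R]_n -> \bar R) :
  0 < v -> 0 < a -> measurable_fun setT G -> (forall x, 0 <= G x)%E ->
  (\int[gaussP mu v]_y G (y + b)%R <=
   (Num.sqrt (1 + a) ^+ n * expR (sqn b / (a * v *+ 2)))%R%:E *
   \int[gaussP mu ((1 + a) * v)]_y G y)%E.
Proof.
move=> v0 a0 mG G0.
pose T i (x : mR) : mR := x + b ord0 i.
have mT i : measurable_fun setT (T i) by exact: measurable_shiftr.
have mmT := measurable_map_rV mT.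
pose c i := Num.sqrt (1 + a) * expR (b ord0 i ^+ 2 / (a * v *+ 2)).
have c0 i : 0 <= c i by rewrite mulr_ge0 ?sqrtr_ge0 ?expR_ge0.
have cE : Num.sqrt (1 + a) ^+ n * expR (sqn b / (a * v *+ 2)) = \prod_i c i.
  rewrite big_split/= prodr_const card_ord /sqn mulr_suml.
  by congr (_ * _); rewrite expR_sum.
have C0 : 0 <= \prod_i c i by exact: prodr_ge0.
have TE y : y + b = map_rV T y by apply/rowP => i; rewrite !mxE.
apply: (@le_trans _ _ (\int[gaussP mu v]_y G (map_rV T y))%E).
  by rewrite le_eqVlt; apply/orP; left; apply/eqP; apply: eq_integral => y _; rewrite TE.
rewrite cE -(ge0_integral_mscale _ _ (NngNum C0))//.
rewrite (ge0_integral_comp mmT)//.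
apply: ge0_le_measure_integral => // A mA.
apply: product_rV_dominated => // i B mB.
exact: normal_prob_shift_le.
Qed.

Lemma measurable_row_mx k l : measurable_fun setT
  (fun yz : 'rV[R]_k * 'rV[R]_l => row_mx yz.1 yz.2).
Proof.
apply/measurable_fun_rVP => i; case: (split_ordP i) => j ->.
  under eq_fun do rewrite row_mxEl.
  exact: (measurableT_comp (measurable_rV_coord j) measurable_fst).
under eq_fun do rewrite row_mxEr.
exact: (measurableT_comp (measurable_rV_coord j) measurable_snd).
Qed.

(** The pair of two independent Gaussian vectors as one Gaussian vector of
    R^(k + l), where weak gradients are formulated. *)
Lemma gaussP_row_mx k l (mu : 'rV[R]_k) (mu' : 'rV[R]_l) v A : measurable A ->
  (gaussP mu v \x gaussP mu' v)%E [set yz | A (row_mx yz.1 yz.2)] =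
  gaussP (row_mx mu mu') v A.
Proof.
move=> mA; have mr := @measurable_row_mx k l.
apply: (product_rV_unique (nu := pushforward_measure
  (gaussP mu v \x gaussP mu' v)%E mr)) => // [i|B mB].
  exact: probability_setT.
rewrite /= /pushforward.
rewrite [X in (_ \x _)%E X](_ : _ =
    box_rV (fun i => B (lshift l i)) `*` box_rV (fun i => B (rshift k i))).
  rewrite product_measure1E; [|by apply: measurable_box_rV => i; exact: mB..].
  rewrite big_split_ord/= !gaussP_box; [|by move=> i; exact: mB..].
  apply: (f_equal2 (fun x y => (x * y)%E)); apply: eq_bigr => i _; first by rewrite row_mxEl.
  by rewrite row_mxEr.
apply/seteqP; split => -[y z] /=.
  move=> Bv; split => i; first by have := Bv (lshift l i); rewrite row_mxEl.
  by have := Bv (rshift k i); rewrite row_mxEr.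
move=> [By Bz] i; case: (split_ordP i) => j ->; first by rewrite row_mxEl; exact: By.
by rewrite row_mxEr; exact: Bz.
Qed.

(** The law of (Y, s w) is absolutely continuous on R^(n + n). *)
Lemma gaussP_lebesgue_null n (mu : 'rV[R]_n) v s (A : set 'rV[R]_(n + n)) :
  0 < s -> measurable A -> lebesgue_rV R (n + n) A = 0%E ->
  (gaussP mu v \x gaussP 0 v)%E [set yw | A (row_mx yw.1 (s *: yw.2))] = 0%E.
Proof.
move=> s0 mA A0.
pose t : 'rV[R]_(n + n) := row_mx (const_mx 1) (const_mx s).
have t0 i : 0 < t ord0 i.
  by case: (split_ordP i) => j ->; rewrite /t ?row_mxEl ?row_mxEr mxE.
pose T i (x : mR) : mR := t ord0 i * x.
have mT i : measurable_fun setT (T i) by exact: measurable_scaler.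
have mTA : measurable (map_rV T @^-1` A).
  by rewrite -[X in measurable X]setTI; exact: measurable_map_rV.
have := gaussP_row_mx mu 0 v mTA.
rewrite [RHS](product_rV_null (q := fun=> lebesgue_measure))//.
  move=> <-; congr ((_ \x _)%E _); apply/seteqP; split => -[y w] /=;
  rewrite (_ : map_rV T (row_mx y w) = row_mx y (s *: w))//;
  by apply/rowP => i; rewrite mxE; case: (split_ordP i) => j ->;
     rewrite /T /t ?row_mxEl ?row_mxEr !mxE ?mul1r.
by move=> i B mB B0; exact: normal_prob_scale_null.
Qed.

(** The image of N(0, v) under the sign change is dominated by N(0, v); apply this
    twice, since the sign change is an involution. *)
Lemma gaussP_sign n v (e : 'I_n -> bool) (A : set 'rV[R]_n) :
  0 < v -> measurable A ->
  gaussP 0 v (map_rV (fun i x => (-1) ^+ e i * x) @^-1` A) = gaussP 0 v A.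
Proof.
move=> v0; pose T i (x : mR) : mR := (-1) ^+ e i * x.
have mT i : measurable_fun setT (T i) by exact: measurable_scaler.
have le B : measurable B -> (gaussP (0 : 'rV[R]_n) v (map_rV T @^-1` B) <= gaussP 0 v B)%E.
  move=> mB.
  have := product_rV_dominated mT (c := fun=> 1)
    (p := fun i => normal_prob ((0 : 'rV[R]_n) ord0 i) (Num.sqrt v))
    (q := fun i => normal_prob ((0 : 'rV[R]_n) ord0 i) (Num.sqrt v)).
  rewrite big1// => /(_ _ _ B mB); rewrite mul1e; apply => // i C mC.
  rewrite mul1e mxE /T; case: (e i) => /=.
    under eq_fun do rewrite expr1 mulN1r.
    by rewrite normal_prob_opp.
  by under eq_fun do rewrite expr0 mul1r.
move=> mA; apply/eqP; rewrite eq_le le//=.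
have mTA : measurable (map_rV T @^-1` A).
  by rewrite -[X in measurable X]setTI; exact: measurable_map_rV.
have := le _ mTA; congr (_ <= _)%E; congr (gaussP _ _ _).
apply/seteqP; split => x /=; rewrite (_ : map_rV T (map_rV T x) = x)//;
  by apply/rowP => i; rewrite !mxE /T mulrA -expr2 -exprM mulnC exprM sqrrN !expr1n mul1r.
Qed.

End normal_rV_theory.

(** * Exponential weights *)

(** A nonzero sum S of n nonnegative numbers is at most n + 1 times one of them: if
    all were less than S / (n + 1), one would get S < S, and n + 1 instead of n
    covers n = 0.  This turns exponential moments of |w|^2 into one-dimensional
    ones. *)
Lemma expR_sum_le {R : realType} n (x : 'I_n -> R) : (forall i, 0 <= x i) ->
  expR (\sum_i x i) <= 1 + \sum_i expR (n.+1%:R * x i).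
Proof.
move=> x0; set S := \sum_i x i.
have S0 : 0 <= S by exact: sumr_ge0.
have [/existsP[i Si]|/existsPn no] := boolP [exists i, S <= n.+1%:R * x i].
  rewrite (bigD1 i)//= addrA; apply: (@le_trans _ _ (expR (n.+1%:R * x i))).
    by rewrite ler_expR.
  rewrite -addrA addrCA lerDl addr_ge0//.
  by apply: sumr_ge0 => j _; exact: expR_ge0.
have : \sum_(i < n) n.+1%:R * x i <= \sum_(i < n) S.
  by apply: ler_sum => i _; have := no i; rewrite -ltNge => /ltW.
rewrite -mulr_sumr -/S sumr_const card_ord -[_ *+ n]mulr_natl -natr1 mulrDl.
move=> S0'; have -> : S = 0 by lra.
rewrite expR0 lerDl.
by apply: sumr_ge0 => i _; exact: expR_ge0.
Qed.

Section gauss_weight.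
Context {R : realType} (n : nat) (v : R).
Hypothesis v0 : 0 < v.

(** Chosen such that exp (2 (n + 1) gauss_rate x^2) = exp (x^2 / 4v), which is
    integrable against N(0, v). *)
Definition gauss_rate : R := (8 * n.+1%:R * v)^-1.

Lemma gauss_rate_gt0 : 0 < gauss_rate.
Proof. by rewrite invr_gt0 !mulr_gt0. Qed.

(** Dominates both the powers of |w| up to the fourth and the exponential factor
    that a shift by a small multiple of w costs. *)
Definition gauss_weight (w : 'rV[R]_n) : R :=
  (1 + sqn w) ^+ 2 * expR (gauss_rate * sqn w).

Lemma gauss_weight_ge0 w : 0 <= gauss_weight w.
Proof. by rewrite mulr_ge0 ?sqr_ge0 ?expR_ge0. Qed.

Lemma measurable_sqn d (T : measurableType d) (f : T -> 'rV[R]_n) :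
  measurable_fun setT f -> measurable_fun setT (fun x => sqn (f x)).
Proof.
move=> /measurable_fun_rVP mf; apply: measurable_sum => i.
exact: measurable_funX.
Qed.

Lemma measurable_gauss_weight : measurable_fun setT gauss_weight.
Proof.
have ms := measurable_sqn (@measurable_id _ 'rV[R]_n setT).
apply: measurable_funM.
  by apply: measurable_funX; apply: measurable_funD.
by apply: measurableT_comp => //; apply: measurable_funM.
Qed.

(** The polynomial factor is at most a constant times exp (gauss_rate |w|^2), and
    the resulting exp (2 gauss_rate |w|^2) is bounded by one-dimensional
    exponentials. *)
Lemma gauss_weight_integral : exists2 C : R, 0 < C &
  (\int[gaussP 0 v]_w (gauss_weight w)%:E <= C%:E)%E.
Proof.
pose b := gauss_rate; have b0 : 0 < b := gauss_rate_gt0.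
have b1 : expR b >= 1 by rewrite -expR0 ler_expR ltW.
pose c := 4 * b ^- 2 * expR b.
have c0 : 0 < c by rewrite !mulr_gt0 ?invr_gt0 ?exprn_gt0 ?expR_gt0.
have bound w : gauss_weight w <=
    c * (1 + \sum_i expR ((4 * v)^-1 * w ord0 i ^+ 2)).
  apply: (@le_trans _ _ (c * expR (2 * b * sqn w))).
    (* u^2 <= exp (2 u), and 2 u = b + b |w|^2 *)
    pose u := b * (1 + sqn w) / 2.
    have u0 : 0 <= u by rewrite divr_ge0// mulr_ge0 ?(ltW b0) ?addr_ge0 ?sqn_ge0.
    have h1 : u ^+ 2 <= expR (u + u).
      rewrite expRD -expr2 lerXn2r ?nnegrE ?expR_ge0//.
      by have := expR_ge1Dx u; lra.
    rewrite /gauss_weight -/b /c.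
    have -> : (1 + sqn w) ^+ 2 = 4 * b ^- 2 * u ^+ 2.
      by rewrite /u; field; rewrite gt_eqF.
    rewrite -!(mulrA (4 * b ^- 2)) ler_wpM2l//.
      by rewrite mulr_ge0// invr_ge0 exprn_ge0 ?(ltW b0).
    apply: (le_trans (ler_wpM2r (expR_ge0 _) h1)).
    by rewrite -!expRD ler_expR /u; lra.
  rewrite ler_wpM2l ?(ltW c0)//.
  rewrite (_ : 2 * b * sqn w = \sum_i (2 * b * w ord0 i ^+ 2)); last first.
    by rewrite /sqn mulr_sumr.
  apply: (le_trans (expR_sum_le _)).
    by move=> i; apply: mulr_ge0; [rewrite mulr_ge0// ltW|exact: sqr_ge0].
  rewrite lerD2l; apply: ler_sum => i _; rewrite ler_expR mulrA ler_wpM2r ?sqr_ge0//.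
  rewrite le_eqVlt; apply/orP; left; apply/eqP.
  rewrite /b /gauss_rate; field.
  by rewrite gt_eqF//= -(natr1 _) gt_eqF// ltr_wpDl.
have mei (i : 'I_n) : measurable_fun setT
    (fun w : 'rV[R]_n => (expR ((4 * v)^-1 * w ord0 i ^+ 2))%:E).
  apply/measurable_EFinP; apply: measurableT_comp => //.
  apply: measurable_funM => //; apply: measurable_funX.
  exact: measurable_rV_coord.
(* the exponential moment of the line at r = sqrt 2 *)
have rateE : (1 - (Num.sqrt 2) ^- 2) / (v *+ 2) = (4 * v)^-1.
  by rewrite sqr_sqrtr//; field; rewrite gt_eqF.
exists (c * (1 + n%:R * Num.sqrt 2)).
  by rewrite mulr_gt0// ltr_wpDr// mulr_ge0 ?sqrtr_ge0.
apply: (@le_trans _ _ (\int[gaussP 0 v]_w (c%:E * (1 +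
    \sum_i (expR ((4 * v)^-1 * w ord0 i ^+ 2))%:E))))%E.
  apply: ge0_le_integral => //.
  - by move=> w _; rewrite lee_fin gauss_weight_ge0.
  - by apply/measurable_EFinP; exact: measurable_gauss_weight.
  - apply: measurable_funeM; apply: emeasurable_funD => //.
    exact: emeasurable_sum.
  - by move=> w _; rewrite sumEFin -EFinD -EFinM lee_fin.
have S0 (w : 'rV[R]_n) : (0 <= \sum_i (expR ((4 * v)^-1 * w ord0 i ^+ 2))%:E)%E.
  by apply: sume_ge0 => i _; rewrite lee_fin expR_ge0.
rewrite ge0_integralZl//; last 3 first.
  apply: emeasurable_funD => //; exact: emeasurable_sum.
  by move=> w _; rewrite adde_ge0.
  by rewrite lee_fin ltW.
rewrite ge0_integralD//; last exact: emeasurable_sum.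
rewrite integral_cst// mul1e.
rewrite [X in (_ * (X + _) <= _)%E](_ : _ = 1%E); last exact: probability_setT.
rewrite ge0_integral_sum; [|exact: measurableT|exact: mei|
  by move=> i w _; rewrite lee_fin expR_ge0].
rewrite (eq_bigr (fun=> (Num.sqrt 2)%:E)); last first.
  move=> i _; rewrite (@integral_gaussP_coord R n 0 v i
    (fun x => (expR ((4 * v)^-1 * x ^+ 2))%:E)).
  - by rewrite mxE -rateE; apply: normal_prob_exp_moment; rewrite ?sqrtr_gt0.
  - by apply/measurable_EFinP; apply: measurableT_comp => //; exact: measurable_funM.
  - by move=> x; rewrite lee_fin expR_ge0.
by rewrite sumEFin sumr_const card_ord -EFinD -EFinM mulr_natl.
Qed.

End gauss_weight.

(** * A Gaussian vector and an independent perturbation *)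

Section gauss_pair_def.
Context {R : realType} (n : nat) (mu : 'rV[R]_n) (v : R).
Notation rV2 := ('rV[R]_n * 'rV[R]_n)%type.

(** The joint law of Y and of one perturbation, a measure of its own so that
    its product structure is only unfolded on demand. *)
Definition gauss_pair (A : set rV2) : \bar R := (gaussP mu v \x gaussP 0 v)%E A.

Let gauss_pair0 : gauss_pair set0 = 0%E. Proof. exact: measure0. Qed.

Let gauss_pair_ge0 A : (0 <= gauss_pair A)%E. Proof. exact: measure_ge0. Qed.

Let gauss_pair_sigma_additive : semi_sigma_additive gauss_pair.
Proof. exact: measure_semi_sigma_additive. Qed.

HB.instance Definition _ := isMeasure.Build _ _ _
  gauss_pair gauss_pair0 gauss_pair_ge0 gauss_pair_sigma_additive.

Let gauss_pair_setT : gauss_pair setT = 1%E.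
Proof.
rewrite /gauss_pair -setXTT product_measure1E//.
rewrite [X in (X * _)%E](_ : _ = 1%E); last exact: probability_setT.
by rewrite mul1e; exact: probability_setT.
Qed.

HB.instance Definition _ :=
  @Measure_isProbability.Build _ _ R gauss_pair gauss_pair_setT.

Lemma integral_gauss_pair (f : rV2 -> \bar R) : measurable_fun setT f ->
  (forall z, 0 <= f z)%E ->
  (\int[gauss_pair]_z f z = \int[gaussP 0 v]_w \int[gaussP mu v]_y f (y, w))%E.
Proof.
move=> mf f0; rewrite -(fubini_tonelli2 f mf f0).
exact: eq_measure_integral.
Qed.

Lemma integral_gauss_pair_swap (f : rV2 -> \bar R) : measurable_fun setT f ->
  (forall z, 0 <= f z)%E ->
  (\int[gauss_pair]_z f z = \int[gaussP mu v]_y \int[gaussP 0 v]_w f (y, w))%E.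
Proof.
move=> mf f0; rewrite -(fubini_tonelli1 f mf f0).
exact: eq_measure_integral.
Qed.

Lemma measurable_integral_gauss_pair (f : rV2 -> \bar R) : measurable_fun setT f ->
  (forall z, 0 <= f z)%E ->
  measurable_fun setT (fun w => \int[gaussP mu v]_y f (y, w))%E.
Proof. by move=> mf f0; exact: (measurable_fun_fubini_tonelli_G _ mf f0). Qed.

End gauss_pair_def.

Section gauss_domination.
Context {R : realType} (n : nat) (mu : 'rV[R]_n) (v : R).
Hypothesis v0 : 0 < v.
Notation Q := (gauss_pair mu v).
Notation rV2 := ('rV[R]_n * 'rV[R]_n)%type.

Lemma measurable_perturb s :
  measurable_fun setT (fun z : rV2 => z.1 + s *: z.2).
Proof.
apply: measurable_rVD; first exact: measurable_fst.
by apply: measurable_rVZ => //; exact: measurable_snd.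
Qed.

(** For fixed w the shift by s w costs the factor exp (s^2 |w|^2 / (2 a v)), which
    gauss_weight absorbs as soon as s^2 <= 2 a v gauss_rate.  The constant does
    not depend on s, F and G. *)
Lemma gauss_domination a : 0 < a -> exists C s0 : R, [/\ 0 < C, 0 < s0 &
  forall s, 0 <= s <= s0 -> forall (F : 'rV[R]_n -> R) (G : 'rV[R]_n -> \bar R),
  measurable_fun setT F -> (forall w, 0 <= F w <= (1 + sqn w) ^+ 2) ->
  measurable_fun setT G -> (forall y, 0 <= G y)%E ->
  (\int[Q]_z ((F z.2)%:E * G (z.1 + s *: z.2)%R) <=
   C%:E * \int[gaussP mu ((1 + a) * v)]_y G y)%E].
Proof.
move=> a0; have [W W0 hW] := @gauss_weight_integral R n v v0.
have b0 := @gauss_rate_gt0 R n v v0.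
set b := gauss_rate n v in b0.
pose k := Num.sqrt (1 + a) ^+ n.
have k0 : 0 < k by rewrite exprn_gt0// sqrtr_gt0; lra.
have sb0 : 0 < 2 * a * v * b by rewrite !mulr_gt0.
exists (k * W), (Num.sqrt (2 * a * v * b)); split; [exact: mulr_gt0|by rewrite sqrtr_gt0|].
move=> s /andP[s_ge0 ss0] F G mF F01 mG G0.
have s2 : s ^+ 2 <= 2 * a * v * b.
  by rewrite -(sqr_sqrtr (ltW sb0)) lerXn2r ?nnegrE ?sqrtr_ge0.
set IG := (\int[gaussP mu ((1 + a) * v)]_y G y)%E.
have IG0 : (0 <= IG)%E by exact: integral_ge0.
have mFG : measurable_fun setT
    (fun z : rV2 => (F z.2)%:E * G (z.1 + s *: z.2)%R)%E.
  apply: emeasurable_funM.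
    by apply/measurable_EFinP; exact: (measurableT_comp mF measurable_snd).
  exact: (measurableT_comp mG (measurable_perturb s)).
have F0 w : 0 <= F w by have /andP[] := F01 w.
have FG0 (z : rV2) : (0 <= (F z.2)%:E * G (z.1 + s *: z.2)%R)%E.
  by rewrite mule_ge0 ?lee_fin.
rewrite integral_gauss_pair//=.
apply: (@le_trans _ _ (\int[gaussP 0 v]_w (k%:E * IG * (gauss_weight v w)%:E))%E).
  apply: ge0_le_integral.
  - exact: measurableT.
  - by move=> w _; apply: integral_ge0 => y _; exact: (FG0 (y, w)).
  - exact: (measurable_integral_gauss_pair _ _ mFG FG0).
  - by apply: measurable_funeM; apply/measurable_EFinP; exact: measurable_gauss_weight.
  move=> w _.
  have mGw : measurable_fun setT (fun y : 'rV[R]_n => G (y + s *: w)%R).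
    apply: (measurableT_comp mG); apply: measurable_rVD; first exact: measurable_id.
    exact: measurable_cst.
  rewrite ge0_integralZl ?lee_fin//.
  apply: (@le_trans _ _ ((F w)%:E * ((k * expR (sqn (s *: w) / (a * v *+ 2)))%:E * IG)))%E.
    by apply: lee_wpmul2l; [rewrite lee_fin|exact: gaussP_shift_le].
  rewrite muleA [X in (_ <= X)%E]muleAC; apply: lee_wpmul2r => //.
  rewrite -!EFinM lee_fin /gauss_weight mulrCA ler_wpM2l ?(ltW k0)//.
  have /andP[_ Fw] := F01 w.
  apply: ler_pM => //.
  rewrite ler_expR sqnZ mulrAC ler_wpM2r ?sqn_ge0//.
  rewrite ler_pdivrMr ?mulrn_wgt0 ?mulr_gt0//.
  by rewrite (le_trans s2)// le_eqVlt; apply/orP; left; apply/eqP; rewrite /b; ring.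
rewrite ge0_integralZl; last 4 first.
  exact: measurableT.
  by apply/measurable_EFinP; exact: measurable_gauss_weight.
  by move=> w _; rewrite lee_fin gauss_weight_ge0.
  by rewrite mule_ge0// lee_fin ltW.
rewrite EFinM muleAC; apply: lee_wpmul2r => //.
by apply: lee_wpmul2l => //; rewrite lee_fin ltW.
Qed.

End gauss_domination.

(** * Increments of weakly differentiable maps *)

Section smooth_increment.
Context {R : realType} (n : nat) (mu : 'rV[R]_n) (v : R).
Hypothesis v0 : 0 < v.
Notation Q := (gauss_pair mu v).
Notation rV2 := ('rV[R]_n * 'rV[R]_n)%type.
Notation leb := (@lebesgue_measure R).
Notation I01 := (`[0%R, 1%R]%classic : set (measurableTypeR R)).

Variables (f : 'rV[R]_n -> 'rV[R]_n) (Df : 'rV[R]_n -> 'M[R]_n).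
Hypothesis mf : measurable_fun setT f.
Hypothesis mDf : forall i, measurable_fun setT (fun y => row i (Df y)).
Hypothesis gDf :
  forall i, weak_gradient (fun y => f y ord0 i) (fun y => row i (Df y)).

Let lebI : leb I01 = 1%E.
Proof. by rewrite lebesgue_measure_itv/= lte_fin ltr01 oppr0 adde0. Qed.

Lemma measurable_l2norm_jacobian : measurable_fun setT (fun y => l2norm (Df y) ^+ 2).
Proof.
under eq_fun do rewrite l2norm_sqr.
apply: measurable_sum => i; apply: measurable_sum => j; apply: measurable_funX.
rewrite (_ : (fun y => Df y i j) = (fun y => row i (Df y) ord0 j)).
  exact: (measurableT_comp (measurable_rV_coord j) (mDf i)).
by apply/funext => y; rewrite mxE.
Qed.

(** Jensen's inequality in t and the Cauchy-Schwarz inequality, in each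
    coordinate. *)
Lemma sqn_increment_le y z :
  (forall i, (f (y + z) ord0 i - f y ord0 i)%:E =
     \int[leb]_(t in I01) (\sum_j z ord0 j * row i (Df (y + t *: z)) ord0 j)%:E)%E ->
  ((sqn (f (y + z) - f y))%:E <=
   \int[leb]_(t in I01) (sqn z * l2norm (Df (y + t *: z)) ^+ 2)%:E)%E.
Proof.
move=> hz; have mI : measurable I01 by exact: measurable_itv.
have my : measurable_fun setT (fun t : measurableTypeR R => y + t *: z).
  apply: measurable_rVD; first exact: measurable_cst.
  by apply: measurable_rVZ => //; exact: measurable_cst.
have mrow i : measurable_fun setT (fun t : measurableTypeR R => row i (Df (y + t *: z))).
  exact: (measurableT_comp (mDf i) my).
have mdot i : measurable_fun setT (fun t : measurableTypeR R => dotv z (row i (Df (y + t *: z)))).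
  by apply: measurable_dotv => //; exact: measurable_cst.
have mrs i : measurable_fun I01 (fun t => (sqn z * sqn (row i (Df (y + t *: z))))%:E).
  apply: measurable_funTS; apply/measurable_EFinP; apply: measurable_funM => //.
  exact: measurable_sqn.
rewrite (_ : (fun t : measurableTypeR R => (sqn z * l2norm (Df (y + t *: z)) ^+ 2)%:E) =
    (fun t => \sum_i (sqn z * sqn (row i (Df (y + t *: z))))%:E)%E); last first.
  apply/funext => t; rewrite sumEFin -mulr_sumr l2norm_sqr; congr ((_ * _)%:E).
  by apply: eq_bigr => i _; apply: eq_bigr => j _; rewrite mxE.
rewrite ge0_integral_sum//; last first.
  by move=> i t _; rewrite lee_fin mulr_ge0 ?sqn_ge0.
rewrite /sqn -sumEFin; apply: lee_sum => i _.
rewrite [X in (X%:E <= _)%E](_ : _ = (f (y + z) ord0 i - f y ord0 i) ^+ 2); last first.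
  by rewrite !mxE.
have mdotI := measurable_funTS (mdot i) : measurable_fun I01 _.
apply: (le_trans (sqr_integral_le mI lebI mdotI _)); first by rewrite hz.
apply: ge0_le_integral => //.
- by move=> t _; rewrite lee_fin sqr_ge0.
- by apply: measurable_funTS; apply/measurable_EFinP; exact: measurable_funX.
- exact: mrs.
- by move=> t _; rewrite lee_fin; exact: cauchy_schwarz.
Qed.

(** The pair (Y, s w) has a law that is absolutely continuous on R^(n + n), so that
    the exceptional set of the weak gradient is negligible for it. *)
Lemma weak_gradient_gauss s : 0 < s ->
  {ae Q, forall z : rV2,
   ((sqn (f (z.1 + s *: z.2) - f z.1))%:E <= \int[leb]_(t in I01)
     (s ^+ 2 * sqn z.2 * l2norm (Df (z.1 + (t * s) *: z.2)) ^+ 2)%:E)%E}.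
Proof.
move=> s0.
have ae_i i : {ae Q, forall z : rV2,
    ((f (z.1 + s *: z.2) ord0 i - f z.1 ord0 i)%:E =
     \int[leb]_(t in I01) (\sum_j (s *: z.2) ord0 j *
        row i (Df (z.1 + t *: (s *: z.2))) ord0 j)%:E)%E}.
  have [N [mN N0 sN]] := gDf i.
  exists [set z : rV2 | N (row_mx z.1 (s *: z.2))]; split.
  - rewrite -[X in measurable X]setTI.
    have mp : measurable_fun setT (fun z : rV2 => (z.1, s *: z.2)).
      apply: measurable_fun_pair; first exact: measurable_fst.
      by apply: measurable_rVZ => //; exact: measurable_snd.
    exact: (measurableT_comp (@measurable_row_mx R n n) mp).
  - exact: gaussP_lebesgue_null.
  - move=> z /= hz; apply: sN => /= h; apply: hz.
    by move: h; rewrite row_mxKl row_mxKr.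
apply: filterS (filter_forall (ae_filter_ringOfSetsType Q) ae_i) => z hz.
apply: (le_trans (sqn_increment_le hz)).
rewrite le_eqVlt; apply/orP; left; apply/eqP; apply: eq_integral => t _.
by rewrite sqnZ scalerA.
Qed.

(** After exchanging the integrals, gauss_domination applies for each t, to the
    perturbation size t s <= s0 and with F the fourth power of |w|: one square
    comes from the increment, the other one from the weight. *)
Lemma smooth_increment_bound a : 0 < a ->
  (\int[gaussP mu ((1 + a) * v)]_y (l2norm (Df y) ^+ 2)%:E < +oo)%E ->
  exists C s0 : R, [/\ 0 <= C, 0 < s0 & forall s, 0 < s <= s0 ->
  (\int[Q]_z (sqn z.2 * sqn (f (z.1 + s *: z.2) - f z.1))%:E <= (C * s ^+ 2)%:E)%E].
Proof.
move=> a0 Doo; have [C [s0 [C0 s00 dom]]] := gauss_domination mu v0 a0.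
set ID := (\int[_]_y _)%E in Doo.
have ID0 : (0 <= ID)%E by apply: integral_ge0 => y _; rewrite lee_fin sqr_ge0.
have IDE : ID = (fine ID)%:E by rewrite fineK// ge0_fin_numE.
exists (C * fine ID), s0; split => //; first by rewrite mulr_ge0 ?fine_ge0// ltW.
move=> s /andP[sgt0 ss0].
have msqnf : measurable_fun setT (fun z : rV2 => sqn (f (z.1 + s *: z.2) - f z.1)).
  apply: measurable_sqn; apply: measurable_rVB.
    exact: (measurableT_comp mf (measurable_perturb s)).
  exact: (measurableT_comp mf measurable_fst).
have msqn : measurable_fun setT (fun z : rV2 => sqn z.2).
  by apply: measurable_sqn; exact: measurable_snd.
pose H (z : rV2) (t : R) : R := s ^+ 2 * sqn z.2 ^+ 2 *
   l2norm (Df (z.1 + (t * s) *: z.2)) ^+ 2 * \1_I01 t.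
have H0 z t : 0 <= H z t.
  apply: mulr_ge0; last by rewrite indicE ler0n.
  by apply: mulr_ge0; [apply: mulr_ge0|]; exact: sqr_ge0.
have mDt d (U : measurableType d) (p : U -> R) (q : U -> rV2) :
    measurable_fun setT p -> measurable_fun setT q ->
    measurable_fun setT (fun u => l2norm (Df ((q u).1 + (p u * s) *: (q u).2)) ^+ 2).
  move=> mp mq; apply: (measurableT_comp measurable_l2norm_jacobian).
  apply: measurable_rVD; first exact: (measurableT_comp measurable_fst mq).
  apply: measurable_rVZ; first exact: measurable_funM.
  exact: (measurableT_comp measurable_snd mq).
have mH : measurable_fun setT (fun zt : rV2 * measurableTypeR R => (H zt.1 zt.2)%:E).
  apply/measurable_EFinP; apply: measurable_funM; last first.
    apply: (measurableT_comp _ measurable_snd); exact: measurable_indic.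
  apply: measurable_funM; last first.
    exact: (mDt _ _ _ _ measurable_snd measurable_fst).
  apply: measurable_funM => //; apply: measurable_funX.
  exact: (measurableT_comp msqn measurable_fst).
apply: (@le_trans _ _ (\int[Q]_z \int[leb]_t (H z t)%:E)%E).
  apply: ae_ge0_le_integral.
  - exact: measurableT.
  - by move=> z _; rewrite lee_fin mulr_ge0 ?sqn_ge0.
  - by apply/measurable_EFinP; exact: measurable_funM.
  - by move=> z _; apply: integral_ge0 => t _; rewrite lee_fin.
  - apply: (measurable_fun_fubini_tonelli_F _ mH) => -[z t] /=.
    by rewrite lee_fin.
  apply: filterS (weak_gradient_gauss sgt0) => z hz _.
  rewrite EFinM; apply: (le_trans (lee_wpmul2l _ hz)); first by rewrite lee_fin sqn_ge0.
  rewrite -ge0_integralZl; last 4 first.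
    exact: measurable_itv.
    apply: measurable_funTS; apply/measurable_EFinP; apply: measurable_funM => //.
    apply: (mDt _ (measurableTypeR R) (fun t => t) (fun=> z)).
      exact: measurable_id.
    exact: measurable_cst.
    move=> t _; rewrite lee_fin; apply: mulr_ge0; last exact: sqr_ge0.
    by rewrite mulr_ge0 ?sqr_ge0 ?sqn_ge0.
    by rewrite lee_fin sqn_ge0.
  rewrite integral_mkcond le_eqVlt; apply/orP; left; apply/eqP.
  apply: eq_integral => t _; rewrite epatch_indic -!EFinM; congr (_%:E).
  by rewrite /H; ring.
have -> : (\int[Q]_z \int[leb]_t (H z t)%:E = \int[leb]_t \int[Q]_z (H z t)%:E)%E.
  apply: (fubini_tonelli (m1 := Q) (m2 := leb)
    (fun zt : rV2 * measurableTypeR R => (H zt.1 zt.2)%:E) mH).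
  by move=> -[z t]; rewrite lee_fin.
apply: (@le_trans _ _ (\int[leb]_(t in I01) ((s ^+ 2)%:E * (C%:E * ID))))%E.
  rewrite [leRHS]integral_mkcond; apply: ge0_le_integral.
  - exact: measurableT.
  - by move=> t _; apply: integral_ge0 => z _; rewrite lee_fin.
  - apply: (measurable_fun_fubini_tonelli_G _ mH) => -[z t] /=.
    by rewrite lee_fin.
  - apply/(measurable_restrictT _ _).1; first exact: measurable_itv.
    exact: measurable_cst.
  move=> t _; rewrite epatch_indic/=.
  have [t01|t01] := boolP (t \in I01); last first.
    rewrite indicE (negbTE t01) mule0 integral0_eq// => z _.
    by rewrite /H indicE (negbTE t01) mulr0.
  rewrite indicE t01 mule1.
  have /andP[t0 t1] : 0 <= t <= 1 by move: t01; rewrite inE/= in_itv.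
  have ts : 0 <= t * s <= s0.
    rewrite mulr_ge0 ?(ltW sgt0)//= (le_trans _ ss0)//.
    by rewrite ler_piMl// ltW.
  have msq : measurable_fun setT (fun w : 'rV[R]_n => sqn w ^+ 2).
    by apply: measurable_funX; apply: measurable_sqn; exact: measurable_id.
  have mDE : measurable_fun setT (fun y => (l2norm (Df y) ^+ 2)%:E).
    by apply/measurable_EFinP; exact: measurable_l2norm_jacobian.
  have F01 (w : 'rV[R]_n) : 0 <= sqn w ^+ 2 <= (1 + sqn w) ^+ 2.
    by rewrite sqr_ge0/= lerXn2r ?nnegrE ?addr_ge0 ?sqn_ge0// lerDr.
  have domt := dom _ ts _ _ msq F01 mDE (fun y => sqr_ge0 _).
  apply: (le_trans _ (lee_wpmul2l _ domt)); last by rewrite lee_fin sqr_ge0.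
  rewrite -ge0_integralZl; last 4 first.
    exact: measurableT.
    apply: emeasurable_funM; apply/measurable_EFinP.
      by apply: (measurableT_comp msq); exact: measurable_snd.
    exact: (measurableT_comp measurable_l2norm_jacobian (measurable_perturb (t * s))).
    by move=> z _; rewrite -EFinM lee_fin mulr_ge0 ?sqr_ge0.
    by rewrite lee_fin sqr_ge0.
  rewrite le_eqVlt; apply/orP; left; apply/eqP; apply: eq_integral => z _.
  by rewrite -!EFinM /H indicE t01 mulr1 mulrA.
rewrite integral_cst; last exact: measurable_itv.
rewrite [X in (_ * X <= _)%E](_ : _ = 1%E); last exact: lebI.
by rewrite mule1 IDE -!EFinM mulrC lexx.
Qed.

End smooth_increment.

(** * Mass of the slabs around the discontinuities *)

Section slab.
Context {R : realType} (n : nat) d (T : measurableType d) (P : probability T R).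
Variables (Y : T -> 'rV[R]_n) (a : 'rV[R]_n -> 'rV[R]_n) (h : 'rV[R]_n -> R).
Hypotheses (mY : measurable_fun setT Y) (mh : measurable_fun setT h).
Notation leb := (@lebesgue_measure R).

(** Near zero the mass of |a(Y)|^2 on the slab |h(Y)| <= r is the integral of
    the bounded function p m; for large r it is at most the total mass. *)
Lemma slab_mass_le : bounded_near_zero P Y a h ->
  exists2 C : R, 0 <= C & forall r, 0 <= r ->
  (\int[P]_w (sqn (a (Y w)) * \1_(`[- r, r]%classic) (h (Y w)))%:E <=
   (C * r)%:E)%E.
Proof.
move=> [t0 [t00 [p [ma [[mp p0] hp [iX mma ima hma] hess]]]]].
pose B (r : R) : set (measurableTypeR R) := `[- r, r]%classic.
have mB r : measurable (B r) by exact: measurable_itv.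
have [M M0 hM] : exists2 M : R, 0 <= M &
    {ae leb, forall s, B t0 s -> p s * ma s <= M}.
  set E := ess_sup _ _ in hess.
  have EM : (E <= (Num.max (fine E) 0)%:E)%E.
    case: E hess => [e _|//|_] /=; last by rewrite leNye.
    by rewrite lee_fin le_max lexx.
  have [N [mN N0 sN]] := ess_supP EM.
  exists (Num.max (fine E) 0); first by rewrite le_max lexx orbT.
  exists (N `&` B t0); split; [exact: measurableI|exact: N0|].
  move=> s /= hs; split; last by apply: contrapT => h'; apply: hs => /h'.
  by apply: sN => /= h'; apply: hs => _; rewrite -lee_fin.
have mZ : measurable_fun setT (fun w => (h (Y w) : measurableTypeR R)).
  exact: (measurableT_comp mh mY).
pose Z w : measurableTypeR R := h (Y w).
have mZB r : measurable (Z @^-1` B r) by rewrite -[X in measurable X]setTI; exact: mZ.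
pose X w : R := l2norm (a (Y w)) ^+ 2.
have X0 w : 0 <= X w by exact: sqr_ge0.
have iXoo := iX; move/integrableP : iXoo => [mX Xoo].
have XE r : (\int[P]_w (sqn (a (Y w)) * \1_(B r) (h (Y w)))%:E =
             \int[P]_(w in Z @^-1` B r) (X w)%:E)%E.
  rewrite [RHS]integral_mkcond; apply: eq_integral => w _.
  by rewrite epatch_indic/= -EFinM /X l2norm_rV_sqr.
pose EX := fine (\int[P]_w (X w)%:E)%E.
have EX0 : (0 <= \int[P]_w (X w)%:E)%E by apply: integral_ge0 => w _; rewrite lee_fin.
have EXE : (\int[P]_w (X w)%:E = EX%:E)%E.
  rewrite /EX fineK// ge0_fin_numE//.
  move: Xoo; congr (_ < _)%E; apply: eq_integral => w _.
  by rewrite /= ger0_norm ?sqr_ge0.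
have EX1 : 0 <= EX by exact: fine_ge0.
exists (2 * M + EX / t0); first by apply: addr_ge0; [exact: mulr_ge0|rewrite divr_ge0// ltW].
move=> r r0; rewrite XE.
have [rt|tr] := ltP r t0; last first.
  apply: (@le_trans _ _ EX%:E).
    by rewrite -EXE; apply: ge0_subset_integral => // w _; rewrite lee_fin.
  rewrite lee_fin mulrDl (@le_trans _ _ (EX / t0 * r))//; last first.
    by rewrite lerDr !mulr_ge0.
  by rewrite -mulrA ler_peMr// mulrC ler_pdivlMr// mul1r.
have sB s : B r s -> `]- t0, t0[%classic s /\ B t0 s.
  by rewrite /B /= !in_itv/=; lra.
(* a version of a conditional mean may be negative on a null set *)
pose mp' s := Num.max (ma s) 0.
have mmp : measurable_fun setT (fun s : measurableTypeR R => (mp' s)%:E).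
  by apply/measurable_EFinP; exact: measurable_maxr.
have mp0 s : 0 <= mp' s by rewrite le_max lexx orbT.
rewrite -hma; last exact: mB.
apply: (@le_trans _ _ (\int[P]_(w in Z @^-1` B r) (mp' (Z w))%:E)%E).
  have [->|] := eqVneq (\int[P]_(w in Z @^-1` B r) (mp' (Z w))%:E)%E +oo%E.
    by rewrite leey.
  move=> fin; apply: le_integral => //.
  - exact: integrableS ima.
  - apply/integrableP; split.
      by apply: measurable_funTS; exact: (measurableT_comp mmp mZ).
    rewrite (_ : (\int[P]_(w in Z @^-1` B r) `|(mp' (Z w))%:E|)%E =
        (\int[P]_(w in Z @^-1` B r) (mp' (Z w))%:E)%E) ?ltey//.
    by apply: eq_integral => w _; rewrite gee0_abs ?lee_fin.
  - by move=> w _; rewrite lee_fin le_max lexx.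
have -> : (\int[P]_(w in Z @^-1` B r) (mp' (Z w))%:E =
    \int[pushforward_measure P mZ]_(s in B r) (mp' s)%:E)%E.
  rewrite (ge0_integral_pushforward mZ)//; first exact: (measurable_funTS mmp).
  by move=> s _; rewrite lee_fin.
rewrite (@ge0_integral_density_on _ _ _ leb (pushforward_measure P mZ) p (B r))//; last first.
  move=> A mA AB; apply: hp => // s /AB/sB[]//.
apply: (@le_trans _ _ (\int[leb]_(s in B r) (cst M%:E s))%E).
  apply: ae_ge0_le_integral => //.
  - by move=> s _; rewrite mule_ge0 ?lee_fin.
  - apply: measurable_funTS; apply: emeasurable_funM => //.
    exact/measurable_EFinP.
  apply: filterS hM => s hs Bs; have {}hs := hs (sB _ Bs).2.
  rewrite -EFinM lee_fin /mp' mulrC.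
  by case: (leP (ma s) 0) => // _; rewrite mulr0.
have lebB : leb (B r) = (r + r)%:E.
  rewrite lebesgue_measure_itv/= lte_fin; case: ltP => [_|rr].
    by rewrite -EFinB opprK.
  by congr (_%:E); lra.
rewrite integral_cst; last exact: mB.
rewrite [X in (_ * X <= _)%E](_ : _ = (r + r)%:E); last exact: lebB.
rewrite -EFinM lee_fin.
have : 0 <= EX / t0 * r by rewrite mulr_ge0// divr_ge0// ltW.
lra.
Qed.

End slab.

(** * Moments of non-centred normal laws *)

Section recentre.
Context {R : realType}.

Lemma normal_prob_recentre_le (m v : R) (A : set (measurableTypeR R)) :
  0 < v -> measurable A ->
  (normal_prob m (Num.sqrt v) A <=
   (Num.sqrt 2 * expR (m ^+ 2 / (v *+ 2)))%:E *
   normal_prob 0%R (Num.sqrt (2 * v)) A)%E.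
Proof.
move=> v0 mA.
have := @normal_prob_shift_le R 0 m v 1 A v0 ltr01 mA.
have e2 : 1 + 1 = 2 :> R by [].
rewrite mul1r e2; apply: le_trans.
rewrite le_eqVlt; apply/orP; left; apply/eqP; rewrite /normal_prob.
transitivity (\int[lebesgue_measure]_(x in (fun x : R => (x + m)%R) @^-1` A)
    (normal_pdf m (Num.sqrt v) (x + m))%:E)%E; last first.
  apply: eq_integral => x _; rewrite !normal_pdf_sqrt//.
  by rewrite addrK subr0.
apply/esym; apply: (ge0_integral_preserving (measurable_shiftr m)
  (f := fun x => (normal_pdf m (Num.sqrt v) x)%:E)) => //.
- by move=> B mB; exact: lebesgue_measure_shift.
- by apply/measurable_EFinP; exact: measurable_normal_pdf.
- by move=> x; rewrite lee_fin normal_pdf_ge0.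
Qed.

(** A shift by the mean, absorbed by doubling the variance. *)
Lemma gaussP_recentre_le n (mu : 'rV[R]_n) v : 0 < v ->
  exists2 k : R, 0 <= k & forall G : 'rV[R]_n -> \bar R,
  measurable_fun setT G -> (forall x, 0 <= G x)%E ->
  (\int[gaussP mu v]_y G y <= k%:E * \int[gaussP 0 (2 * v)]_y G y)%E.
Proof.
move=> v0; pose c i := Num.sqrt 2 * expR (mu ord0 i ^+ 2 / (v *+ 2)).
have c0 i : 0 <= c i by rewrite mulr_ge0 ?sqrtr_ge0 ?expR_ge0.
have C0 : 0 <= \prod_i c i by exact: prodr_ge0.
exists (\prod_i c i) => // G mG G0.
rewrite -(ge0_integral_mscale _ _ (NngNum C0))//.
apply: ge0_le_measure_integral => // A mA.
have mid (i : 'I_n) : measurable_fun setT (fun x : measurableTypeR R => x) by exact: measurable_id.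
have := product_rV_dominated (T := fun _ x => x)
   (p := fun i => normal_prob (mu ord0 i) (Num.sqrt v))
   (q := fun i => normal_prob ((0 : 'rV[R]_n) ord0 i) (Num.sqrt (2 * v))) mid c0 _ mA.
rewrite (_ : map_rV _ @^-1` A = A); last first.
  apply/seteqP; split => x /=; rewrite (_ : map_rV _ x = x)//;
  by apply/rowP => i; rewrite mxE.
by apply => i B mB; rewrite mxE; exact: normal_prob_recentre_le.
Qed.

Lemma gaussP_moment4 n (mu : 'rV[R]_n) v : 0 < v ->
  exists2 C : R, 0 <= C & (\int[gaussP mu v]_y (sqn y ^+ 2)%:E <= C%:E)%E.
Proof.
move=> v0; have [k k0 hk] := gaussP_recentre_le mu v0.
have v20 : 0 < 2 * v by rewrite mulr_gt0.
have [C C0 hC] := @gauss_weight_integral R n (2 * v) v20.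
have ms : measurable_fun setT (fun y : 'rV[R]_n => (sqn y ^+ 2)%:E).
  apply/measurable_EFinP; apply: measurable_funX.
  by apply: measurable_sqn; exact: measurable_id.
exists (k * C); first by rewrite mulr_ge0// ltW.
apply: (le_trans (hk _ ms _)); first by move=> y; rewrite lee_fin sqr_ge0.
rewrite EFinM; apply: lee_wpmul2l; first by rewrite lee_fin.
apply: le_trans hC; apply: ge0_le_integral => //.
- by move=> y _; rewrite lee_fin sqr_ge0.
- by apply/measurable_EFinP; exact: measurable_gauss_weight.
move=> y _; rewrite lee_fin /gauss_weight -[leLHS]mulr1.
apply: ler_pM => //; first exact: sqr_ge0.
  by rewrite lerXn2r ?nnegrE ?addr_ge0 ?sqn_ge0// lerDr.
rewrite -[leLHS]expR0 ler_expR; apply: mulr_ge0; last exact: sqn_ge0.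
exact: ltW (gauss_rate_gt0 n v20).
Qed.

End recentre.

(** * Orders of magnitude for vanishing perturbations *)

Section gauss_bigO.
Context {R : realType} (n : nat) (mu : 'rV[R]_n) (v : R).
Notation Q := (gauss_pair mu v).
Notation rV2 := ('rV[R]_n * 'rV[R]_n)%type.
Implicit Types F G : R -> rV2 -> R.

(** The bound is in the extended reals: it contains the finiteness of the
    integral. *)
Definition gauss_bigO F (e : R -> R) := exists2 C : R, 0 <= C &
  \forall s \near 0^'+, (\int[Q]_z (F s z)%:E <= (C * e s)%:E)%E.

Lemma gauss_bigO_le k F G e : 0 <= k ->
  (forall s, measurable_fun setT (F s)) -> (forall s, measurable_fun setT (G s)) ->
  (\forall s \near 0^'+, forall z, 0 <= F s z <= k * G s z) ->
  (forall s z, 0 <= G s z) ->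
  gauss_bigO G e -> gauss_bigO F e.
Proof.
move=> k0 mF mG FG G0 [C C0 hC]; exists (k * C); first exact: mulr_ge0.
apply: filterS2 FG hC => s FG hs.
rewrite -mulrA EFinM; apply: (le_trans _ (lee_wpmul2l _ hs)); last by rewrite lee_fin.
rewrite -ge0_integralZl; last 4 first.
  exact: measurableT.
  exact/measurable_EFinP.
  by move=> z _; rewrite lee_fin.
  by rewrite lee_fin.
apply: ge0_le_integral.
- exact: measurableT.
- by move=> z _; rewrite lee_fin; have /andP[] := FG z.
- exact/measurable_EFinP.
- by apply: measurable_funeM; exact/measurable_EFinP.
- by move=> z _; rewrite -EFinM lee_fin; have /andP[] := FG z.
Qed.

Lemma gauss_bigO_weaken F e e' : (\forall s \near 0^'+, e s <= e' s) ->
  gauss_bigO F e -> gauss_bigO F e'.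
Proof.
move=> ee [C C0 hC]; exists C => //; apply: filterS2 ee hC => s ee hs.
by apply: (le_trans hs); rewrite lee_fin ler_wpM2l.
Qed.

Lemma gauss_bigO_sum (I : finType) (F : I -> R -> rV2 -> R) e :
  (forall i s, measurable_fun setT (F i s)) ->
  (forall i s z, 0 <= F i s z) ->
  (forall i, gauss_bigO (F i) e) ->
  gauss_bigO (fun s z => \sum_i F i s z) e.
Proof.
move=> mF F0 hF.
have /choice[C hC] : forall i, exists C : R, 0 <= C /\
  \forall s \near 0^'+, (\int[Q]_z (F i s z)%:E <= (C * e s)%:E)%E.
  by move=> i; have [C] := hF i; exists C.
exists (\sum_i C i); first by apply: sumr_ge0 => i _; have [] := hC i.
have : \forall s \near 0^'+, forall i, (\int[Q]_z (F i s z)%:E <= (C i * e s)%:E)%E.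
  by apply: filter_forall => i; have [] := hC i.
apply: filterS => s hs.
under eq_integral do rewrite -sumEFin.
rewrite ge0_integral_sum; last 3 first.
  exact: measurableT.
  by move=> i; exact/measurable_EFinP.
  by move=> i z _; rewrite lee_fin.
by rewrite mulr_suml -sumEFin; apply: lee_sum => i _.
Qed.

Lemma gauss_bigO_add F G e :
  (forall s, measurable_fun setT (F s)) -> (forall s, measurable_fun setT (G s)) ->
  (forall s z, 0 <= F s z) -> (forall s z, 0 <= G s z) ->
  gauss_bigO F e -> gauss_bigO G e -> gauss_bigO (fun s z => F s z + G s z) e.
Proof.
move=> mF mG F0 G0 hF hG.
have := @gauss_bigO_sum bool (fun b => if b then F else G) e.
rewrite (_ : (fun s z => \sum_(b : bool) _) = (fun s z => F s z + G s z)).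
  by apply => [[]|[]|[]].
by apply/funext => s; apply/funext => z; rewrite big_bool.
Qed.

End gauss_bigO.

Lemma gauss_bigO_scale {R : realType} n (mu : 'rV[R]_n) v
    (F : R -> 'rV[R]_n * 'rV[R]_n -> R) (c e : R -> R) :
  (forall s, measurable_fun setT (F s)) -> (forall s z, 0 <= F s z) ->
  (\forall s \near 0^'+, 0 <= c s) ->
  gauss_bigO mu v F e ->
  gauss_bigO mu v (fun s z => c s * F s z) (fun s => c s * e s).
Proof.
move=> mF F0 c0 [C C0 hC]; exists C => //; apply: filterS2 c0 hC => s c0 hs.
under eq_integral do rewrite EFinM.
rewrite ge0_integralZl; last 4 first.
  exact: measurableT.
  exact/measurable_EFinP.
  by move=> z _; rewrite lee_fin.
  by rewrite lee_fin.
by rewrite mulrCA EFinM; apply: lee_wpmul2l => //; rewrite lee_fin.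
Qed.

Section vector_sums.
Context {R : realType} (n : nat).

Lemma sqn_sum_le m (x : 'I_m -> 'rV[R]_n) :
  sqn (\sum_l x l) <= m%:R * \sum_l sqn (x l).
Proof.
rewrite /sqn exchange_big/= mulr_sumr; apply: ler_sum => j _.
pose c : 'rV[R]_m := \row_l x l ord0 j.
have e1 : dotv (const_mx 1) c = \sum_l x l ord0 j.
  by apply: eq_bigr => l _; rewrite !mxE mul1r.
have e2 : sqn (const_mx 1 : 'rV[R]_m) = m%:R.
  rewrite /sqn (eq_bigr (fun=> 1)) ?sumr_const ?card_ord// => l _.
  by rewrite mxE expr1n.
have e3 : sqn c = \sum_l x l ord0 j ^+ 2.
  by apply: eq_bigr => l _; rewrite mxE.
by rewrite summxE -e1 -e2 -e3; exact: cauchy_schwarz.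
Qed.

End vector_sums.

Lemma sum_sqr_le {R : realType} m (x : 'I_m -> R) :
  (\sum_l x l) ^+ 2 <= m%:R * \sum_l x l ^+ 2.
Proof.
have := @sqn_sum_le R 1 m (fun l => const_mx (x l)).
rewrite /sqn big_ord1 summxE (eq_bigr x) => [|l _]; last by rewrite mxE.
by congr (_ <= _ * _); apply: eq_bigr => l _; rewrite big_ord1 mxE.
Qed.

(** * Smooth increments and jumps *)

Section piecewise.
Context {R : realType} (n : nat) (mu : 'rV[R]_n) (sigma : R).
Hypothesis sigma_gt0 : 0 < sigma.
Notation Q := (gauss_pair mu (sigma ^+ 2)).
Notation rV2 := ('rV[R]_n * 'rV[R]_n)%type.
Implicit Types f a : 'rV[R]_n -> 'rV[R]_n.

Let v0 : 0 < sigma ^+ 2. Proof. exact: exprn_gt0. Qed.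

Lemma near0_gt0 : \forall s \near (0 : R)^'+, 0 < s.
Proof. exact: nbhs_right_gt. Qed.

Lemma near0_le (s0 : R) : 0 < s0 -> \forall s \near (0 : R)^'+, 0 < s <= s0.
Proof.
move=> s00; near=> s; apply/andP; split; near: s; first exact: nbhs_right_gt.
exact: nbhs_right_le.
Unshelve. all: by end_near. Qed.

Lemma measurable_sqn_perturb f (s : R) : measurable_fun setT f ->
  measurable_fun setT (fun z : rV2 => sqn (f (z.1 + s *: z.2))).
Proof.
move=> mf; apply: measurable_sqn.
exact: (measurableT_comp mf (measurable_perturb s)).
Qed.

Lemma measurable_increment f (s : R) : measurable_fun setT f ->
  measurable_fun setT (fun z : rV2 => f (z.1 + s *: z.2) - f z.1).
Proof.
move=> mf; apply: measurable_rVB.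
  exact: (measurableT_comp mf (measurable_perturb s)).
exact: (measurableT_comp mf measurable_fst).
Qed.

Lemma measurable_sqn_increment f (s : R) : measurable_fun setT f ->
  measurable_fun setT
    (fun z : rV2 => sqn z.2 * sqn (f (z.1 + s *: z.2) - f z.1)).
Proof.
move=> mf; apply: measurable_funM.
  by apply: measurable_sqn; exact: measurable_snd.
by apply: measurable_sqn; exact: measurable_increment.
Qed.

(** Both estimates follow from gauss_domination at the variance of the moment
    condition, applied to the fourth power of |f| and to the square of |Df|. *)
Lemma smooth_moment_bigO f : smooth_moment mu sigma f ->
  gauss_bigO mu (sigma ^+ 2) (fun s z => sqn (f (z.1 + s *: z.2)) ^+ 2) (fun=> 1) /\
  gauss_bigO mu (sigma ^+ 2)
    (fun s z => sqn z.2 * sqn (f (z.1 + s *: z.2) - f z.1)) (fun s => s ^+ 2).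
Proof.
move=> [mf [Df [mDf gDf [a a0 [f4 Df2]]]]]; split.
  have [C [s0 [C0 s00 dom]]] := gauss_domination mu v0 a0.
  move: f4; rewrite -integral_gaussP// => f4.
  have mf4 : measurable_fun setT (fun y => (l2norm (f y) ^+ 4)%:E).
    by apply/measurable_EFinP; apply: measurable_funX; exact: measurable_l2norm.
  set I4 := (\int[_]_y _)%E in f4.
  have I40 : (0 <= I4)%E.
    by apply: integral_ge0 => y _; rewrite lee_fin exprn_ge0// l2norm_ge0.
  have I4E : I4 = (fine I4)%:E by rewrite fineK// ge0_fin_numE.
  exists (C * fine I4); first by rewrite mulr_ge0 ?fine_ge0// ltW.
  apply: filterS (near0_le s00) => s /andP[sgt0 ss0].
  have ss : 0 <= s <= s0 by rewrite ltW.
  have F01 (w : 'rV[R]_n) : 0 <= (1 : R) <= (1 + sqn w) ^+ 2.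
    by rewrite ler01 exprn_ege1// lerDl sqn_ge0.
  have G0 y : (0 <= (l2norm (f y) ^+ 4)%:E)%E.
    by rewrite lee_fin exprn_ge0// l2norm_ge0.
  have mone : measurable_fun setT (fun _ : 'rV[R]_n => 1 : R) by exact: measurable_cst.
  have := dom s ss _ _ mone F01 mf4 G0.
  rewrite -/I4 I4E mulr1 EFinM; apply: le_trans.
  rewrite le_eqVlt; apply/orP; left; apply/eqP; apply: eq_integral => z _.
  by rewrite mul1e -l2norm_rV_sqr -exprM.
move: Df2; rewrite -integral_gaussP// => Df2.
have [C [s0 [C0 s00 hC]]] := smooth_increment_bound v0 mf mDf gDf a0 Df2.
exists C => //; apply: filterS (near0_le s00) => s ss; exact: hC.
Qed.

(** Controls the jump of a 1_{h > 0} between y and y + s w: if h has the Lipschitz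
    constant L, its sign can only change when |h y| <= L s |w|. *)
Definition slab_term a (h : 'rV[R]_n -> R) (L s : R) (z : rV2) : R :=
  sqn z.2 * (sqn (a z.1) * (`|h z.1| <= L * s * l2norm z.2)%R%:R).

Lemma slab_term_ge0 a h L s z : 0 <= slab_term a h L s z.
Proof.
by apply: mulr_ge0; [exact: sqn_ge0|apply: mulr_ge0; [exact: sqn_ge0|]].
Qed.

Lemma measurable_slab_term a h L s : measurable_fun setT a ->
  measurable_fun setT h -> measurable_fun setT (slab_term a h L s).
Proof.
move=> ma mh; apply: measurable_funM.
  by apply: measurable_sqn; exact: measurable_snd.
apply: measurable_funM.
  by apply: measurable_sqn; exact: (measurableT_comp ma measurable_fst).
apply: measurable_bool_natr; apply: measurable_fun_ler.
  apply: measurableT_comp => //; exact: (measurableT_comp mh measurable_fst).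
by apply: measurable_funM => //; apply: measurable_l2norm; exact: measurable_snd.
Qed.

(** For fixed w the slab has half-width L s |w|, hence a mass O(s |w|), and the
    third moment of |w| is finite. *)
Lemma slab_term_bigO d (T : measurableType d) (P : probability T R)
    (Y : T -> 'rV[R]_n) a h L : measurable_fun setT Y ->
  (forall B, measurable B -> P (Y @^-1` B) = gaussP mu (sigma ^+ 2) B) ->
  measurable_fun setT a -> measurable_fun setT h -> 0 <= L ->
  bounded_near_zero P Y a h ->
  gauss_bigO mu (sigma ^+ 2) (slab_term a h L) id.
Proof.
move=> mY lawY ma mh L0 bnz.
have [C0 C00 hC0] := slab_mass_le mY mh bnz.
have [W W0 hW] := @gauss_weight_integral R n _ v0.
exists (C0 * L * W); first by rewrite mulr_ge0 ?mulr_ge0// ltW.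
apply: filterS near0_gt0 => s s0.
have CLs : 0 <= C0 * L * s by rewrite mulr_ge0 ?mulr_ge0// ltW.
have mJ := measurable_slab_term L s ma mh.
have mJE : measurable_fun setT (fun z => (slab_term a h L s z)%:E).
  exact/measurable_EFinP.
have J0 z : (0 <= (slab_term a h L s z)%:E)%E by rewrite lee_fin slab_term_ge0.
rewrite integral_gauss_pair//.
apply: (@le_trans _ _ (\int[gaussP 0 (sigma ^+ 2)]_w
   ((C0 * L * s)%:E * (gauss_weight (sigma ^+ 2) w)%:E))%E).
  apply: ge0_le_integral.
  - exact: measurableT.
  - by move=> w _; apply: integral_ge0 => y _; exact: J0.
  - exact: (measurable_integral_gauss_pair _ _ mJE J0).
  - by apply: measurable_funeM; apply/measurable_EFinP; exact: measurable_gauss_weight.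
  move=> w _; set r := L * s * l2norm w.
  have r0 : 0 <= r by rewrite mulr_ge0 ?l2norm_ge0// mulr_ge0// ltW.
  have mS : measurable_fun setT (fun y : 'rV[R]_n => (sqn (a y) * \1_(`[- r, r]%classic) (h y))%:E).
    apply/measurable_EFinP; apply: measurable_funM; first exact: measurable_sqn.
    apply: (measurableT_comp _ mh); apply: measurable_indic; exact: measurable_itv.
  have S0 (y : 'rV[R]_n) : (0 <= (sqn (a y) * \1_(`[- r, r]%classic) (h y))%:E)%E.
    by rewrite lee_fin mulr_ge0 ?sqn_ge0// indicE.
  rewrite (eq_integral (fun y : 'rV[R]_n => (sqn w)%:E *
    (sqn (a y) * \1_(`[- r, r]%classic) (h y))%:E)%E); last first.
    move=> y _; rewrite -EFinM /slab_term/= -/r indicE mem_setE/= in_itv/=.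
    by rewrite ler_norml.
  rewrite ge0_integralZl ?lee_fin ?sqn_ge0//.
  have -> : (\int[gaussP mu (sigma ^+ 2)]_y (sqn (a y) * \1_(`[- r, r]%classic) (h y))%:E
     = \int[P]_t (sqn (a (Y t)) * \1_(`[- r, r]%classic) (h (Y t)))%:E)%E.
    rewrite [RHS](ge0_integral_comp mY P mS S0).
    by apply: eq_measure_integral => B mB _; apply/esym/lawY.
  apply: (le_trans (lee_wpmul2l _ (hC0 r r0))); first by rewrite lee_fin sqn_ge0.
  rewrite -!EFinM lee_fin /r /gauss_weight.
  rewrite (_ : sqn w * (C0 * (L * s * l2norm w)) = C0 * L * s * (sqn w * l2norm w)); last by ring.
  apply: ler_wpM2l => //.
  have e1 : 1 <= expR (gauss_rate n (sigma ^+ 2) * sqn w).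
    rewrite -[leLHS]expR0 ler_expR; apply: mulr_ge0; last exact: sqn_ge0.
    exact: ltW (gauss_rate_gt0 n v0).
  apply: (@le_trans _ _ ((1 + sqn w) ^+ 2)); last by rewrite ler_peMr// sqr_ge0.
  have := sqr_ge0 (l2norm w - 1); have := l2norm_rV_sqr w.
  have := l2norm_ge0 w; have := sqn_ge0 w; nra.
rewrite ge0_integralZl; last 4 first.
  exact: measurableT.
  by apply/measurable_EFinP; exact: measurable_gauss_weight.
  by move=> w _; rewrite lee_fin gauss_weight_ge0.
  by rewrite lee_fin.
rewrite (_ : C0 * L * W * s = C0 * L * s * W); last by ring.
by rewrite [X in (_ <= X)%E]EFinM; apply: lee_wpmul2l => //; rewrite lee_fin.
Qed.

End piecewise.

(** * Piecewise smooth maps *)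

Section piecewise_estimates.
Context {R : realType} (n m : nat) (mu : 'rV[R]_n) (sigma : R).
Hypothesis sigma_gt0 : 0 < sigma.
Context d (T : measurableType d) (P : probability T R) (Y : T -> 'rV[R]_n).
Hypothesis mY : measurable_fun setT Y.
Hypothesis lawY :
  forall B, measurable B -> P (Y @^-1` B) = gaussP mu (sigma ^+ 2) B.
Variables (f0 : 'rV[R]_n -> 'rV[R]_n) (a : 'I_m -> 'rV[R]_n -> 'rV[R]_n).
Variable h : 'I_m -> 'rV[R]_n -> R.
Hypothesis smooth : piecewise_smooth P Y mu sigma f0 a h.
Variable g : 'rV[R]_n -> 'rV[R]_n.
Hypothesis gE : forall y, g y = f0 y + \sum_l (0 < h l y)%R%:R *: a l y.
Notation rV2 := ('rV[R]_n * 'rV[R]_n)%type.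
Local Notation gO := (gauss_bigO mu (sigma ^+ 2)).

Let v0 : 0 < sigma ^+ 2. Proof. exact: exprn_gt0. Qed.

Let mf0 : measurable_fun setT f0. Proof. by case: smooth => -[]. Qed.
Let ma l : measurable_fun setT (a l). Proof. by case: smooth => _ /(_ l)[]. Qed.
Let mh l : measurable_fun setT (h l).
Proof. by case: smooth => _ _ /(_ l)[L hL] _; exact: measurable_lipschitz hL. Qed.

Lemma measurable_piecewise : measurable_fun setT g.
Proof.
rewrite (_ : g = fun y => f0 y + \sum_l (0 < h l y)%R%:R *: a l y); last exact/funext.
apply: measurable_rVD => //; apply: measurable_rV_sum => l.
apply: measurable_rVZ => //; apply: measurable_bool_natr.
by apply: measurable_fun_ltr => //; exact: measurable_cst.
Qed.

Let mg := measurable_piecewise.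

Let sqn_scale_bool (b : bool) (x : 'rV[R]_n) : sqn (b%:R *: x) <= sqn x.
Proof. by case: b; rewrite ?scale1r// sqnZ expr0n mul0r sqn_ge0. Qed.

Let sqr_add3 (x y z k : R) : 0 <= x -> 0 <= y -> 0 <= z -> 0 <= k ->
  (2 * x + 4 * y + 4 * k * z) ^+ 2 <= 12 * x ^+ 2 + 48 * y ^+ 2 + 48 * k ^+ 2 * z ^+ 2.
Proof.
move=> *; have := sqr_ge0 (2 * x - 4 * y); have := sqr_ge0 (2 * x - 4 * k * z).
have := sqr_ge0 (4 * y - 4 * k * z); nra.
Qed.

(** Reduces the fourth moments of g to those of f0, of the a l and of y. *)
Lemma piecewise_sub_sqr_le y y' :
  sqn (g y' - y) ^+ 2 <= 48 * (1 + m%:R) ^+ 3 *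
    (sqn (f0 y') ^+ 2 + \sum_l sqn (a l y') ^+ 2 + sqn y ^+ 2).
Proof.
(* 48 = 3 * 4^2 from the square of a sum of three terms with coefficients at
   most 4; the cube of m from (m S)^2 and from S^2 <= m * \sum_l _ ^2 *)
set S := \sum_l sqn (a l y').
have S0 : 0 <= S by apply: sumr_ge0 => l _; exact: sqn_ge0.
have h1 : sqn (g y' - y) <= 2 * sqn y + 4 * sqn (f0 y') + 4 * m%:R * S.
  apply: (le_trans (sqnD_le _ _)); rewrite sqnN gE.
  have := sqnD_le (f0 y') (\sum_l (0 < h l y')%R%:R *: a l y').
  have : sqn (\sum_l (0 < h l y')%R%:R *: a l y') <= m%:R * S.
    apply: (le_trans (sqn_sum_le _)); apply: ler_wpM2l => //.
    by apply: ler_sum => l _; exact: sqn_scale_bool.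
  by lra.
have h2 : sqn (g y' - y) ^+ 2 <= (2 * sqn y + 4 * sqn (f0 y') + 4 * m%:R * S) ^+ 2.
  rewrite lerXn2r ?nnegrE ?sqn_ge0//.
  by rewrite addr_ge0 ?mulr_ge0 ?addr_ge0 ?mulr_ge0 ?sqn_ge0.
apply: (le_trans h2).
apply: (le_trans (sqr_add3 (sqn_ge0 _) (sqn_ge0 _) S0 (ler0n _ m))).
have hS : S ^+ 2 <= m%:R * \sum_l sqn (a l y') ^+ 2 by exact: sum_sqr_le.
set S2 := \sum_l _ in hS *.
have S20 : 0 <= S2 by apply: sumr_ge0 => l _; exact: sqr_ge0.
have m0 : 0 <= m%:R :> R by [].
set k := m%:R in hS m0 *.
have hS' : k ^+ 2 * S ^+ 2 <= k ^+ 3 * S2.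
  have -> : k ^+ 3 * S2 = k ^+ 2 * (k * S2) by ring.
  by rewrite ler_wpM2l// sqr_ge0.
have k3 : 1 + k ^+ 3 <= (1 + k) ^+ 3.
  have : 0 <= k ^+ 2 by exact: sqr_ge0.
  by rewrite !exprS expr0; nra.
have k30 : 0 <= k ^+ 3 by exact: exprn_ge0.
have := ler_wpM2r (sqr_ge0 (sqn (f0 y'))) k3; have := ler_wpM2r (sqr_ge0 (sqn y)) k3.
have := ler_wpM2r S20 k3.
have := mulr_ge0 k30 (sqr_ge0 (sqn (f0 y'))); have := mulr_ge0 k30 (sqr_ge0 (sqn y)).
have := sqr_ge0 (sqn y).
set A := sqn (f0 y') ^+ 2; set B := sqn y ^+ 2; rewrite -!mulrA; lra.
Qed.

Lemma piecewise_sub_bigO :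
  gO (fun s z => sqn (g (z.1 + s *: z.2) - z.1) ^+ 2) (fun=> 1).
Proof.
have [sf0 sa _ _] := smooth.
have [b0 _] := smooth_moment_bigO sigma_gt0 sf0.
have ba l : gO (fun s z => sqn (a l (z.1 + s *: z.2)) ^+ 2) (fun=> 1).
  by have [] := smooth_moment_bigO sigma_gt0 (sa l).
have m4 (f : 'rV[R]_n -> 'rV[R]_n) : measurable_fun setT f -> forall s,
    measurable_fun setT (fun z : rV2 => sqn (f (z.1 + s *: z.2)) ^+ 2).
  by move=> mf s; apply: measurable_funX; exact: measurable_sqn_perturb.
have my4 : measurable_fun setT (fun z : rV2 => sqn z.1 ^+ 2).
  by apply: measurable_funX; apply: measurable_sqn; exact: measurable_fst.
have by4 : gO (fun s z => sqn z.1 ^+ 2) (fun=> 1).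
  have [C C0 hC] := gaussP_moment4 mu v0.
  exists C => //; near=> s; rewrite mulr1 integral_gauss_pair/=; last 2 first.
    exact/measurable_EFinP.
    by move=> z; rewrite lee_fin sqr_ge0.
  rewrite integral_cst; last exact: measurableT.
  by rewrite [X in (_ * X <= _)%E](_ : _ = 1%E) ?mule1//; exact: probability_setT.
apply: (@gauss_bigO_le _ _ _ _ (48 * (1 + m%:R) ^+ 3) _
  (fun s z => sqn (f0 (z.1 + s *: z.2)) ^+ 2 +
     \sum_l sqn (a l (z.1 + s *: z.2)) ^+ 2 + sqn z.1 ^+ 2)).
- by rewrite mulr_ge0// exprn_ge0// addr_ge0.
- move=> s; apply: measurable_funX; apply: measurable_sqn; apply: measurable_rVB.
    exact: (measurableT_comp mg (measurable_perturb s)).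
  exact: measurable_fst.
- move=> s; apply: measurable_funD => //; apply: measurable_funD; first exact: m4.
  by apply: measurable_sum => l; exact: m4.
- by near=> s => z; rewrite sqr_ge0 piecewise_sub_sqr_le.
- move=> s z; apply: addr_ge0; last exact: sqr_ge0.
  by apply: addr_ge0; [exact: sqr_ge0|apply: sumr_ge0 => l _; exact: sqr_ge0].
apply: gauss_bigO_add => //.
- move=> s; apply: measurable_funD; first exact: m4.
  by apply: measurable_sum => l; exact: m4.
- by move=> s z; apply: addr_ge0; [exact: sqr_ge0|apply: sumr_ge0 => l _; exact: sqr_ge0].
- by move=> s z; exact: sqr_ge0.
apply: gauss_bigO_add => //.
- exact: m4.
- by move=> s; apply: measurable_sum => l; exact: m4.
- by move=> s z; exact: sqr_ge0.
- by move=> s z; apply: sumr_ge0 => l _; exact: sqr_ge0.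
apply: gauss_bigO_sum => //.
- by move=> l s; exact: m4.
- by move=> l s z; exact: sqr_ge0.
Unshelve. all: by end_near. Qed.

(** Each product 1_{h > 0} a changes by 1_{h y' > 0} (a y' - a y), which is smooth,
    and by a y times the change of the indicator, which is supported by the
    slab. *)
Lemma piecewise_increment_le L s (z : rV2) : 0 <= s ->
  (forall l, 0 <= L l) -> (forall l, has_lipschitz_constant (h l) (L l)) ->
  dotv z.2 (g (z.1 + s *: z.2) - g z.1) ^+ 2 <= (2 + 4 * m%:R) *
    (sqn z.2 * sqn (f0 (z.1 + s *: z.2) - f0 z.1) +
     \sum_l (sqn z.2 * sqn (a l (z.1 + s *: z.2) - a l z.1) +
             slab_term (a l) (h l) (L l) s z)).
Proof.
move=> s0 L0 hL; case: z => y w /=; set y' := y + s *: w.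
pose u l := (0 < h l y')%R%:R *: (a l y' - a l y) +
  ((0 < h l y')%R%:R - (0 < h l y)%R%:R) *: a l y.
have gu : g y' - g y = (f0 y' - f0 y) + \sum_l u l.
  rewrite !gE opprD addrACA; congr (_ + _); rewrite -sumrB; apply: eq_bigr => l _.
  by rewrite /u scalerBr scalerBl addrA subrK.
apply: (le_trans (cauchy_schwarz _ _)).
have su l : sqn w * sqn (u l) <= 2 * (sqn w * sqn (a l y' - a l y) +
    slab_term (a l) (h l) (L l) s (y, w)).
  rewrite /slab_term/= -mulrDr mulrCA ler_wpM2l ?sqn_ge0//.
  apply: (le_trans (sqnD_le _ _)); rewrite -mulrDr ler_wpM2l//.
  apply: lerD; first exact: sqn_scale_bool.
  rewrite sqnZ mulrC; apply: ler_wpM2l; first exact: sqn_ge0.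
  have lip : `|h l y' - h l y| <= L l * s * l2norm w.
    apply: (le_trans (hL l y' y)); rewrite -mulrA; apply: ler_wpM2l => //.
    rewrite /y' addrAC subrr add0r -(ler_pXn2r (n:=2)) ?nnegrE ?mulr_ge0 ?l2norm_ge0//.
    by rewrite exprMn !l2norm_rV_sqr sqnZ.
  have [h1|h1] := ltP 0 (h l y'); have [h2|h2] := ltP 0 (h l y).
  - by rewrite subrr expr0n.
  - rewrite subr0 expr1n ler1n lt0b; apply: le_trans lip.
    by rewrite ler0_norm// ger0_norm; lra.
  - rewrite sub0r sqrrN expr1n ler1n lt0b; apply: le_trans lip.
    by rewrite (ger0_norm (ltW h2)) ler0_norm; lra.
  - by rewrite subrr expr0n.
rewrite gu; apply: (le_trans (ler_wpM2l (sqn_ge0 _) (sqnD_le _ _))).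
have hs : sqn w * sqn (\sum_l u l) <= m%:R * \sum_l sqn w * sqn (u l).
  by rewrite -mulr_sumr mulrCA ler_wpM2l ?sqn_ge0 ?sqn_sum_le.
set S := \sum_l (sqn w * sqn (a l y' - a l y) + _).
have hs2 : \sum_l sqn w * sqn (u l) <= 2 * S.
  by rewrite mulr_sumr; apply: ler_sum => l _; exact: su.
have S0 : 0 <= S.
  apply: sumr_ge0 => l _; apply: addr_ge0; last exact: slab_term_ge0.
  by rewrite mulr_ge0 ?sqn_ge0.
have m0 : 0 <= m%:R :> R by [].
have hs3 := le_trans hs (ler_wpM2l m0 hs2).
have F0 : 0 <= sqn w * sqn (f0 y' - f0 y) by rewrite mulr_ge0 ?sqn_ge0.
have := mulr_ge0 m0 F0; rewrite mulrDr !(mulrCA _ 2).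
rewrite mulrA in hs3; lra.
Qed.

(** The smooth increments are O(s^2); the slabs only give O(s). *)
Lemma piecewise_increment_bigO :
  gO (fun s z => dotv z.2 (g (z.1 + s *: z.2) - g z.1) ^+ 2) id.
Proof.
have [sf0 sa hlip bnz] := smooth.
have /choice[L hL] : forall l, exists L, 0 <= L /\ has_lipschitz_constant (h l) L.
  move=> l; have [L hL] := hlip l; exists `|L|; split => // y z.
  apply: (le_trans (hL y z)); rewrite ler_wpM2r ?l2norm_ge0//; exact: ler_norm.
have sq_le : \forall s \near (0 : R)^'+, s ^+ 2 <= s.
  by apply: filterS (near0_le ltr01) => s; nra.
have bf f : smooth_moment mu sigma f ->
    gO (fun s z => sqn z.2 * sqn (f (z.1 + s *: z.2) - f z.1)) id.
  move=> sf; have [_] := smooth_moment_bigO sigma_gt0 sf.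
  exact: gauss_bigO_weaken.
have bs l : gO (slab_term (a l) (h l) (L l)) id.
  by apply: slab_term_bigO => //; have [] := hL l.
have mi (f : 'rV[R]_n -> 'rV[R]_n) : measurable_fun setT f -> forall s, measurable_fun setT
    (fun z : rV2 => sqn z.2 * sqn (f (z.1 + s *: z.2) - f z.1)).
  by move=> mf s; exact: measurable_sqn_increment.
have i0 (f : 'rV[R]_n -> 'rV[R]_n) s (z : rV2) : 0 <= sqn z.2 * sqn (f (z.1 + s *: z.2) - f z.1).
  by rewrite mulr_ge0 ?sqn_ge0.
have ms l s : measurable_fun setT (slab_term (a l) (h l) (L l) s).
  exact: measurable_slab_term.
have mis l s : measurable_fun setT (fun z : rV2 =>
    sqn z.2 * sqn (a l (z.1 + s *: z.2) - a l z.1) + slab_term (a l) (h l) (L l) s z).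
  by apply: measurable_funD => //; exact: mi.
have is0 l s (z : rV2) : 0 <= sqn z.2 * sqn (a l (z.1 + s *: z.2) - a l z.1) +
    slab_term (a l) (h l) (L l) s z.
  by rewrite addr_ge0 ?slab_term_ge0.
apply: (@gauss_bigO_le _ _ _ _ (2 + 4 * m%:R) _
  (fun s z => sqn z.2 * sqn (f0 (z.1 + s *: z.2) - f0 z.1) +
     \sum_l (sqn z.2 * sqn (a l (z.1 + s *: z.2) - a l z.1) +
             slab_term (a l) (h l) (L l) s z))).
- by rewrite addr_ge0// mulr_ge0.
- move=> s; apply: measurable_funX; apply: measurable_dotv; first exact: measurable_snd.
  exact: measurable_increment.
- move=> s; apply: measurable_funD; first exact: mi.
  by apply: measurable_sum => l; exact: mis.
- apply: filterS near0_gt0 => s s0 z; rewrite sqr_ge0/=.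
  by apply: piecewise_increment_le => [|l|l]; [exact: ltW|by have [] := hL l|by have [] := hL l].
- by move=> s z; apply: addr_ge0 => //; apply: sumr_ge0 => l _; exact: is0.
apply: gauss_bigO_add.
- exact: mi.
- by move=> s; apply: measurable_sum => l; exact: mis.
- by move=> s z; exact: i0.
- by move=> s z; apply: sumr_ge0 => l _; exact: is0.
- exact: bf.
apply: gauss_bigO_sum; [exact: mis|exact: is0|] => l.
apply: gauss_bigO_add; [exact: mi|exact: ms|by move=> *; exact: i0| |exact: bf|exact: bs].
by move=> *; exact: slab_term_ge0.
Qed.

(** What is left of one fold of the estimator once its Gaussian linear term
    (2 / s) <w, g y - y> is removed; here s is the square root of alpha. *)
Definition fold_residual (s : R) (z : rV2) : R :=
  sqn (g (z.1 + s *: z.2) - z.1) +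
  2 / s * dotv z.2 (g (z.1 + s *: z.2) - g z.1).

Lemma measurable_fold_residual s : measurable_fun setT (fold_residual s).
Proof.
apply: measurable_funD.
  apply: measurable_sqn; apply: measurable_rVB.
    exact: (measurableT_comp mg (measurable_perturb s)).
  exact: measurable_fst.
apply: measurable_funM => //; apply: measurable_dotv; first exact: measurable_snd.
exact: measurable_increment.
Qed.

(** The first term of the residual has a bounded second moment, and the one of
    the second term is (4 / s^2) O(s). *)
Lemma fold_residual_bigO :
  gO (fun s z => fold_residual s z ^+ 2) (fun s => s^-1).
Proof.
have msub s : measurable_fun setT (fun z : rV2 => sqn (g (z.1 + s *: z.2) - z.1) ^+ 2).
  apply: measurable_funX; apply: measurable_sqn; apply: measurable_rVB.
    exact: (measurableT_comp mg (measurable_perturb s)).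
  exact: measurable_fst.
have minc s : measurable_fun setT (fun z : rV2 => dotv z.2 (g (z.1 + s *: z.2) - g z.1) ^+ 2).
  apply: measurable_funX; apply: measurable_dotv; first exact: measurable_snd.
  exact: measurable_increment.
have c0 s : 0 <= 4 * s ^- 2 :> R by rewrite mulr_ge0// invr_ge0 sqr_ge0.
apply: (@gauss_bigO_le _ _ _ _ 2 _
  (fun s z => sqn (g (z.1 + s *: z.2) - z.1) ^+ 2 +
     (4 * s ^- 2) * dotv z.2 (g (z.1 + s *: z.2) - g z.1) ^+ 2)) => //.
- by move=> s; apply: measurable_funX; exact: measurable_fold_residual.
- by move=> s; apply: measurable_funD => //; exact: measurable_funM.
- near=> s => z; rewrite sqr_ge0/= /fold_residual.
  set x := sqn _; set y := dotv _ _.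
  rewrite -exprVn (_ : 4 * s^-1 ^+ 2 * y ^+ 2 = (2 / s * y) ^+ 2); last by ring.
  by have := sqr_ge0 (x - 2 / s * y); nra.
- move=> s z; apply: addr_ge0; first exact: sqr_ge0.
  by apply: mulr_ge0 => //; exact: sqr_ge0.
apply: gauss_bigO_add.
- exact: msub.
- by move=> s; exact: measurable_funM.
- by move=> s z; exact: sqr_ge0.
- by move=> s z; apply: mulr_ge0 => //; exact: sqr_ge0.
- apply: gauss_bigO_weaken piecewise_sub_bigO.
  apply: filterS (near0_le ltr01) => s /andP[s0 s1].
  by rewrite invf_ge1.
have [C C0 hC] : gO (fun s z => 4 * s ^- 2 * dotv z.2 (g (z.1 + s *: z.2) - g z.1) ^+ 2)
    (fun s => 4 * s ^- 2 * s).
  apply: gauss_bigO_scale => //; first by move=> s z; exact: sqr_ge0.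
    by near=> s.
  exact: piecewise_increment_bigO.
exists (C * 4); first exact: mulr_ge0.
apply: filterS2 hC near0_gt0 => s hs s0; apply: (le_trans hs).
rewrite lee_fin le_eqVlt; apply/orP; left; apply/eqP.
by field; rewrite gt_eqF.
Unshelve. all: by end_near. Qed.

(** The zero shift in gaussP_shift_le: N(mu, v) is dominated by N(mu, (1 + b) v). *)
Lemma smooth_moment4_fin f : smooth_moment mu sigma f ->
  (\int[gaussP mu (sigma ^+ 2)]_y (sqn (f y) ^+ 2)%:E < +oo)%E.
Proof.
move=> [mf [Df [_ _ [b b0 [f4 _]]]]].
have {}f4 : (\int[gaussP mu ((1 + b) * sigma ^+ 2)]_y (l2norm (f y) ^+ 4)%:E < +oo)%E.
  by rewrite (integral_gaussP _ _ _ measurableT).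
pose G y := (l2norm (f y) ^+ 4)%:E.
have mG : measurable_fun setT G.
  by apply/measurable_EFinP; apply: measurable_funX; exact: measurable_l2norm.
have G0 y : (0 <= G y)%E by rewrite lee_fin exprn_ge0// l2norm_ge0.
apply: (@le_lt_trans _ _ ((Num.sqrt (1 + b) ^+ n *
    expR (sqn (0 : 'rV[R]_n) / (b * sigma ^+ 2 *+ 2)))%:E *
    \int[gaussP mu ((1 + b) * sigma ^+ 2)]_y G y)%E).
  apply: (le_trans _ (gaussP_shift_le mu 0 v0 b0 mG G0)).
  rewrite le_eqVlt; apply/orP; left; apply/eqP; apply: eq_integral => y _.
  by rewrite addr0 /G (exprM _ 2 2) l2norm_rV_sqr.
apply: lte_mul_pinfty; last exact: f4.
  by rewrite lee_fin mulr_ge0 ?expR_ge0// exprn_ge0 ?sqrtr_ge0.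
by [].
Qed.

Lemma piecewise_sub_fin :
  (\int[gaussP mu (sigma ^+ 2)]_y (sqn (g y - y))%:E < +oo)%E.
Proof.
have [sf0 sa _ _] := smooth.
pose k : R := 48 * (1 + m%:R) ^+ 3.
have k0 : 0 <= k by rewrite mulr_ge0// exprn_ge0// addr_ge0.
have m4 (f : 'rV[R]_n -> 'rV[R]_n) : measurable_fun setT f ->
    measurable_fun setT (fun y => (sqn (f y) ^+ 2)%:E).
  move=> mf; apply/measurable_EFinP; apply: measurable_funX; exact: measurable_sqn.
have sq0 (x : R) : (0 <= (x ^+ 2)%:E)%E by rewrite lee_fin sqr_ge0.
have mS : measurable_fun setT (fun y => \sum_l (sqn (a l y) ^+ 2)%:E)%E.
  by apply: emeasurable_sum => l; exact: m4.
have m3 : measurable_fun setT (fun y => (sqn (f0 y) ^+ 2)%:E +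
    \sum_l (sqn (a l y) ^+ 2)%:E + (sqn y ^+ 2)%:E)%E.
  apply: emeasurable_funD; last by apply: m4; exact: measurable_id.
  by apply: emeasurable_funD => //; exact: m4.
have S0 y : (0 <= \sum_l (sqn (a l y) ^+ 2)%:E)%E by apply: sume_ge0.
have p3 y : (0 <= (sqn (f0 y) ^+ 2)%:E +
    \sum_l (sqn (a l y) ^+ 2)%:E + (sqn y ^+ 2)%:E)%E.
  by rewrite !adde_ge0.
apply: (@le_lt_trans _ _ (\int[gaussP mu (sigma ^+ 2)]_y
  (1 + k%:E * ((sqn (f0 y) ^+ 2)%:E + \sum_l (sqn (a l y) ^+ 2)%:E + (sqn y ^+ 2)%:E)))%E).
  apply: ge0_le_integral => //.
  - by move=> y _; rewrite lee_fin sqn_ge0.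
  - apply/measurable_EFinP; apply: measurable_sqn; apply: measurable_rVB.
      exact: mg.
    exact: measurable_id.
  - apply: emeasurable_funD; first exact: measurable_cst.
    exact: measurable_funeM.
  move=> y _; rewrite sumEFin -!(EFinD, EFinM) lee_fin.
  apply: (@le_trans _ _ (1 + sqn (g y - y) ^+ 2)).
    by have := sqr_ge0 (sqn (g y - y) - 1); have := sqn_ge0 (g y - y); nra.
  by rewrite lerD2l; exact: piecewise_sub_sqr_le.
rewrite ge0_integralD//; last 2 first.
  by move=> y _; rewrite mule_ge0// lee_fin.
  exact: measurable_funeM.
rewrite ge0_integralZl// ?lee_fin//.
rewrite integral_cst// mul1e.
rewrite [X in (X + _ < _)%E](_ : _ = 1%E); last exact: probability_setT.
apply: lte_add_pinfty; first exact: ltry.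
apply: lte_mul_pinfty => //.
rewrite ge0_integralD//; last 3 first.
- by move=> y _; rewrite adde_ge0.
- by apply: emeasurable_funD => //; exact: m4.
- by apply: m4; exact: measurable_id.
apply: lte_add_pinfty; last first.
  by have [C C0 hC] := gaussP_moment4 mu v0; apply: le_lt_trans hC (ltry _).
rewrite ge0_integralD//; last exact: m4.
apply: lte_add_pinfty; first exact: smooth_moment4_fin.
rewrite ge0_integral_sum//; last by move=> l; exact: m4.
by apply: lte_sum_pinfty => l _; exact: smooth_moment4_fin.
Qed.

End piecewise_estimates.

(** * Conditional expectation by freezing *)

Section freezing.
Context {R : realType} d dV dU (T : measurableType d) (V : measurableType dV)
  (U : measurableType dU) (P : probability T R).
Variables (Y : {mfun T >-> V}) (X : {mfun T >-> U}).
Hypothesis indep : forall A B, measurable A -> measurable B ->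
  (P ((Y @^-1` A) `&` (X @^-1` B)) = P (Y @^-1` A) * P (X @^-1` B))%E.
Notation PY := (distribution P Y).
Notation PX := (distribution P X).

Let mY : measurable_fun setT Y. Proof. exact: measurable_funP. Qed.
Let mX : measurable_fun setT X. Proof. exact: measurable_funP. Qed.

Let YX t := (Y t, X t).

Let mYX : measurable_fun setT YX.
Proof. exact: measurable_fun_pair. Qed.

Lemma joint_law A : measurable A ->
  (PY \x PX)%E A = pushforward_measure P mYX A.
Proof.
apply: (product_measure_unique (m' := pushforward_measure P mYX)) => B C mB mC.
exact: indep.
Qed.

Lemma ge0_integral_indep (f : V * U -> \bar R) : measurable_fun setT f ->
  (forall z, 0 <= f z)%E ->
  (\int[P]_t f (Y t, X t) = \int[PY]_y \int[PX]_u f (y, u))%E.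
Proof.
move=> mf f0; rewrite (ge0_integral_comp mYX P mf f0) -(fubini_tonelli1 f mf f0).
by apply: eq_measure_integral => A mA _; exact/esym/joint_law.
Qed.

Variable Psi : V * U -> R.
Hypothesis mPsi : measurable_fun setT Psi.

(** The value 0 is taken where the integral is not finite, which happens for a
    negligible set of y when Psi is integrable. *)
Definition frozen_mean (y : V) : R := fine (\int[PX]_u (Psi (y, u))%:E)%E.

Let mPsiE : measurable_fun setT (EFin \o Psi). Proof. exact/measurable_EFinP. Qed.

Lemma integrable_joint :
  (\int[P]_t `|Psi (Y t, X t)|%:E < +oo)%E ->
  (PY \x PX)%E.-integrable setT (EFin \o Psi).
Proof.
move=> Poo; apply/integrableP; split => //.
rewrite (_ : (\int[(PY \x PX)%E]_z `|(EFin \o Psi) z|)%E =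
  (\int[P]_t `|Psi (Y t, X t)|%:E)%E)//.
have mn : measurable_fun setT (fun z => `|Psi z|%:E).
  by apply/measurable_EFinP; exact: measurableT_comp.
rewrite (ge0_integral_comp mYX P mn); last by move=> z; rewrite lee_fin.
by apply: eq_measure_integral => A mA _; exact: joint_law.
Qed.

(** Freezing: given Y = y, the variable X keeps its law, so that integrating X
    out of Psi (y, X) is a version of the conditional expectation. *)
Lemma is_cond_expectation_frozen :
  (\int[P]_t `|Psi (Y t, X t)|%:E < +oo)%E ->
  is_cond_expectation P Y (fun t => Psi (Y t, X t)) frozen_mean.
Proof.
move=> Poo; have iPsi := integrable_joint Poo.
have mF := measurable_fubini_F iPsi.
have iF := integrable_fubini_F iPsi.
have mm : measurable_fun setT frozen_mean.
  by apply: (measurableT_comp _ mF); exact: fine_measurable.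
have mmE : measurable_fun setT (fun y => (frozen_mean y)%:E) by exact/measurable_EFinP.
have im : PY.-integrable setT (fun y => (frozen_mean y)%:E).
  apply: (le_integrable measurableT mmE _ iF) => y _.
  rewrite /frozen_mean /fubini_F/=.
  by case: (\int[PX]_u _)%E => //=; rewrite ?normr0 ?leey.
have imY : P.-integrable setT (EFin \o (frozen_mean \o Y)).
  apply/integrableP; split; first exact: (measurableT_comp mmE mY).
  have /integrableP[_] := im.
  have mn : measurable_fun setT (fun y => `|(frozen_mean y)%:E|)%E.
    exact: measurableT_comp.
  by rewrite (ge0_integral_comp mY P mn).
split => //.
  apply/integrableP; split; first exact: (measurableT_comp mPsiE mYX).
  exact: Poo.
move=> B mB.
have mYB : measurable (Y @^-1` B) by rewrite -[X in measurable X]setTI; exact: mY.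
have m1B : measurable_fun setT (\1_B : V -> R) by exact: measurable_indic.
have norm1B y : `|\1_B y : R| <= 1.
  by rewrite indicE; case: (_ \in _); rewrite ?normr1 ?normr0.
have iPsiB : (PY \x PX)%E.-integrable setT (fun z => (Psi z * \1_B z.1)%:E).
  apply: (le_integrable measurableT _ _ iPsi).
    apply/measurable_EFinP; apply: measurable_funM => //.
    exact: (measurableT_comp m1B measurable_fst).
  by move=> z _; rewrite /= lee_fin normrM ler_piMr.
have mPsiB : measurable_fun setT (fun z : V * U => (Psi z * \1_B z.1)%:E).
  exact: measurable_int iPsiB.
transitivity (\int[PY]_y (frozen_mean y * \1_B y)%:E)%E.
  rewrite [RHS](_ : _ = \int[PY]_(y in B) (frozen_mean y)%:E)%E; last first.
    rewrite [RHS]integral_mkcond; apply: eq_integral => y _.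
    by rewrite epatch_indic.
  rewrite (integral_pushforward mY mmE)//.
  exact: integrableS imY.
transitivity (\int[(PY \x PX)%E]_z (Psi z * \1_B z.1)%:E)%E; last first.
  transitivity (\int[P]_t (Psi (Y t, X t) * \1_B (Y t))%:E)%E; last first.
    rewrite [RHS]integral_mkcond; apply: eq_integral => t _.
    by rewrite epatch_indic.
  rewrite (eq_measure_integral (pushforward_measure P mYX)); last first.
    by move=> A mA _; exact: joint_law.
  rewrite (integral_pushforward mYX mPsiB)//.
  rewrite preimage_setT.
  apply/integrableP; split; first exact: (measurableT_comp mPsiB mYX).
  apply: le_lt_trans Poo; apply: ge0_le_integral => //.
  - apply: (measurableT_comp (f := abse)) => //.
    exact: (measurableT_comp mPsiB mYX).
  - apply/measurable_EFinP; apply: measurableT_comp => //.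
    exact: (measurableT_comp mPsi mYX).
  - by move=> t _; rewrite /= lee_fin normrM ler_piMr.
rewrite -(integral12_prod_meas1 iPsiB).
apply: ae_eq_integral => //.
- by apply/measurable_EFinP; exact: measurable_funM.
- exact: measurable_fubini_F iPsiB.
apply: filterS (ae_integrable1 iPsi) => y iy _.
rewrite /fubini_F/=; under eq_integral do rewrite mulrC EFinM.
rewrite integralZl//= EFinM muleC /frozen_mean fineK//.
exact: integrable_fin_num iy.
Qed.

Lemma frozen_mean_sqr_le y :
  ((frozen_mean y ^+ 2)%:E <= \int[PX]_u (Psi (y, u) ^+ 2)%:E)%E.
Proof.
have I0 : (0 <= \int[PX]_u (Psi (y, u) ^+ 2)%:E)%E.
  by apply: integral_ge0 => u _; rewrite lee_fin sqr_ge0.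
rewrite /frozen_mean; case E : (\int[PX]_u (Psi (y, u))%:E)%E => [x||] /=;
  rewrite ?expr0n//.
apply: (@sqr_integral_le _ _ _ PX setT) => //; first exact: probability_setT.
exact: (measurableT_comp mPsi (measurable_pair1 y)).
Qed.

End freezing.

(** * Expected conditional variance *)

Section expected_cond_variance.
Context {R : realType} d dV dU (T : measurableType d) (V : measurableType dV)
  (U : measurableType dU) (P : probability T R).
Variables (Y : {mfun T >-> V}) (X : {mfun T >-> U}).
Hypothesis indep : forall A B, measurable A -> measurable B ->
  (P ((Y @^-1` A) `&` (X @^-1` B)) = P (Y @^-1` A) * P (X @^-1` B))%E.
Notation PY := (distribution P Y).
Notation PX := (distribution P X).
Variable Phi : V * U -> R.
Hypothesis mPhi : measurable_fun setT Phi.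
Hypothesis Phi2 : (\int[P]_t (Phi (Y t, X t) ^+ 2)%:E < +oo)%E.

Let mY : measurable_fun setT Y. Proof. exact: measurable_funP. Qed.
Let mX : measurable_fun setT X. Proof. exact: measurable_funP. Qed.
Let mYX : measurable_fun setT (fun t => (Y t, X t)).
Proof. exact: measurable_fun_pair. Qed.

Let m := frozen_mean P X Phi.
Let Dev (z : V * U) := (Phi z - m z.1) ^+ 2.

Definition expected_frozen_variance : R :=
  fine (\int[P]_t ((Phi (Y t, X t) - frozen_mean P X Phi (Y t)) ^+ 2)%:E)%E.

Let Phi1 : (\int[P]_t `|Phi (Y t, X t)|%:E < +oo)%E.
Proof.
apply: (@le_lt_trans _ _ (\int[P]_t (1 + (Phi (Y t, X t) ^+ 2)%:E))%E).
  apply: ge0_le_integral => //.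
  - apply/measurable_EFinP; apply: measurableT_comp => //.
    exact: (measurableT_comp mPhi mYX).
  - apply: emeasurable_funD; first exact: measurable_cst.
    by apply/measurable_EFinP; apply: measurable_funX; exact: (measurableT_comp mPhi mYX).
  move=> t _; rewrite -EFinD lee_fin -(real_normK (num_real (Phi _))).
  by have := sqr_ge0 (`|Phi (Y t, X t)| - 1); have := normr_ge0 (Phi (Y t, X t)); nra.
rewrite ge0_integralD//; last 2 first.
  by move=> t _; rewrite lee_fin sqr_ge0.
  by apply/measurable_EFinP; apply: measurable_funX; exact: (measurableT_comp mPhi mYX).
rewrite integral_cst// mul1e [X in (X + _ < _)%E](_ : _ = 1%E); last exact: probability_setT.
by apply: lte_add_pinfty => //; exact: ltry.
Qed.

Let cond_mean : is_cond_expectation P Y (fun t => Phi (Y t, X t)) m.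
Proof. exact: is_cond_expectation_frozen. Qed.

Let mm : measurable_fun setT m. Proof. by case: cond_mean. Qed.

Let mDev : measurable_fun setT Dev.
Proof.
apply: measurable_funX; apply: measurable_funB => //.
exact: (measurableT_comp mm measurable_fst).
Qed.

Let Dev0 z : 0 <= Dev z. Proof. exact: sqr_ge0. Qed.

Lemma frozen_mean_second_moment :
  (\int[P]_t (m (Y t) ^+ 2)%:E <= \int[P]_t (Phi (Y t, X t) ^+ 2)%:E)%E.
Proof.
have mm2 : measurable_fun setT (fun y => (m y ^+ 2)%:E).
  by apply/measurable_EFinP; exact: measurable_funX.
have mPhi2 : measurable_fun setT (fun z => (Phi z ^+ 2)%:E).
  by apply/measurable_EFinP; exact: measurable_funX.
have s0 (x : R) : (0 <= (x ^+ 2)%:E)%E by rewrite lee_fin sqr_ge0.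
rewrite (ge0_integral_comp mY P mm2)//.
rewrite (ge0_integral_indep indep mPhi2)//.
apply: ge0_le_integral => //.
- exact: (measurable_fun_fubini_tonelli_F _ mPhi2 (fun z => s0 _)).
- by move=> y _; exact: frozen_mean_sqr_le.
Qed.

(** From (x - m)^2 <= 2 x^2 + 2 m^2, the conditional mean m having a smaller second
    moment than Phi. *)
Lemma expected_frozen_variance_le :
  (\int[P]_t (Dev (Y t, X t))%:E <= 4%:E * \int[P]_t (Phi (Y t, X t) ^+ 2)%:E)%E.
Proof.
have mP : measurable_fun setT (fun t => (Phi (Y t, X t) ^+ 2)%:E).
  by apply/measurable_EFinP; apply: measurable_funX; exact: (measurableT_comp mPhi mYX).
have mM : measurable_fun setT (fun t => (m (Y t) ^+ 2)%:E).
  by apply/measurable_EFinP; apply: measurable_funX; exact: (measurableT_comp mm mY).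
have s0 (x : R) : (0 <= (x ^+ 2)%:E)%E by rewrite lee_fin sqr_ge0.
apply: (@le_trans _ _ (\int[P]_t (2%:E * ((Phi (Y t, X t) ^+ 2)%:E + (m (Y t) ^+ 2)%:E)))%E).
  apply: ge0_le_integral => //.
  - by move=> t _; rewrite lee_fin.
  - by apply/measurable_EFinP; exact: (measurableT_comp mDev mYX).
  - by apply: measurable_funeM; exact: emeasurable_funD.
  - move=> t _; rewrite -EFinD -EFinM lee_fin /Dev/=.
    by have := sqr_ge0 (Phi (Y t, X t) + m (Y t)); nra.
rewrite ge0_integralZl//; last 2 first.
  exact: emeasurable_funD.
  by move=> t _; rewrite adde_ge0.
rewrite ge0_integralD//.
apply: (@le_trans _ _ (2%:E * (\int[P]_t (Phi (Y t, X t) ^+ 2)%:E +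
    \int[P]_t (Phi (Y t, X t) ^+ 2)%:E)))%E.
  by apply: lee_wpmul2l => //; apply: leeD => //; exact: frozen_mean_second_moment.
have : (0 <= \int[P]_t (Phi (Y t, X t) ^+ 2)%:E)%E by exact: integral_ge0.
move: Phi2; case: (\int[P]_t (Phi (Y t, X t) ^+ 2)%:E)%E => [x||]//= _ _.
by rewrite -EFinD -!EFinM lee_fin; lra.
Qed.

Let Dev_fin : (\int[P]_t (Dev (Y t, X t))%:E < +oo)%E.
Proof. by apply: (le_lt_trans expected_frozen_variance_le); exact: lte_mul_pinfty. Qed.

Lemma expected_frozen_varianceE :
  (expected_frozen_variance%:E =
   \int[P]_t ((Phi (Y t, X t) - frozen_mean P X Phi (Y t)) ^+ 2)%:E)%E.
Proof.
rewrite /expected_frozen_variance fineK// ge0_fin_numE//.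
by apply: integral_ge0 => t _; rewrite lee_fin sqr_ge0.
Qed.

(** The mean of the conditional expectation of the squared deviation is the mean
    of the squared deviation. *)
Lemma is_expected_frozen_variance :
  is_expected_cond_variance P Y (fun t => Phi (Y t, X t)) expected_frozen_variance.
Proof.
have cv : is_cond_expectation P Y (fun t => Dev (Y t, X t)) (frozen_mean P X Dev).
  apply: is_cond_expectation_frozen => //.
  move: Dev_fin; congr (_ < _)%E; apply: eq_integral => t _.
  by rewrite ger0_norm.
exists (frozen_mean P X Dev); first by exists m.
have [_ _ _ /(_ setT measurableT)] := cv; rewrite preimage_setT => e.
by rewrite expected_frozen_varianceE unlock /= e.
Qed.

(** The second hypothesis holds when M (y, X) is centred for all y.  Used with q
    the conditional mean of Phi, it allows comparing M with the deviation of Phi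
    from this mean. *)
Lemma expected_frozen_variance_lower (M : V * U -> R) :
  measurable_fun setT M ->
  (forall y q, (\int[PX]_u (M (y, u) ^+ 2)%:E <=
                \int[PX]_u ((M (y, u) - q) ^+ 2)%:E)%E) ->
  (\int[P]_t (M (Y t, X t) ^+ 2)%:E <=
   2%:E * expected_frozen_variance%:E +
   2%:E * \int[P]_t ((Phi (Y t, X t) - M (Y t, X t)) ^+ 2)%:E)%E.
Proof.
move=> mM hM.
have s0 (x : R) : (0 <= (x ^+ 2)%:E)%E by rewrite lee_fin sqr_ge0.
have mM2 : measurable_fun setT (fun z => (M z ^+ 2)%:E).
  by apply/measurable_EFinP; exact: measurable_funX.
have mMm : measurable_fun setT (fun z => ((M z - m z.1) ^+ 2)%:E).
  apply/measurable_EFinP; apply: measurable_funX; apply: measurable_funB => //.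
  exact: (measurableT_comp mm measurable_fst).
have mPM : measurable_fun setT (fun t => ((Phi (Y t, X t) - M (Y t, X t)) ^+ 2)%:E).
  apply/measurable_EFinP; apply: measurable_funX; apply: measurable_funB.
    exact: (measurableT_comp mPhi mYX).
  exact: (measurableT_comp mM mYX).
have mDYX : measurable_fun setT (fun t => (Dev (Y t, X t))%:E).
  by apply/measurable_EFinP; exact: (measurableT_comp mDev mYX).
apply: (@le_trans _ _ (\int[P]_t ((M (Y t, X t) - m (Y t)) ^+ 2)%:E)%E).
  rewrite (ge0_integral_indep indep mM2)//.
  rewrite (ge0_integral_indep indep mMm)//.
  apply: ge0_le_integral => //.
  - by move=> y _; apply: integral_ge0.
  - exact: (measurable_fun_fubini_tonelli_F _ mM2 (fun z => s0 _)).
  - exact: (measurable_fun_fubini_tonelli_F _ mMm (fun z => s0 _)).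
  - by move=> y _; exact: (hM y (m y)).
apply: (@le_trans _ _ (\int[P]_t (2%:E * (Dev (Y t, X t))%:E +
    2%:E * ((Phi (Y t, X t) - M (Y t, X t)) ^+ 2)%:E))%E).
  apply: ge0_le_integral => //.
  - exact: (measurableT_comp mMm mYX).
  - by apply: emeasurable_funD; apply: measurable_funeM.
  - move=> t _; rewrite -!EFinM -EFinD lee_fin /Dev/=.
    have := sqr_ge0 (2 * Phi (Y t, X t) - m (Y t) - M (Y t, X t)); nra.
rewrite ge0_integralD//; last 4 first.
- by move=> t _; rewrite mule_ge0// lee_fin.
- exact: measurable_funeM.
- by move=> t _; rewrite mule_ge0// lee_fin sqr_ge0.
- exact: measurable_funeM.
rewrite !ge0_integralZl//; last by move=> t _; rewrite lee_fin.
by rewrite expected_frozen_varianceE.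
Qed.

End expected_cond_variance.

(** * Moments of the randomization *)

Section gaussP_odd.
Context {R : realType} (n : nat) (v : R).
Hypothesis v0 : 0 < v.
Notation N := (@gaussP R n 0 v).

(** The law is invariant under the sign change, so that the mean of f equals its
    opposite. *)
Lemma gaussP_odd (e : 'I_n -> bool) (f : 'rV[R]_n -> R) :
  measurable_fun setT f -> N.-integrable setT (EFin \o f) ->
  (forall x, f (map_rV (fun i t => (-1) ^+ e i * t) x) = - f x) ->
  (\int[N]_x (f x)%:E = 0)%E.
Proof.
move=> mf fi fodd; set T := map_rV _ in fodd.
have mT : measurable_fun setT T.
  by apply: measurable_map_rV => i; exact: measurable_scaler.
have mfE : measurable_fun setT (EFin \o f) by exact/measurable_EFinP.
have iT : N.-integrable (T @^-1` setT) ((EFin \o f) \o T).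
  rewrite preimage_setT (_ : (EFin \o f) \o T = \- (EFin \o f))%E.
    exact: integrableN.
  by apply/funext => x /=; rewrite fodd.
have eN : (\int[N]_x (f x)%:E = - \int[N]_x (f x)%:E)%E.
  rewrite -[RHS]integralN; last exact: integrable_add_def.
  transitivity (\int[pushforward_measure N mT]_x (EFin \o f) x)%E.
    by apply: eq_measure_integral => A mA _; exact/esym/gaussP_sign.
  rewrite (integral_pushforward mT mfE iT)// preimage_setT.
  by apply: eq_integral => x _ /=; rewrite fodd.
have : (\int[N]_x (f x)%:E)%E \is a fin_num by exact: integrable_fin_num fi.
move: eN; case: (\int[N]_x (f x)%:E)%E => [r||]//= [rN] _.
by congr (_%:E); lra.
Qed.

Lemma gaussP_coord_second_moment j : (\int[N]_x (x ord0 j ^+ 2)%:E = v%:E)%E.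
Proof.
rewrite (@integral_gaussP_coord R n 0 v j (fun x => (x ^+ 2)%:E)).
- by rewrite mxE normal_prob_second_moment.
- by apply/measurable_EFinP; exact: measurable_funX.
- by move=> x; rewrite lee_fin sqr_ge0.
Qed.

End gaussP_odd.

Section square_integrable.
Context {R : realType} d (T : measurableType d) (P : probability T R).

Lemma integrable_mul_sqr (X Z : T -> R) :
  measurable_fun setT X -> measurable_fun setT Z ->
  (\int[P]_t (X t ^+ 2)%:E < +oo)%E -> (\int[P]_t (Z t ^+ 2)%:E < +oo)%E ->
  P.-integrable setT (fun t => (X t * Z t)%:E).
Proof.
move=> mX mZ X2 Z2; apply/integrableP; split.
  by apply/measurable_EFinP; exact: measurable_funM.
have mS (W : T -> R) : measurable_fun setT W -> measurable_fun setT (fun t => (W t ^+ 2)%:E).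
  by move=> mW; apply/measurable_EFinP; exact: measurable_funX.
apply: (@le_lt_trans _ _ (\int[P]_t ((X t ^+ 2)%:E + (Z t ^+ 2)%:E))%E).
  apply: ge0_le_integral => //.
  - by apply/measurable_EFinP; apply: measurableT_comp => //; exact: measurable_funM.
  - by apply: emeasurable_funD; exact: mS.
  - move=> t _; rewrite /= -EFinD lee_fin normrM.
    rewrite -(real_normK (num_real (X t))) -(real_normK (num_real (Z t))).
    have := sqr_ge0 (`|X t| - `|Z t|); have := normr_ge0 (X t); have := normr_ge0 (Z t); nra.
rewrite ge0_integralD//; last 4 first.
- by move=> t _; rewrite lee_fin sqr_ge0.
- exact: mS.
- by move=> t _; rewrite lee_fin sqr_ge0.
- exact: mS.
exact: lte_add_pinfty.
Qed.

Lemma integral_sqr_combination (I : finType) (X : I -> T -> R) (A : I -> I -> R)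
    (c : I -> R) (q : R) :
  (forall i, P.-integrable setT (EFin \o X i)) ->
  (forall i j, P.-integrable setT (fun t => (X i t * X j t)%:E)) ->
  (forall i, (\int[P]_t (X i t)%:E = 0)%E) ->
  (forall i j, (\int[P]_t (X i t * X j t)%:E = (A i j)%:E)%E) ->
  (\int[P]_t ((\sum_i c i * X i t - q) ^+ 2)%:E =
   (\sum_i \sum_j c i * c j * A i j + q ^+ 2)%:E)%E.
Proof.
move=> iX iXX X0 XA.
pose F1 t := (\sum_i \sum_j (c i * c j)%:E * (X i t * X j t)%:E)%E.
pose F2 t := (\sum_i (- (2 * q * c i))%:E * (X i t)%:E)%E.
have iF1i i : P.-integrable setT (fun t => \sum_j (c i * c j)%:E * (X i t * X j t)%:E)%E.
  by apply: integrable_sum => // j _; apply: integrableZl.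
have iF1 : P.-integrable setT F1 by apply: integrable_sum => // i _.
have iF2 : P.-integrable setT F2.
  by apply: integrable_sum => // i _; apply: integrableZl => //; exact: iX.
have iq : P.-integrable setT (cst (q ^+ 2)%:E) by exact: finite_measure_integrable_cst.
transitivity (\int[P]_t (F1 t + (F2 t + (q ^+ 2)%:E)))%E.
  apply: eq_integral => t _.
  have -> : (\sum_i c i * X i t - q) ^+ 2 =
      \sum_i \sum_j c i * c j * (X i t * X j t) +
      (\sum_i - (2 * q * c i) * X i t + q ^+ 2).
    rewrite sqrrB addrA; congr (_ + _ + _).
      rewrite expr2 big_distrlr/=; apply: eq_bigr => i _; apply: eq_bigr => j _.
      by ring.
    rewrite -mulr_natl mulr_suml mulr_sumr -sumrN; apply: eq_bigr => i _.
    by ring.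
  rewrite !EFinD -!sumEFin; congr (_ + (_ + _))%E.
  by apply: eq_bigr => i _; rewrite -sumEFin; apply: eq_bigr => j _; rewrite EFinM.
rewrite integralD//; last exact: integrableD.
rewrite integralD// integral_cst// [X in (_ * X)%E](_ : _ = 1%E); last exact: probability_setT.
rewrite mule1 EFinD; congr (_ + _)%E.
  rewrite integral_sum; [|exact: measurableT|exact: iF1i].
  rewrite -sumEFin; apply: eq_bigr => i _.
  rewrite integral_sum; [|exact: measurableT|by move=> j; exact: integrableZl].
  rewrite -sumEFin; apply: eq_bigr => j _.
  by rewrite integralZl// XA EFinM.
rewrite integral_sum; [|exact: measurableT|by move=> i; apply: integrableZl => //; exact: iX].
rewrite big1 ?add0e// => i _.
rewrite integralZl//; last exact: iX.
by rewrite X0 mule0.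
Qed.

End square_integrable.

Section randomization_moments.
Context {R : realType} (n K : nat) (sigma rho : R).
Context d (T : measurableType d) (P : probability T R).
Variable omega : 'I_K -> {RV P >-> 'rV[R]_n}.
Hypothesis sigma_gt0 : 0 < sigma.
Hypothesis omega_normal : exchangeable_normal sigma rho omega.
Notation N := (@gaussP R n 0 (sigma ^+ 2)).

Let v0 : 0 < sigma ^+ 2. Proof. exact: exprn_gt0. Qed.

Let momega k : measurable_fun setT (omega k). Proof. exact: measurable_funP. Qed.

Lemma omega_law k B : measurable B -> pushforward_measure P (momega k) B = N B.
Proof. by move=> mB; have [_ + _] := omega_normal; exact. Qed.

Lemma ge0_integral_omega k (f : 'rV[R]_n -> \bar R) : measurable_fun setT f ->
  (forall x, 0 <= f x)%E -> (\int[P]_t f (omega k t) = \int[N]_x f x)%E.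
Proof.
move=> mf f0; rewrite (ge0_integral_comp (momega k) P mf f0).
by apply: eq_measure_integral => A mA _; exact: omega_law.
Qed.

Definition noise (i : 'I_K * 'I_n) (t : T) : R := omega i.1 t ord0 i.2.

Lemma measurable_noise i : measurable_fun setT (noise i).
Proof. exact: (measurableT_comp (measurable_rV_coord i.2) (momega i.1)). Qed.

Lemma noise_second_moment i : (\int[P]_t (noise i t ^+ 2)%:E = (sigma ^+ 2)%:E)%E.
Proof.
rewrite (ge0_integral_omega i.1 (f := fun x => (x ord0 i.2 ^+ 2)%:E)).
- exact: gaussP_coord_second_moment.
- by apply/measurable_EFinP; apply: measurable_funX; exact: measurable_rV_coord.
- by move=> x; rewrite lee_fin sqr_ge0.
Qed.

Lemma noise_mul_integrable i j :
  P.-integrable setT (fun t => (noise i t * noise j t)%:E).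
Proof.
by apply: integrable_mul_sqr; [exact: measurable_noise|exact: measurable_noise|
  rewrite noise_second_moment ltry|rewrite noise_second_moment ltry].
Qed.

Lemma noise_integrable i : P.-integrable setT (EFin \o noise i).
Proof.
have -> : EFin \o noise i = (fun t => (noise i t * cst 1 t)%:E).
  by apply/funext => t /=; rewrite mulr1.
apply: integrable_mul_sqr; [exact: measurable_noise|exact: measurable_cst| |].
  by rewrite noise_second_moment ltry.
rewrite (eq_integral (cst 1%E)); last by move=> t _; rewrite /= expr1n.
rewrite integral_cst// mul1e.
by apply: (le_lt_trans (probability_le1 _ _)) => //; exact: ltry.
Qed.

(** Gives the means of the coordinates of one perturbation, and its covariances
    between different coordinates. *)
Lemma omega_odd k (e : 'I_n -> bool) (f : 'rV[R]_n -> R) :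
  measurable_fun setT f -> P.-integrable setT (fun t => (f (omega k t))%:E) ->
  (forall x, f (map_rV (fun i t => (-1) ^+ e i * t) x) = - f x) ->
  (\int[P]_t (f (omega k t))%:E = 0)%E.
Proof.
move=> mf fi fodd.
have mfE : measurable_fun setT (EFin \o f) by exact/measurable_EFinP.
have iN : N.-integrable setT (EFin \o f).
  apply/integrableP; split => //.
  have mfn : measurable_fun setT (fun x => `|(f x)%:E|)%E by exact: measurableT_comp.
  rewrite -(ge0_integral_omega k mfn)//.
  by have /integrableP[] := fi.
have := gaussP_odd v0 mf iN fodd; apply: etrans.
transitivity (\int[pushforward_measure P (momega k)]_x (f x)%:E)%E.
  rewrite (integral_pushforward (momega k) mfE); first by rewrite preimage_setT.
  - by rewrite preimage_setT.
  - exact: measurableT.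
by apply: eq_measure_integral => A mA _; exact: omega_law.
Qed.

Lemma noise_mean i : (\int[P]_t (noise i t)%:E = 0)%E.
Proof.
apply: (@omega_odd i.1 (fun=> true) (fun x => x ord0 i.2)).
- exact: measurable_rV_coord.
- exact: noise_integrable.
- by move=> x; rewrite mxE expr1 mulN1r.
Qed.

Definition noise_covariance (i j : 'I_K * 'I_n) : R :=
  (if i.1 == j.1 then 1 else rho) * sigma ^+ 2 * (i.2 == j.2)%:R.

(** For different perturbations this is the assumption on the covariances, and for
    a coordinate with itself the variance.  The product of two different
    coordinates of one perturbation is odd in the first of them. *)
Lemma noise_covarianceE i j :
  (\int[P]_t (noise i t * noise j t)%:E = (noise_covariance i j)%:E)%E.
Proof.
rewrite /noise_covariance; have [ij1|ij1] := eqVneq i.1 j.1; last first.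
  have [_ _ /(_ _ _ i.2 j.2 ij1)] := omega_normal; rewrite unlock => <-.
  rewrite unlock; apply: eq_integral => t _.
  have E0 l : fine (\int[P]_w (omega l.1 w ord0 l.2)%:E)%E = 0.
    by rewrite noise_mean.
  by rewrite !E0 !fctE /= !subr0.
have [ij2|ij2] := eqVneq i.2 j.2.
  rewrite mul1r mulr1 -(noise_second_moment i); apply: eq_integral => t _.
  by rewrite expr2; congr ((_ * _)%:E); rewrite /noise ij1 ij2.
rewrite mulr0.
have := @omega_odd i.1 (fun k => k == i.2) (fun x => x ord0 i.2 * x ord0 j.2).
have e : (fun t => (noise i t * noise j t)%:E) =
    (fun t => (omega i.1 t ord0 i.2 * omega i.1 t ord0 j.2)%:E).
  by apply/funext => t; rewrite /noise ij1.
rewrite e; apply.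
- by apply: measurable_funM; exact: measurable_rV_coord.
- by rewrite -e; exact: noise_mul_integrable.
- by move=> x; rewrite !mxE eqxx eq_sym (negbTE ij2) expr1 expr0 mul1r mulN1r mulNr.
Qed.

(** The variance of each coordinate of the average perturbation; it vanishes
    exactly for rho = -1/(K-1). *)
Definition mean_noise_variance : R :=
  sigma ^+ 2 * (1 + (K%:R - 1) * rho) / K%:R.

Let linear_form (b : R) (G : 'rV[R]_n) (t : T) :=
  b * \sum_(k < K) dotv (omega k t) G.

Let linear_formE b G t :
  linear_form b G t = \sum_i (b * G ord0 i.2) * noise i t.
Proof.
rewrite /linear_form mulr_sumr (eq_bigr (fun k : 'I_K =>
    \sum_(j < n) (b * G ord0 j) * noise (k, j) t)); last first.
  by move=> k _; rewrite /dotv mulr_sumr; apply: eq_bigr => j _; rewrite /noise/=; ring.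
by rewrite pair_big/=; apply: eq_bigr => -[k j].
Qed.

(** Only the covariances of the perturbations matter, not their joint law.  The
    shift q shows that the linear form is centred, in the form that
    expected_frozen_variance_lower uses. *)
Lemma linear_form_second_moment b G q :
  (\int[P]_t ((b * \sum_(k < K) dotv (omega k t) G - q) ^+ 2)%:E =
   ((b * K%:R) ^+ 2 * mean_noise_variance * sqn G + q ^+ 2)%:E)%E.
Proof.
transitivity (\int[P]_t ((\sum_i (b * G ord0 i.2) * noise i t - q) ^+ 2)%:E)%E.
  by apply: eq_integral => t _; rewrite -linear_formE.
rewrite (integral_sqr_combination (A := noise_covariance))//; last 4 first.
- exact: noise_integrable.
- exact: noise_mul_integrable.
- exact: noise_mean.
- exact: noise_covarianceE.
congr ((_ + _)%:E).
have -> : \sum_i \sum_j b * G ord0 i.2 * (b * G ord0 j.2) * noise_covariance i j =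
   \sum_(i : 'I_K * 'I_n) b ^+ 2 * sigma ^+ 2 * (1 + (K%:R - 1) * rho) * G ord0 i.2 ^+ 2.
  apply: eq_bigr => -[k j] _ /=.
  rewrite (eq_bigr (fun i : 'I_K * 'I_n => (fun k' j' => b * G ord0 j * (b * G ord0 j') *
     ((if k == k' then 1 else rho) * sigma ^+ 2 * (j == j')%:R)) i.1 i.2)); last by move=> [].
  rewrite -(pair_bigA _ (fun k' j' => b * G ord0 j * (b * G ord0 j') *
     ((if k == k' then 1 else rho) * sigma ^+ 2 * (j == j')%:R)))/=.
  rewrite (eq_bigr (fun k' => b ^+ 2 * sigma ^+ 2 * G ord0 j ^+ 2 *
    (if k == k' then 1 else rho))); last first.
    move=> k' _; rewrite (bigD1 j)//= eqxx mulr1 big1 ?addr0.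
      by case: (k == k'); ring.
    by move=> j' /negbTE; rewrite eq_sym => ->; rewrite !mulr0.
  rewrite -mulr_sumr (bigD1 k)//= eqxx (eq_bigr (fun=> rho)); last first.
    by move=> k' /negbTE; rewrite eq_sym => ->.
  rewrite sumr_const cardC1 card_ord -[rho *+ _]mulr_natl.
  have -> : K.-1%:R = K%:R - 1 :> R.
    by case: (K) k => [[]//|K' _]; rewrite -natr1 addrK.
  by ring.
rewrite -(pair_bigA _ (fun (k : 'I_K) (j : 'I_n) =>
  b ^+ 2 * sigma ^+ 2 * (1 + (K%:R - 1) * rho) * G ord0 j ^+ 2))/=.
rewrite sumr_const card_ord -mulr_sumr -/(sqn G) -[_ *+ K]mulr_natl /mean_noise_variance.
have [->|K0] := eqVneq K 0%N; first by rewrite !mul0r mulr0 expr0n !mul0r.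
by field; rewrite pnatr_eq0.
Qed.

End randomization_moments.

(** * Decomposition of the cross-validation estimator *)

(** Expanding the square: the noise terms of order alpha^-1 cancel, and the
    cross term splits into its value at y and an increment of g. *)
Lemma fold_decomposition {R : realType} n (g : 'rV[R]_n -> 'rV[R]_n) (s : R)
    (y w : 'rV[R]_n) : 0 < s ->
  l2norm (g (y + s *: w) - (y - s^-1 *: w)) ^+ 2 - (s ^+ 2)^-1 * l2norm w ^+ 2 =
  fold_residual g s (y, w) + 2 / s * dotv w (g y - y).
Proof.
move=> s0; rewrite !l2norm_rV_sqr /fold_residual/=; set y' := y + s *: w.
have -> : g y' - (y - s^-1 *: w) = (g y' - y) + s^-1 *: w.
  by rewrite opprB addrCA addrC addrAC -addrA.
have -> : sqn (g y' - y + s^-1 *: w) =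
    sqn (g y' - y) + 2 / s * dotv w (g y' - y) + (s ^+ 2)^-1 * sqn w.
  rewrite /sqn /dotv !mulr_sumr -!big_split/=; apply: eq_bigr => j _.
  have -> : (g y' - y + s^-1 *: w) ord0 j = (g y' - y) ord0 j + s^-1 * w ord0 j.
    by rewrite mxE [(s^-1 *: w) _ _]mxE.
  by field; rewrite gt_eqF.
have -> : g y' - y = (g y' - g y) + (g y - y) by rewrite addrA subrK.
by rewrite dotvDr; ring.
Qed.

Lemma near0_sqrt {R : realType} (Q : R -> Prop) :
  (\forall s \near 0^'+, Q s) -> \forall a \near 0^'+, Q (Num.sqrt a).
Proof.
move=> [e /= e0 he]; exists (e ^+ 2) => /=; first exact: exprn_gt0.
move=> a /=; rewrite sub0r normrN => ae a0; apply: he => /=; last by rewrite sqrtr_gt0.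
rewrite sub0r normrN ger0_norm ?sqrtr_ge0// -[ltRHS]ger0_norm ?(ltW e0)// -sqrtr_sqr.
by rewrite ltr_sqrt ?exprn_gt0// (le_lt_trans (ler_norm a)).
Qed.

Section assembly.
Context {R : realType} (n K m : nat) (mu : 'rV[R]_n) (sigma rho : R).
Hypothesis K_ge2 : (2 <= K)%N.
Hypothesis rho_ge : - (K%:R - 1)^-1 <= rho.
Hypothesis sigma_gt0 : 0 < sigma.
Context d (T : measurableType d) (P : probability T R).
Variables (Y : {RV P >-> 'rV[R]_n}) (omega : 'I_K -> {RV P >-> 'rV[R]_n}).
Hypothesis Y_normal : forall B, measurable B ->
  distribution P Y B = normal_rV mu (sigma ^+ 2) B.
Hypothesis omega_normal : exchangeable_normal sigma rho omega.
Hypothesis Y_omega_indep : independent_joint P Y omega.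
Variables (f0 : 'rV[R]_n -> 'rV[R]_n) (a : 'I_m -> 'rV[R]_n -> 'rV[R]_n).
Variable h : 'I_m -> 'rV[R]_n -> R.
Hypothesis smooth : piecewise_smooth P Y mu sigma f0 a h.
Variable g : 'rV[R]_n -> 'rV[R]_n.
Hypothesis gE : forall y, g y = f0 y + \sum_l (0 < h l y)%R%:R *: a l y.

Let v0 : 0 < sigma ^+ 2. Proof. exact: exprn_gt0. Qed.
Let K0 : (0 < K)%N. Proof. exact: ltnW. Qed.
Let mY : measurable_fun setT Y. Proof. exact: measurable_funP. Qed.
Let lawY B : measurable B -> P (Y @^-1` B) = gaussP mu (sigma ^+ 2) B.
Proof. exact: Y_normal. Qed.
Let mg : measurable_fun setT g. Proof. exact: (measurable_piecewise smooth gE). Qed.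

Notation tup := (K.-tuple 'rV[R]_n).

Let mjoint : measurable_fun setT (joint omega : T -> tup).
Proof.
apply/measurable_fun_tnthP => k.
rewrite (_ : _ \o _ = omega k); first exact: measurable_funP.
by apply/funext => t /=; rewrite tnth_mktuple.
Qed.

Let X : {mfun T >-> tup} :=
  HB.pack (joint omega : T -> tup)
    (isMeasurableFun.Build _ _ _ _ (joint omega : T -> tup) mjoint).

Let tnthX t k : tnth (X t) k = omega k t.
Proof. by rewrite tnth_mktuple. Qed.

(** The estimator as a function of Y and of the tuple of perturbations. *)
Definition CV_fun (alpha : R) (z : 'rV[R]_n * tup) : R :=
  K%:R^-1 * \sum_(k < K)
    (l2norm (g (z.1 + Num.sqrt alpha *: tnth z.2 k) -
             (z.1 - (Num.sqrt alpha)^-1 *: tnth z.2 k)) ^+ 2 -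
     alpha^-1 * l2norm (tnth z.2 k) ^+ 2).

Let CVE alpha : CV g Y omega alpha = (fun t => CV_fun alpha (Y t, X t)).
Proof.
apply/funext => t; congr (_ * _); apply: eq_bigr => k _.
by rewrite /= tnth_mktuple.
Qed.

Let mtnth k : measurable_fun setT (fun z : 'rV[R]_n * tup => tnth z.2 k).
Proof. exact: (measurableT_comp (measurable_tnth k) measurable_snd). Qed.

Definition CV_linear (s : R) (z : 'rV[R]_n * tup) : R :=
  (2 / s / K%:R) * \sum_(k < K) dotv (tnth z.2 k) (g z.1 - z.1).

Definition CV_residual (s : R) (z : 'rV[R]_n * tup) : R :=
  K%:R^-1 * \sum_(k < K) fold_residual g s (z.1, tnth z.2 k).

Let CV_funE s z : 0 < s -> CV_fun (s ^+ 2) z = CV_linear s z + CV_residual s z.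
Proof.
move=> s0; rewrite /CV_fun sqrtr_sqr gtr0_norm//.
under eq_bigr do rewrite fold_decomposition//.
by rewrite big_split/= -mulr_sumr /CV_linear /CV_residual; ring.
Qed.

Let mgsub : measurable_fun setT (fun z : 'rV[R]_n * tup => g z.1 - z.1).
Proof.
apply: measurable_rVB; last exact: measurable_fst.
exact: (measurableT_comp mg measurable_fst).
Qed.

Let mlinear s : measurable_fun setT (CV_linear s).
Proof.
apply: measurable_funM => //; apply: measurable_sum => k.
by apply: measurable_dotv.
Qed.

Let mfold k s : measurable_fun setT
  (fun z : 'rV[R]_n * tup => fold_residual g s (z.1, tnth z.2 k)).
Proof.
apply: (measurableT_comp (measurable_fold_residual smooth gE s)).
by apply: measurable_fun_pair => //; exact: measurable_fst.
Qed.

Let mresidual s : measurable_fun setT (CV_residual s).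
Proof. by apply: measurable_funM => //; apply: measurable_sum => k. Qed.

Let indep A B : measurable A -> measurable B ->
  (P ((Y @^-1` A) `&` (X @^-1` B)) = P (Y @^-1` A) * P (X @^-1` B))%E.
Proof. exact: Y_omega_indep. Qed.

Lemma integral_pair_law k (f : 'rV[R]_n * 'rV[R]_n -> \bar R) :
  measurable_fun setT f -> (forall z, 0 <= f z)%E ->
  (\int[P]_t f (Y t, omega k t) = \int[gauss_pair mu (sigma ^+ 2)]_z f z)%E.
Proof.
move=> mf fge0.
pose F (z : 'rV[R]_n * tup) := f (z.1, tnth z.2 k).
have mF : measurable_fun setT F.
  apply: (measurableT_comp mf); apply: measurable_fun_pair => //.
transitivity (\int[P]_t F (Y t, X t))%E.
  by apply: eq_integral => t _; rewrite /F/= tnth_mktuple.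
rewrite (ge0_integral_indep indep mF); last by move=> z; exact: fge0.
rewrite (integral_gauss_pair_swap _ _ mf fge0).
transitivity (\int[distribution P Y]_y \int[gaussP 0 (sigma ^+ 2)]_w f (y, w))%E; last first.
  by apply: eq_measure_integral => B mB _; exact: lawY.
apply: eq_integral => y _.
have mfy : measurable_fun setT (fun w => f (y, w)).
  exact: (measurableT_comp mf (measurable_pair1 y)).
have mfu : measurable_fun setT (fun u : tup => f (y, tnth u k)).
  exact: (measurableT_comp mfy (measurable_tnth k)).
rewrite -(ge0_integral_omega omega_normal k mfy) //.
transitivity (\int[P]_t f (y, tnth (X t) k))%E; last first.
  by apply: eq_integral => t _; rewrite tnthX.
by rewrite (ge0_integral_comp mjoint P mfu).
Qed.

(** By convexity of the square it suffices to bound the residual of each fold,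
    whatever the dependence between the folds. *)
Lemma CV_residual_bound : exists2 C : R, 0 <= C & \forall s \near 0^'+,
  (\int[P]_t (CV_residual s (Y t, X t) ^+ 2)%:E <= (C * s^-1)%:E)%E.
Proof.
have [C C0 hC] := fold_residual_bigO sigma_gt0 mY lawY smooth gE.
exists C => //; apply: filterS hC => s hs.
have Kn0 : K%:R != 0 :> R by rewrite pnatr_eq0 -lt0n.
have mf2 : measurable_fun setT (fun z => (fold_residual g s z ^+ 2)%:E).
  apply/measurable_EFinP; apply: measurable_funX.
  exact: (measurable_fold_residual smooth gE s).
have f20 z : (0 <= (fold_residual g s z ^+ 2)%:E)%E by rewrite lee_fin sqr_ge0.
have mYo k : measurable_fun setT (fun t => (fold_residual g s (Y t, omega k t) ^+ 2)%:E).
  have mk : measurable_fun setT (omega k) by exact: measurable_funP.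
  exact: (measurableT_comp mf2 (measurable_fun_pair mY mk)).
apply: (@le_trans _ _ (\int[P]_t ((K%:R^-1)%:E *
    \sum_(k < K) (fold_residual g s (Y t, omega k t) ^+ 2)%:E))%E).
  apply: ge0_le_integral => //.
  - by move=> t _; rewrite lee_fin sqr_ge0.
  - apply/measurable_EFinP; apply: measurable_funX; apply: (measurableT_comp (mresidual s)).
    exact: measurable_fun_pair.
  - by apply: measurable_funeM; exact: emeasurable_sum.
  move=> t _; rewrite sumEFin -EFinM lee_fin /CV_residual exprMn/=.
  under eq_bigr do rewrite tnth_mktuple.
  have hK := sum_sqr_le (fun k => fold_residual g s (Y t, omega k t)).
  apply: (le_trans (ler_wpM2l _ hK)); first exact: sqr_ge0.
  by rewrite le_eqVlt; apply/orP; left; apply/eqP; field.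
rewrite ge0_integralZl; [|exact: measurableT|by apply: emeasurable_sum|
  by move=> t _; apply: sume_ge0 => k _; rewrite lee_fin sqr_ge0|by rewrite lee_fin invr_ge0].
rewrite ge0_integral_sum; [|exact: measurableT|exact: mYo|
  by move=> k t _; rewrite lee_fin sqr_ge0].
apply: (@le_trans _ _ ((K%:R^-1)%:E * \sum_(k < K) (C * s^-1)%:E)%E).
  apply: lee_wpmul2l; first by rewrite lee_fin invr_ge0.
  apply: lee_sum => k _; rewrite (integral_pair_law k mf2 f20); exact: hs.
rewrite sumEFin sumr_const card_ord -EFinM.
by rewrite mulrnAr -[_ *+ K]mulr_natl mulrA divff// mul1r.
Qed.

Notation lambda := (mean_noise_variance K sigma rho).

Lemma mean_noise_variance_ge0 : 0 <= lambda.
Proof.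
have K1 : 0 < K%:R - 1 :> R by rewrite subr_gt0 ltr1n.
rewrite /mean_noise_variance divr_ge0// mulr_ge0 ?(ltW v0)//.
have := ler_wpM2l (ltW K1) rho_ge; rewrite mulrN divff ?gt_eqF//; lra.
Qed.

Definition mean_sqr_displacement : R := fine (\int[gaussP mu (sigma ^+ 2)]_y (sqn (g y - y))%:E)%E.

Let msub : measurable_fun setT (fun y => (sqn (g y - y))%:E).
Proof.
apply/measurable_EFinP; apply: measurable_sqn; by apply: measurable_rVB.
Qed.

Lemma mean_sqr_displacementE :
  (\int[gaussP mu (sigma ^+ 2)]_y (sqn (g y - y))%:E = mean_sqr_displacement%:E)%E.
Proof.
rewrite /mean_sqr_displacement fineK// ge0_fin_numE.
  exact: (piecewise_sub_fin sigma_gt0 smooth gE).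
by apply: integral_ge0 => y _; rewrite lee_fin sqn_ge0.
Qed.

Lemma mean_sqr_displacement_ge0 : 0 <= mean_sqr_displacement.
Proof. by apply: fine_ge0; apply: integral_ge0 => y _; rewrite lee_fin sqn_ge0. Qed.

Let frozen_linear s y q :
  (\int[distribution P X]_u ((CV_linear s (y, u) - q) ^+ 2)%:E =
   ((2 / s) ^+ 2 * lambda * sqn (g y - y) + q ^+ 2)%:E)%E.
Proof.
have mu2 : measurable_fun setT (fun u : tup => ((CV_linear s (y, u) - q) ^+ 2)%:E).
  apply/measurable_EFinP; apply: measurable_funX; apply: measurable_funB => //.
  exact: (measurableT_comp (mlinear s) (measurable_pair1 y)).
transitivity (\int[P]_t ((CV_linear s (y, X t) - q) ^+ 2)%:E)%E.
  by rewrite (ge0_integral_comp mjoint P mu2)// => u; rewrite lee_fin sqr_ge0.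
have Kn0 : K%:R != 0 :> R by rewrite pnatr_eq0 -lt0n.
have := linear_form_second_moment sigma_gt0 omega_normal (2 / s / K%:R) (g y - y) q.
rewrite divfK// => <-; apply: eq_integral => t _.
rewrite /CV_linear/=; congr ((( _ * _ - _) ^+ 2)%:E).
by apply: eq_bigr => k _; rewrite tnth_mktuple.
Qed.

Lemma CV_linear_second_moment s :
  (\int[P]_t (CV_linear s (Y t, X t) ^+ 2)%:E =
   ((2 / s) ^+ 2 * lambda * mean_sqr_displacement)%:E)%E.
Proof.
have ml2 : measurable_fun setT (fun z => (CV_linear s z ^+ 2)%:E).
  by apply/measurable_EFinP; apply: measurable_funX; exact: mlinear.
have l0 : 0 <= (2 / s) ^+ 2 * lambda.
  by rewrite mulr_ge0 ?sqr_ge0 ?mean_noise_variance_ge0.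
rewrite (ge0_integral_indep indep ml2); last by move=> z; rewrite lee_fin sqr_ge0.
transitivity (\int[gaussP mu (sigma ^+ 2)]_y
    (((2 / s) ^+ 2 * lambda)%:E * (sqn (g y - y))%:E))%E.
  transitivity (\int[distribution P Y]_y
    (((2 / s) ^+ 2 * lambda)%:E * (sqn (g y - y))%:E))%E.
    apply: eq_integral => y _.
    have := frozen_linear s y 0; rewrite expr0n addr0 -EFinM => <-.
    by apply: eq_integral => u _; rewrite subr0.
  by apply: eq_measure_integral => B mB _; exact: lawY.
rewrite ge0_integralZl; [|exact: measurableT|exact: msub|
  by move=> y _; rewrite lee_fin sqn_ge0|by rewrite lee_fin].
by rewrite mean_sqr_displacementE -EFinM.
Qed.

Let V alpha := expected_frozen_variance P Y X (CV_fun alpha).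

Let mCV alpha : measurable_fun setT (CV_fun alpha).
Proof.
apply: measurable_funM => //; apply: measurable_sum => k.
have mu1 s : measurable_fun setT (fun z : 'rV[R]_n * tup => s *: tnth z.2 k).
  by apply: measurable_rVZ.
apply: measurable_funB.
  apply: measurable_funX; apply: measurable_l2norm; apply: measurable_rVB.
    by apply: (measurableT_comp mg); apply: measurable_rVD.
  by apply: measurable_rVB.
apply: measurable_funM => //; apply: measurable_funX.
exact: measurable_l2norm.
Qed.

Let integral_CV_le C s : 0 < s -> 0 <= C ->
  (\int[P]_t (CV_residual s (Y t, X t) ^+ 2)%:E <= (C * s^-1)%:E)%E ->
  (\int[P]_t (CV_fun (s ^+ 2) (Y t, X t) ^+ 2)%:E <=
   (2 * ((2 / s) ^+ 2 * lambda * mean_sqr_displacement) + 2 * (C * s^-1))%:E)%E.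
Proof.
move=> s0 C0 hC.
have mYX : measurable_fun setT (fun t => (Y t, X t)).
  exact: measurable_fun_pair.
have mS (F : 'rV[R]_n * tup -> R) : measurable_fun setT F ->
    measurable_fun setT (fun t => (F (Y t, X t) ^+ 2)%:E).
  move=> mF; apply/measurable_EFinP; apply: measurable_funX.
  exact: (measurableT_comp mF mYX).
have s2 (x : R) : (0 <= (x ^+ 2)%:E)%E by rewrite lee_fin sqr_ge0.
apply: (@le_trans _ _ (\int[P]_t (2%:E * (CV_linear s (Y t, X t) ^+ 2)%:E +
    2%:E * (CV_residual s (Y t, X t) ^+ 2)%:E))%E).
  apply: ge0_le_integral.
  - exact: measurableT.
  - by move=> t _; exact: s2.
  - exact: mS.
  - by apply: emeasurable_funD; apply: measurable_funeM; exact: mS.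
  move=> t _; rewrite -!EFinM -EFinD lee_fin CV_funE//.
  have := sqr_ge0 (CV_linear s (Y t, X t) - CV_residual s (Y t, X t)); nra.
rewrite ge0_integralD; [|exact: measurableT| | | |].
- rewrite !ge0_integralZl; [|by []|exact: mS|by move=> t _; exact: s2|by []
    |by []|exact: mS|by move=> t _; exact: s2|by []].
  rewrite CV_linear_second_moment [X in (_ <= X)%E]EFinD; apply: leeD => //.
  by rewrite [X in (_ <= X)%E]EFinM; apply: lee_wpmul2l.
- by move=> t _; rewrite mule_ge0.
- by apply: measurable_funeM; exact: mS.
- by move=> t _; rewrite mule_ge0.
- by apply: measurable_funeM; exact: mS.
Qed.

(** The upper bound is V <= 4 E[CV^2] with CV^2 at most twice the squares of its
    two parts, and 32 = 4 * 2 * 4.  For the lower bound M is the linear part. *)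
Lemma expected_variance_bounds : exists (V : R -> R) (C : R), 0 <= C /\
  \forall alpha \near 0^'+,
  [/\ is_expected_cond_variance P Y (CV g Y omega alpha) (V alpha),
      0 <= V alpha,
      V alpha <= 32 * lambda * mean_sqr_displacement * alpha^-1 + C * (Num.sqrt alpha)^-1 &
      4 * lambda * mean_sqr_displacement * alpha^-1 <=
        2 * V alpha + C * (Num.sqrt alpha)^-1].
Proof.
have [C C0 hC] := CV_residual_bound; exists V, (8 * C); split.
  exact: mulr_ge0.
apply: filterS2 near0_gt0 (near0_sqrt hC) => alpha a0 hs.
set s := Num.sqrt alpha in hs *; have s0 : 0 < s by rewrite sqrtr_gt0.
have sE : s ^+ 2 = alpha by rewrite sqr_sqrtr// ltW.
have hCV := integral_CV_le s0 C0 hs; rewrite sE in hCV.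
have CVoo : (\int[P]_t (CV_fun alpha (Y t, X t) ^+ 2)%:E < +oo)%E.
  exact: le_lt_trans hCV (ltry _).
have sl : (2 / s) ^+ 2 = 4 * alpha^-1.
  by rewrite -sE; field; rewrite gt_eqF.
have Cs0 : 0 <= C * s^-1 by rewrite mulr_ge0// invr_ge0 ltW.
split.
- rewrite CVE; exact: is_expected_frozen_variance.
- rewrite -lee_fin /V expected_frozen_varianceE//.
  by apply: integral_ge0 => t _; rewrite lee_fin sqr_ge0.
- rewrite -lee_fin /V expected_frozen_varianceE//.
  apply: (le_trans (expected_frozen_variance_le indep (mCV alpha) CVoo)).
  apply: (le_trans (lee_wpmul2l _ hCV)) => //.
  by rewrite -EFinM lee_fin sl; lra.
have hM y q : (\int[distribution P X]_u (CV_linear s (y, u) ^+ 2)%:E <=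
    \int[distribution P X]_u ((CV_linear s (y, u) - q) ^+ 2)%:E)%E.
  rewrite frozen_linear.
  have := frozen_linear s y 0; under eq_integral do rewrite subr0.
  by move=> ->; rewrite lee_fin expr0n addr0 lerDl sqr_ge0.
have := expected_frozen_variance_lower indep (mCV alpha) CVoo (mlinear s) hM.
rewrite CV_linear_second_moment sl => lower; rewrite -lee_fin.
rewrite (_ : 4 * lambda * mean_sqr_displacement / alpha =
  4 / alpha * lambda * mean_sqr_displacement); last by ring.
apply: (le_trans lower); rewrite [X in (_ <= X)%E]EFinD; apply: leeD => //.
rewrite (_ : (8 * C * s^-1)%:E = (4%:E * (2%:E * (C * s^-1)%:E)))%E; last first.
  by rewrite -!EFinM; congr (_%:E); ring.
apply: (@le_trans _ _ (2%:E * (C * s^-1)%:E)%E); last first.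
  by rewrite -!EFinM lee_fin; lra.
apply: lee_wpmul2l => //; apply: le_trans hs.
rewrite le_eqVlt; apply/orP; left; apply/eqP; apply: eq_integral => t _.
by rewrite -sE CV_funE// addrAC subrr add0r.
Qed.

End assembly.

Theorem theorem5p1 (R : realType) (n K m : nat)
  (n_ge1 : (1 <= n)%N) (K_ge2 : (2 <= K)%N) (m_ge1 : (1 <= m)%N)
  (mu : 'rV[R]_n) (sigma : R) (sigma_gt0 : 0 < sigma)
  (rho : R) (rho_ge : - (K%:R - 1)^-1 <= rho) (rho_le : rho <= 1)
  (d : measure_display) (T : measurableType d) (P : probability T R)
  (Y : {RV P >-> 'rV[R]_n}) (omega : 'I_K -> {RV P >-> 'rV[R]_n})
  (Y_normal : forall B, measurable B ->
    distribution P Y B = normal_rV mu (sigma ^+ 2) B)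
  (omega_normal : exchangeable_normal sigma rho omega)
  (Y_omega_indep : independent_joint P Y omega)
  (f0 : 'rV[R]_n -> 'rV[R]_n) (a : 'I_m -> 'rV[R]_n -> 'rV[R]_n)
  (h : 'I_m -> 'rV[R]_n -> R)
  (smooth : piecewise_smooth P Y mu sigma f0 a h)
  (g : 'rV[R]_n -> 'rV[R]_n)
  (gE : forall y, g y = f0 y + \sum_l (0 < h l y)%R%:R *: a l y)
  (g_neq_id : ('E_P[fun w => (l2norm (g (Y w) - Y w) ^+ 2)%R] > 0)%E) :
  exists V : R -> R,
  [/\ \forall alpha \near 0^'+,
        is_expected_cond_variance P Y (CV g Y omega alpha) (V alpha),
      rho = - (K%:R - 1)^-1 -> V =O_ (0^'+) (fun alpha => alpha `^ (- 2^-1)) &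
      - (K%:R - 1)^-1 < rho -> V \is 'Theta_(0^'+) (fun alpha : R => alpha^-1)].
Proof.
have [V [C [C0 hV]]] := expected_variance_bounds K_ge2 rho_ge sigma_gt0 Y_normal
  omega_normal Y_omega_indep smooth gE.
set lambda := mean_noise_variance K sigma rho in hV.
set e0 := mean_sqr_displacement mu sigma g in hV.
have lambda0 : 0 <= lambda by exact: mean_noise_variance_ge0.
have e00 : 0 <= e0 by exact: mean_sqr_displacement_ge0.
have K1 : 0 < K%:R - 1 :> R by rewrite subr_gt0 ltr1n.
exists V; split.
- by apply: filterS hV => alpha [].
- move=> rhoE; have l0 : lambda = 0.
    rewrite /lambda /mean_noise_variance rhoE mulrN divff ?gt_eqF//.
    by rewrite subrr mulr0 mul0r.
  apply/eqO_exP; exists (C + 1); first by rewrite ltr_wpDl.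
  apply: filterS2 near0_gt0 hV => alpha a0 [_ V0 + _].
  rewrite l0 mulr0 !mul0r add0r powRN powR12_sqrt ?(ltW a0)// => VC.
  have s0 : 0 <= (Num.sqrt alpha)^-1 by rewrite invr_ge0 sqrtr_ge0.
  by rewrite !ger0_norm// (le_trans VC)// ler_wpM2r// lerDl.
move=> rho_gt.
have l0 : 0 < lambda.
  rewrite /lambda /mean_noise_variance divr_gt0 ?ltr0n ?(ltnW K_ge2)//.
  rewrite mulr_gt0 ?exprn_gt0//.
  have : (K%:R - 1) * - (K%:R - 1)^-1 < (K%:R - 1) * rho by rewrite ltr_pM2l.
  by rewrite mulrN divff ?gt_eqF//; lra.
have egt0 : 0 < e0.
  rewrite lt_neqAle e00 andbT eq_sym; apply: contraTneq g_neq_id => e0E.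
  rewrite -leNgt unlock.
  have msub : measurable_fun [set: 'rV[R]_n] (fun y => (sqn (g y - y))%:E).
    apply/measurable_EFinP; apply: measurable_sqn; apply: measurable_rVB.
      exact: (measurable_piecewise smooth gE).
    exact: measurable_id.
  rewrite (eq_integral (fun w => (sqn (g (Y w) - Y w))%:E)); last first.
    by move=> w _; rewrite l2norm_rV_sqr.
  have mY : measurable_fun setT Y by exact: measurable_funP.
  rewrite (ge0_integral_comp mY P msub); last by move=> y; rewrite lee_fin sqn_ge0.
  rewrite (eq_measure_integral (gaussP mu (sigma ^+ 2))); last first.
    by move=> A mA _; exact: Y_normal.
  by rewrite (mean_sqr_displacementE sigma_gt0 smooth gE) -/e0 e0E.
rewrite qualifE; apply/asboolP.
(* in the lower bound the error C / s is at most half of 4 lambda e0 / s^2 as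
   soon as C s <= 2 lambda e0; in the upper bound 1 / s <= 1 / s^2 *)
exists (lambda * e0, 32 * lambda * e0 + C) => /=.
  have := mulr_gt0 l0 egt0 => le0.
  by rewrite le0/= ltr_wpDr// -mulrA; apply: mulr_gt0.
have le0 : 0 < 2 * lambda * e0 / (C + 1).
  apply: divr_gt0; last by rewrite ltr_wpDl.
  by rewrite -mulrA; apply: mulr_gt0 => //; exact: mulr_gt0.
have hs := near0_sqrt (near0_le le0).
have hs1 := near0_sqrt (near0_le (ltr01 : 0 < 1 :> R)).
apply: filterS3 hs hs1 hV => alpha /andP[s0 sC] /andP[_ s1] [_ V0 Vup Vlow].
set s := Num.sqrt alpha in s0 sC s1 Vup Vlow.
have a0 : 0 < alpha by move: s0; rewrite sqrtr_gt0.
have aE : alpha^-1 = s^-1 * s^-1.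
  by rewrite -invfM -expr2 sqr_sqrtr// ltW.
have si : 0 < s^-1 by rewrite invr_gt0.
have si1 : 1 <= s^-1 by rewrite invf_ge1.
rewrite !ger0_norm ?invr_ge0 ?(ltW a0)//; split.
  have sC' : s * (C + 1) <= 2 * lambda * e0 by rewrite -ler_pdivlMr ?ltr_wpDl.
  have Cs : C * s^-1 <= 2 * lambda * e0 * alpha^-1.
    rewrite aE mulrA ler_wpM2r ?(ltW si)// ler_pdivlMr//.
    by rewrite (le_trans _ sC')// mulrC ler_wpM2l ?(ltW s0)// lerDl.
  move: Vlow Cs; rewrite -!mulrA; lra.
apply: (le_trans Vup); rewrite [leRHS]mulrDl lerD2l ler_wpM2l//.
by rewrite aE ler_peMr// ltW.
Qed.
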